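(* Let $c>0$, $k>\frac16$ and $s=\mathrm{sgn}(k)=1$. Let $U_0(\xi)=3c\,\mathrm{sech}^2\left(\frac{\sqrt c}{2}\xi\right)$, $$\widetilde\Omega_c=-\frac{c}{16}\left(\sqrt{1+48k}-3\right)^2,\qquad \tilde g(\xi)=\mathrm{sech}^q\left(\frac{\sqrt c}{2}\xi\right)\tanh\left(\frac{\sqrt c}{2}\xi\right),\quad q=\frac{\sqrt{1+48k}-3}{2},$$ and $L_1=-\partial_\xi^2+c-U_0$. Assume $\langle\tilde g^2,L_1^{-1}\tilde g^2\rangle\ne0$. Then there exist $\varepsilon>0$ and an $\Omega$-independent constant $C>0$ such that for every $\Omega<0$ with $0<|\Omega-\widetilde\Omega_c|<\varepsilon$ and $$\mathrm{sgn}(\Omega-\widetilde\Omega_c)=-\mathrm{sgn}\left(\langle\tilde g^2,L_1^{-1}\tilde g^2\rangle\right),$$ there exists a solution $(U,A)\in H^2_{\rm even}(\mathbb{R})\times H^2_{\rm odd}(\mathbb{R})$ with $A\neq0$ of the system $$U''-cU+\tfrac12U^2+sA^2=0,\qquad A''+(\Omega+kU)A=0,$$ satisfying $$\|U-U_0\|_{H^2}\le C|\Omega-\widetilde\Omega_c|,\qquad\|A\|_{H^2}\le C\sqrt{|\Omega-\widetilde\Omega_c|},$$ and this solution is unique up to the sign change $A\mapsto-A$.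
   Context: $H^2_{\rm even}(\mathbb{R})$ and $H^2_{\rm odd}(\mathbb{R})$ are the subspaces of even and odd functions in the real Sobolev space $H^2(\mathbb{R})$, and $\langle\cdot,\cdot\rangle$ is the $L^2(\mathbb{R})$ inner product. The operator $L_1$ on $L^2(\mathbb{R})$ with domain $H^2(\mathbb{R})$ has kernel spanned by the odd function $U_0'$; $L_1^{-1}$ denotes its bounded inverse on the subspace of even functions. *)

(* Defs.v *)
From HB Require Import structures.
From mathcomp Require Import all_boot all_order all_algebra.
From mathcomp Require Import all_classical all_reals all_analysis.

Set Implicit Arguments.
Unset Strict Implicit.
Unset Printing Implicit Defensive.
Import Order.TTheory GRing.Theory Num.Theory.
Import numFieldNormedType.Exports.
Local Open Scope classical_set_scope.
Local Open Scope ring_scope.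

(* Elements of L^2(R) and H^2(R) are represented by functions [R -> R]; every
   identity between such elements is taken almost everywhere. *)

Notation lmeas R := (@lebesgue_measure R).

Definition inL2 (R : realType) (u : R -> R) : Prop :=
  u \in Lfun (lmeas R) 2%:E.

Definition ip (R : realType) (u v : R -> R) : R :=
  \int[lmeas R]_x (u x * v x).

Definition test_function (R : realType) (phi : R -> R) : Prop :=
  (forall n x, derivable (derive1n n phi) x 1) /\
  compact (closure [set x : R | phi x != 0]).

Definition weak_derivative (R : realType) (u v : R -> R) : Prop :=
  [/\ locally_integrable [set: R] u, locally_integrable [set: R] v &
      forall phi : R -> R, test_function phi ->
        \int[lmeas R]_x (u x * derive1 phi x) = - \int[lmeas R]_x (v x * phi x)].

(* A representative of the weak derivative, which is unique up to a null set;
   the zero function if there is none. *)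
Definition wD (R : realType) (u : R -> R) : R -> R :=
  xget (fun=> 0) [set v | weak_derivative u v].

Definition H2 (R : realType) (u : R -> R) : Prop :=
  inL2 u /\ exists v w : R -> R,
    [/\ weak_derivative u v, inL2 v, weak_derivative v w & inL2 w].

Definition H2norm (R : realType) (u : R -> R) : R :=
  Num.sqrt (ip u u + ip (wD u) (wD u) + ip (wD (wD u)) (wD (wD u))).

Definition H2even (R : realType) (u : R -> R) : Prop :=
  H2 u /\ (fun x => u (- x)) = u %[ae lmeas R].

Definition H2odd (R : realType) (u : R -> R) : Prop :=
  H2 u /\ (fun x => u (- x)) = (fun x => - u x) %[ae lmeas R].

Definition sech (R : realType) (x : R) : R := 2 / (expR x + expR (- x)).

Definition tanh (R : realType) (x : R) : R :=
  (expR x - expR (- x)) / (expR x + expR (- x)).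

Definition U0 (R : realType) (c : R) : R -> R :=
  fun x => 3 * c * sech (Num.sqrt c / 2 * x) ^+ 2.

Definition qexp (R : realType) (k : R) : R :=
  (Num.sqrt (1 + 48 * k) - 3) / 2.

Definition Omega_c (R : realType) (c k : R) : R :=
  - (c / 16) * (Num.sqrt (1 + 48 * k) - 3) ^+ 2.

Definition gtilde (R : realType) (c k : R) : R -> R :=
  fun x => sech (Num.sqrt c / 2 * x) `^ qexp k * tanh (Num.sqrt c / 2 * x).

Definition L1 (R : realType) (c : R) (u : R -> R) : R -> R :=
  fun x => - wD (wD u) x + c * u x - U0 c x * u x.

(* The inverse of L1 on the even subspace: the even u in H^2 with L1 u = f.
   It is unique up to a null set, since the kernel of L1 is odd. *)
Definition L1inv (R : realType) (c : R) (f : R -> R) : R -> R :=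
  xget (fun=> 0) [set u | H2even u /\ L1 c u = f %[ae lmeas R]].

Definition solves_system (R : realType) (c k s Omega : R) (U A : R -> R) :
    Prop :=
  (fun x => wD (wD U) x - c * U x + 2^-1 * U x ^+ 2 + s * A x ^+ 2)
    = (fun=> 0) %[ae lmeas R] /\
  (fun x => wD (wD A) x + (Omega + k * U x) * A x) = (fun=> 0) %[ae lmeas R].

Definition nontrivial_solution (R : realType) (c k s Omega : R)
    (U A : R -> R) : Prop :=
  [/\ H2even U, H2odd A, ~ (A = (fun=> 0) %[ae lmeas R]) &
      solves_system c k s Omega U A].

(* Main.v *)
(* Write m = Omega - Omega_c and U = U_0 + V. The system becomes
     L_1 V = V^2 / 2 + A^2,   L_2 A = (m + k V) A,   L_2 = - d^2 - Omega_c - k U_0,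
   where L_1 and L_2 are both of Poeschl-Teller type
   - d^2 + kap^2 (q^2 - (q + 1) (q + 2) sech^2 (kap x)), with q = 2 for L_1. The kernel of
   L_2 is spanned by g = sech^q tanh, and variation of constants inverts L_1 on even
   functions and L_2 on odd functions orthogonal to g, boundedly in the norms weighted by
   exp (b |x|) for 0 <= b < q kap. With a = A'(0) / g'(0), A = a B, V = m v and
   beta = a^2 / m, one gets
     v = beta L_1^-1 (B^2) + m L_1^-1 (v^2 / 2),   B = g + m L_2^-1 ((1 + k v) B),
   where orthogonality of (1 + k v) B to g fixes beta = - <g, g> / (k <g^2, L_1^-1 g^2>) + O(m);
   this is a contraction near (g, 0) for small m, and a^2 = m beta forces the sign of m.
   Weak solutions are classical: mollification at Lebesgue points shows that a function with
   a weak derivative is a primitive of it, and the equations give the second derivative. *)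
Require Import Defs.
From HB Require Import structures.
From mathcomp Require Import all_boot all_order all_algebra.
From mathcomp Require Import all_classical all_reals all_analysis.
From mathcomp Require Import ring lra.

Set Implicit Arguments.
Unset Strict Implicit.
Unset Printing Implicit Defensive.
Import Order.TTheory GRing.Theory Num.Theory.
Import numFieldNormedType.Exports.
Local Open Scope classical_set_scope.
Local Open Scope ring_scope.

(** The branch [A = 0], [U = U_0] solves the system for every [Omega], which makes the system
    degenerate at [m = 0]. Dividing by the amplitude removes that branch: in the unknowns (B, v) the
    limit problem is regular, and [a] returns only through [a^2 = m beta], hence the one ambiguity
    of sign. The normalisation [a = A'(0) / g'(0)] is the one that variation of constants offers,
    since its particular solution has zero derivative at 0. The orthogonality condition is affine in
    [beta], so [beta] is an explicit quotient; the assumption on the inner product keeps its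
    denominator away from 0. Existence has to produce decay, whereas a competing solution is only in
    H^2 and thus, by Sobolev, only bounded. The class of the contraction therefore carries a weight
    [b], with Lipschitz estimates in the sup norm alone: [b > 0] gives solutions in H^2, and [b = 0]
    admits the rescaled competitors. [C] comes from existence, and the range of [Omega] for
    uniqueness is chosen after it. *)

(** * Derivatives, mean value inequalities and primitives on the line *)

Section Calculus.
Variable R : realType.
Implicit Types (f g : R -> R) (x y a b : R).

Definition dv f f' := forall x, is_derive x 1 f (f' x).

Lemma dv_eq f f' g' : dv f f' -> f' =1 g' -> dv f g'.
Proof. by move=> d e x; rewrite -e; exact: d. Qed.

Lemma dv_ext f g f' : dv f f' -> f =1 g -> dv g f'.
Proof. by move=> d /funext <-. Qed.

Lemma dv_derivable f f' : dv f f' -> forall x, derivable f x 1.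
Proof. by move=> d x; case: (d x). Qed.

Lemma dv_val f f' : dv f f' -> forall x, f^`()%classic x = f' x.
Proof. by move=> d x; rewrite derive1E; case: (d x). Qed.

Lemma dv_cont f f' : dv f f' -> continuous f.
Proof.
by move=> d x; apply: differentiable_continuous; apply/derivable1_diffP;
  exact: dv_derivable d x.
Qed.

Lemma dv_cst a : dv (fun=> a) (fun=> 0).
Proof. by move=> x; exact: is_derive_cst. Qed.

Lemma dv_id : dv (fun x => x) (fun=> 1).
Proof. by move=> x; exact: is_derive_id. Qed.

Lemma dv_add f f' g g' : dv f f' -> dv g g' ->
  dv (fun x => f x + g x) (fun x => f' x + g' x).
Proof. by move=> df dg x; have := df x; have := dg x => ? ?; exact: is_deriveD. Qed.

Lemma dv_opp f f' : dv f f' -> dv (fun x => - f x) (fun x => - f' x).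
Proof. by move=> df x; have := df x => ?; exact: is_deriveN. Qed.

Lemma dv_sub f f' g g' : dv f f' -> dv g g' ->
  dv (fun x => f x - g x) (fun x => f' x - g' x).
Proof. by move=> df dg; apply: dv_add => //; exact: dv_opp. Qed.

Lemma dv_mul f f' g g' : dv f f' -> dv g g' ->
  dv (fun x => f x * g x) (fun x => f' x * g x + f x * g' x).
Proof.
move=> df dg x; have := df x; have := dg x => ? ?.
rewrite [_ + _](_ : _ = f x *: g' x + g x *: f' x); first exact: is_deriveM.
by rewrite addrC [X in _ + X]mulrC.
Qed.

Lemma dv_scale a f f' : dv f f' -> dv (fun x => a * f x) (fun x => a * f' x).
Proof. by move=> df x; have := df x => ?; exact: is_deriveZ. Qed.

Lemma dv_comp f f' g g' : dv f f' -> dv g g' ->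
  dv (fun x => f (g x)) (fun x => f' (g x) * g' x).
Proof. by move=> df dg x; have := dg x; have := df (g x) => ? ?; exact: is_derive1_comp. Qed.

Lemma dv_neg f f' : dv f f' -> dv (fun x => f (- x)) (fun x => - f' (- x)).
Proof.
move=> df; apply: dv_eq; first exact: (dv_comp df (dv_opp dv_id)).
by move=> x /=; rewrite mulrN1.
Qed.

Lemma dv_expR : dv (@expR R) (@expR R).
Proof. by move=> x; exact: is_derive_expR. Qed.

Lemma dv_exp f f' : dv f f' ->
  dv (fun x => expR (f x)) (fun x => f' x * expR (f x)).
Proof. by move=> df; apply: dv_eq (dv_comp dv_expR df) _ => x; rewrite mulrC. Qed.

Lemma dv_expl a : dv (fun x => expR (a * x)) (fun x => a * expR (a * x)).
Proof. by apply: dv_eq (dv_exp (dv_scale a dv_id)) _ => x; rewrite mulr1. Qed.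

Lemma dv_sqr f f' : dv f f' -> dv (fun x => f x ^+ 2) (fun x => 2 * f x * f' x).
Proof.
move=> df; apply: dv_ext (dv_eq (dv_mul df df) _) _ => x; last by rewrite expr2.
by ring.
Qed.

Lemma dv_ln f f' : (forall x, 0 < f x) -> dv f f' ->
  dv (fun x => ln (f x)) (fun x => f' x / f x).
Proof.
move=> f0 df x; have := df x; have := is_derive1_ln (f0 x) => ? ?.
by rewrite mulrC; exact: is_derive1_comp.
Qed.

Lemma dv_mvt f f' a b : dv f f' -> a < b ->
  exists2 c, a < c < b & f b - f a = f' c * (b - a).
Proof.
move=> df ab; have [x _||c] := @MVT R f f' a b ab; first exact: df.
  by apply: continuous_subspaceT => z; exact: (dv_cont df).
by rewrite in_itv /= => cab e; exists c.
Qed.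

Lemma dv_ler f f' g g' a b : dv f f' -> dv g g' -> a <= b ->
  (forall x, a < x -> x < b -> f' x <= g' x) -> f b - f a <= g b - g a.
Proof.
move=> df dg; rewrite le_eqVlt => /orP[/eqP->|ab] h; first by rewrite !subrr.
have [c /andP[ac cb] e] := dv_mvt (dv_sub dg df) ab.
rewrite -subr_ge0; have -> : g b - g a - (f b - f a) = (g b - f b) - (g a - f a) by ring.
by rewrite e mulr_ge0 // subr_ge0 ?h // ltW.
Qed.

Lemma dv_abs f f' g g' a b : dv f f' -> dv g g' -> a <= b ->
  (forall x, a < x -> x < b -> `|f' x| <= g' x) -> `|f b - f a| <= g b - g a.
Proof.
move=> df dg ab h; rewrite ler_norml; apply/andP; split.
  rewrite lerNl opprB -[leLHS](addrC (- f b)) -[f a]opprK.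
  apply: (dv_ler (dv_opp df) dg ab) => x ax xb.
  by have := h x ax xb; rewrite ler_norml lerNl => /andP[].
by apply: (dv_ler df dg ab) => x ax xb; exact: le_trans (ler_norm _) (h x ax xb).
Qed.

Lemma dv_lip f f' M x y : dv f f' -> (forall z, `|f' z| <= M) ->
  `|f x - f y| <= M * `|x - y|.
Proof.
move=> df h; wlog xy : x y / y <= x => [H|].
  have [/H//|/ltW/H] := leP y x; by rewrite distrC [`|x - y|]distrC.
have dM : dv (fun x => M * x) (fun=> M).
  by apply: dv_eq (dv_scale M dv_id) _ => z; rewrite mulr1.
apply: le_trans (dv_abs df dM xy _) _ => //.
by rewrite ger0_norm ?subr_ge0 // mulrBr.
Qed.

Lemma dv_cst_eq f f' x y : dv f f' -> (forall z, f' z = 0) -> f x = f y.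
Proof.
by move=> df h; apply: is_derive_0_is_cst => z; rewrite -(h z); exact: df.
Qed.

Lemma dv_inj f f' g g' : dv f f' -> dv g g' -> f =1 g -> f' =1 g'.
Proof.
by move=> df dg /funext e x; move: df; rewrite e => df; rewrite -(dv_val df) (dv_val dg).
Qed.

Notation mu := (@lebesgue_measure R).

Definition iloc f := forall a b, mu.-integrable `[a, b] (EFin \o f).

Lemma cont_iloc f : continuous f -> iloc f.
Proof.
move=> cf a b; apply: continuous_compact_integrable; first exact: segment_compact.
by apply: continuous_subspaceT => z; exact: cf.
Qed.

Lemma locint_iloc f : locally_integrable [set: R] f -> iloc f.
Proof.
case=> mf _ lf a b; apply/integrableP; split.
  by apply/measurable_realfun.measurable_EFinP; exact: measurable_funS mf.
exact: lf (@segment_compact _ _ _).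
Qed.

Lemma iloc_half f a b (c d : bool) :
  iloc f -> mu.-integrable [set` Interval (BSide c a) (BSide d b)] (EFin \o f).
Proof.
move=> lf; apply: integrableS (lf a b) => //.
by apply: subset_itv; case: c; case: d; rewrite ?bnd_simp.
Qed.

(** The sign test makes this the oriented integral from [0], since an integral over a set carries no
    orientation. *)
Definition prim f x : R :=
  if 0 <= x then \int[mu]_(t in `[0, x]) f t else - \int[mu]_(t in `[x, 0]) f t.

Lemma int_split f a b c : iloc f -> a <= b -> b <= c ->
  \int[mu]_(t in `[a, c]) f t
    = \int[mu]_(t in `[a, b]) f t + \int[mu]_(t in `[b, c]) f t.
Proof.
move=> lf ab bc.
have := @Rintegral_itvB _ f (BLeft a) (BRight c) b (lf _ _).
rewrite !bnd_simp => /(_ ab bc); rewrite Rintegral_itv_obnd_cbnd; last exact: (@iloc_half _ _ _ false false).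
by move=> <-; rewrite addrC subrK.
Qed.

Lemma prim_sub f a b : iloc f -> a <= b ->
  prim f b - prim f a = \int[mu]_(t in `[a, b]) f t.
Proof.
move=> lf ab; rewrite /prim; case: (leP 0 b) => b0; case: (leP 0 a) => a0.
- by rewrite (int_split lf a0 ab) addrC addKr.
- by rewrite opprK addrC -int_split // ltW.
- by have := le_lt_trans (le_trans a0 ab) b0; rewrite ltxx.
- by rewrite opprK addrC (int_split lf ab (ltW b0)) addrK.
Qed.

Lemma prim0 f : prim f 0 = 0.
Proof. by rewrite /prim lexx set_itv1 Rintegral_set1. Qed.

Lemma dv_prim f : continuous f -> dv (prim f) f.
Proof.
move=> cf x; have lf := cont_iloc cf.
have xl : x < x + 1 by rewrite ltrDl.
have xr : x - 1 < x by rewrite ltrBlDr.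
have [d e] := @continuous_FTC1_closed R f (x - 1) x (x + 1) xl (lf _ _) xr (cf x).
(* [F] integrates from the fixed point [x - 1]; near [x] it differs from [prim f] by the constant
   [prim f (x - 1)]. *)
set F := (fun z : R => _) in d e.
have dF : is_derive x 1 (fun z => prim f (x - 1) + F z) (f x).
  rewrite -[f x]add0r; apply: is_deriveD; rewrite -e derive1E.
  exact: derivableP.
apply: near_eq_is_derive dF; near=> z.
rewrite /F -prim_sub //; first by rewrite addrC subrK.
by near: z; exact: lt_le_nbhsr.
Unshelve. all: by end_near. Qed.

Lemma prim_unique F f x : continuous f -> dv F f -> prim f x = F x - F 0.
Proof.
move=> cf dF; have := dv_cst_eq x 0 (dv_sub (dv_prim cf) dF) (fun z => subrr _).
by rewrite prim0 => H; apply/eqP; rewrite -subr_eq0 opprB addrA addrAC H; apply/eqP; ring.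
Qed.

Lemma prim_even f x : continuous f -> (forall x, f (- x) = f x) ->
  prim f (- x) = - prim f x.
Proof.
move=> cf e; have d : dv (fun x => - prim f (- x)) f.
  by apply: dv_eq (dv_opp (dv_neg (dv_prim cf))) _ => z; rewrite opprK e.
by rewrite (prim_unique x cf d) /= !(oppr0, prim0, addr0, opprK).
Qed.

Lemma prim_odd f x : continuous f -> (forall x, f (- x) = - f x) ->
  prim f (- x) = prim f x.
Proof.
move=> cf e; have d : dv (fun x => prim f (- x)) f.
  by apply: dv_eq (dv_neg (dv_prim cf)) _ => z; rewrite e opprK.
by rewrite (prim_unique x cf d) /= !(oppr0, prim0, addr0, opprK).
Qed.

Lemma prim_add f g x : continuous f -> continuous g ->
  prim (fun x => f x + g x) x = prim f x + prim g x.
Proof.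
move=> cf cg; rewrite (prim_unique x _ (dv_add (dv_prim cf) (dv_prim cg))).
  by rewrite !prim0 addr0 subr0.
by move=> z; exact: cvgD (cf z) (cg z).
Qed.

Lemma prim_scale a f x : continuous f -> prim (fun x => a * f x) x = a * prim f x.
Proof.
move=> cf; rewrite (prim_unique x _ (dv_scale a (dv_prim cf))).
  by rewrite prim0 mulr0 subr0.
by move=> z; apply: cvgM; [exact: cvg_cst|exact: cf].
Qed.
End Calculus.

(** * Exponentially weighted bounds and integrals over the half-line *)

Section Decay.
Variable R : realType.
Implicit Types (f g : R -> R) (x y a b M : R).

(** A bound in the sup norm weighted by [expR (b * |x|)]. A negative [b] allows exponential growth,
    as for [psi] below, and [b = 0] is the plain sup norm. *)
Definition bd b M f := forall x, `|f x| <= M * expR (- (b * `|x|)).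

Lemma bd_le b M N f : M <= N -> bd b M f -> bd b N f.
Proof. by move=> MN h x; apply: le_trans (h x) _; rewrite ler_wpM2r ?expR_ge0. Qed.

Lemma bd_weak b b' M f : 0 <= M -> b' <= b -> bd b M f -> bd b' M f.
Proof.
move=> M0 bb h x; apply: le_trans (h x) _; rewrite ler_wpM2l // ler_expR lerN2.
by rewrite ler_wpM2r.
Qed.

Lemma bd0P M f : bd 0 M f <-> forall x, `|f x| <= M.
Proof.
by split=> h x; have := h x; rewrite mul0r oppr0 expR0 mulr1.
Qed.

Lemma bd_ge0 b M f : bd b M f -> 0 <= M.
Proof. by move/(_ 0); rewrite normr0 mulr0 oppr0 expR0 mulr1; exact: le_trans. Qed.

Lemma bd_add b M N f g : bd b M f -> bd b N g -> bd b (M + N) (fun x => f x + g x).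
Proof.
by move=> hf hg x; rewrite mulrDl; apply: le_trans (ler_normD _ _) _; exact: lerD.
Qed.

Lemma bd_opp b M f : bd b M f -> bd b M (fun x => - f x).
Proof. by move=> h x; rewrite normrN. Qed.

Lemma bd_scale b M a f : bd b M f -> bd b (`|a| * M) (fun x => a * f x).
Proof. by move=> h x; rewrite normrM -mulrA ler_wpM2l. Qed.

Lemma bd_mul b b' M N f g : bd b M f -> bd b' N g ->
  bd (b + b') (M * N) (fun x => f x * g x).
Proof.
move=> hf hg x; rewrite normrM mulrDl opprD expRD.
rewrite [leRHS](_ : _ = (M * expR (- (b * `|x|))) * (N * expR (- (b' * `|x|)))); last by ring.
by apply: ler_pM.
Qed.

Lemma bd_mul0 b M N f g : bd b M f -> bd 0 N g -> bd b (M * N) (fun x => f x * g x).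
Proof. by move=> hf hg; rewrite -[b]addr0; exact: bd_mul. Qed.

Lemma cont_mul f g : continuous f -> continuous g -> continuous (fun x => f x * g x).
Proof. by move=> cf cg z; apply: cvgM; [exact: cf|exact: cg]. Qed.

Lemma cont_add f g : continuous f -> continuous g -> continuous (fun x => f x + g x).
Proof. by move=> cf cg z; apply: cvgD; [exact: cf|exact: cg]. Qed.

Lemma cont_opp f : continuous f -> continuous (fun x => - f x).
Proof. by move=> cf z; apply: cvgN; exact: cf. Qed.

Lemma cont_cst a : continuous (fun _ : R => a).
Proof. by move=> z; exact: cvg_cst. Qed.

Lemma cont_scale a f : continuous f -> continuous (fun x => a * f x).
Proof. by apply: cont_mul; exact: cont_cst. Qed.

Lemma cont_sub f g : continuous f -> continuous g -> continuous (fun x => f x - g x).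
Proof. by move=> cf cg; apply: cont_add => //; exact: cont_opp. Qed.

Definition expabs b x := expR (- (b * `|x|)).

Lemma cont_expabs b : continuous (expabs b).
Proof.
move=> x; apply: (@cvg_comp _ _ _ (fun z => - (b * `|z|)) (@expR R)); last exact: continuous_expR.
by apply: cvgN; apply: cvgM; [exact: cvg_cst | exact: norm_continuous].
Qed.

Lemma cvg_exp_decay b : 0 < b -> expR (- (b * x)) @[x --> +oo] --> (0 : R).
Proof.
move=> b0; apply: (@cvg_comp _ _ _ (fun x => b * x) (fun x => expR (- x)) _ +oo).
  apply/cvgryPge => A; near=> x.
  rewrite -ler_pdivrMl //; near: x; apply: nbhs_pinfty_ge; exact: num_real.
exact: cvgr_expR.
Unshelve. all: by end_near. Qed.

Lemma dv_exp_int b : b != 0 ->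
  dv (fun x => - b^-1 * expR (- (b * x))) (fun x => expR (- (b * x))).
Proof.
move=> b0; have H := dv_scale (- b^-1) (dv_exp (dv_opp (dv_scale b (@dv_id R)))).
by apply: dv_eq H _ => x; field.
Qed.

(** The integral over the half-line from [0]; by parity the inner products below reduce to it. *)
Definition pinf f : R := lim (prim f x @[x --> +oo]).

Lemma pinf_val f (l : R) : prim f x @[x --> +oo] --> l -> pinf f = l.
Proof. by move=> h; exact: (cvg_lim _ h). Qed.

Lemma prim_tail b M f x y : 0 < b -> continuous f -> bd b M f -> 0 <= x -> x <= y ->
  `|prim f y - prim f x| <= M / b * (expR (- (b * x)) - expR (- (b * y))).
Proof.
move=> b0 cf hf x0 xy.
rewrite [leRHS](_ : _ = M * (- b^-1 * expR (- (b * y))) - M * (- b^-1 * expR (- (b * x)))); last by ring.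
apply: (dv_abs (dv_prim cf) (dv_scale M (dv_exp_int (lt0r_neq0 b0))) xy) => z xz zy.
by have := hf z; rewrite [`|z|]ger0_norm // (le_trans x0) // ltW.
Qed.

(** With [h] the exponential majorant, [f = (f + h) - h] is a difference of nonnegative functions,
    whose primitives are monotone and bounded by [prim_tail]. *)
Lemma pinf_cvg b M f : 0 < b -> continuous f -> bd b M f ->
  prim f x @[x --> +oo] --> pinf f.
Proof.
move=> b0 cf hf; apply/cvg_ex.
pose h x := M * expabs b x; have ch : continuous h := @cont_scale M _ (@cont_expabs b).
have hh : bd b M h by move=> x; rewrite /h normrM (ger0_norm (bd_ge0 hf)) ger0_norm ?expR_ge0.
have K g : continuous g -> (forall x, 0 <= g x) -> bd b (M + M) g ->
    exists l : R, prim g x @[x --> +oo] --> l.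
  move=> cg g0 hg; exists (sup (range (prim g))); apply: nondecreasing_cvgr.
    move=> x y xy; rewrite -subr_ge0.
    have := dv_ler (dv_cst 0) (dv_prim cg) xy; rewrite subrr; apply.
    by move=> *; exact: g0.
  exists ((M + M) / b) => _ [x _ <-].
  have N0 := bd_ge0 hg.
  have xm : x <= `|x| := ler_norm x.
  have := dv_ler (dv_cst 0) (dv_prim cg) xm; rewrite subrr => /(_ (fun _ _ _ => g0 _)).
  rewrite subr_ge0 => /le_trans; apply.
  have := prim_tail b0 cg hg (lexx 0) (normr_ge0 x).
  rewrite prim0 subr0 mulr0 oppr0 expR0 => /(le_trans (ler_norm _)) /le_trans; apply.
  by rewrite ler_piMr ?divr_ge0 ?(ltW b0) // gerBl expR_ge0.
have [l1 H1] := K h ch (fun x => mulr_ge0 (bd_ge0 hf) (expR_ge0 _)) (bd_le (ler_wpDl (bd_ge0 hf) (lexx _)) hh).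
have [] := K (fun x => f x + h x).
- exact: cont_add.
- by move=> x; rewrite -lerBlDr sub0r lerNl; apply: le_trans (hf x); rewrite -normrN; exact: ler_norm.
- exact: bd_add.
move=> l2 H2; exists (l2 - l1).
have -> : prim f = (fun x => prim (fun x => f x + h x) x - prim h x).
  by apply/funext => x; rewrite prim_add // addrK.
exact: cvgB.
Qed.

Lemma pinf_tail b M f x : 0 < b -> continuous f -> bd b M f -> 0 <= x ->
  `|pinf f - prim f x| <= M / b * expR (- (b * x)).
Proof.
move=> b0 cf hf x0.
have H : `|prim f y - prim f x| @[y --> +oo] --> `|pinf f - prim f x|.
  by apply: cvg_norm; apply: cvgB; [exact: (pinf_cvg b0 cf hf)|exact: cvg_cst].
apply: (cvgr_to_le H); near=> y.
have xy : x <= y by near: y; apply: nbhs_pinfty_ge; exact: num_real.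
apply: le_trans (prim_tail b0 cf hf x0 xy) _.
by rewrite ler_wpM2l ?divr_ge0 ?(bd_ge0 hf) ?(ltW b0) // gerBl expR_ge0.
Unshelve. all: by end_near. Qed.

Lemma pinf_bound b M f : 0 < b -> continuous f -> bd b M f -> `|pinf f| <= M / b.
Proof.
move=> b0 cf hf; have := pinf_tail b0 cf hf (lexx 0).
by rewrite prim0 subr0 mulr0 oppr0 expR0 mulr1.
Qed.

Lemma pinf_add b M N f g : 0 < b -> continuous f -> continuous g -> bd b M f -> bd b N g ->
  pinf (fun x => f x + g x) = pinf f + pinf g.
Proof.
move=> b0 cf cg hf hg; apply: pinf_val.
have -> : prim (fun x => f x + g x) = (fun x => prim f x + prim g x).
  by apply/funext => x; exact: prim_add.
by apply: cvgD; [exact: (pinf_cvg b0 cf hf)|exact: (pinf_cvg b0 cg hg)].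
Qed.

Lemma pinf_scale b M a f : 0 < b -> continuous f -> bd b M f ->
  pinf (fun x => a * f x) = a * pinf f.
Proof.
move=> b0 cf hf; apply: pinf_val.
have -> : prim (fun x => a * f x) = (fun x => a * prim f x).
  by apply/funext => x; exact: prim_scale.
by apply: cvgM; [exact: cvg_cst|exact: (pinf_cvg b0 cf hf)].
Qed.

Lemma pinf_gt0 b M f : 0 < b -> continuous f -> bd b M f ->
  (forall x, 0 < x -> 0 < f x) -> 0 < pinf f.
Proof.
move=> b0 cf hf f0.
have p1 : 0 < prim f 1.
  have [c /andP[c0 _]] := dv_mvt (dv_prim cf) (@ltr01 R).
  by rewrite prim0 !subr0 mulr1 => ->; exact: f0.
apply: (lt_le_trans p1); apply: (cvgr_to_ge (pinf_cvg b0 cf hf)); near=> y.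
have y1 : 1 <= y by near: y; apply: nbhs_pinfty_ge; exact: num_real.
rewrite -subr_ge0; have := dv_ler (dv_cst 0) (dv_prim cf) y1; rewrite subrr; apply.
by move=> z z1 _; rewrite ltW // f0 // (lt_trans _ z1).
Unshelve. all: by end_near. Qed.
End Decay.

(** * Green operators *)

(* A fundamental system of [y'' = pot y] with [phi] odd and decaying, [psi]
   even and growing, normalised by [psi 0 = -1] and Wronskian [kap]. *)
Record fundsys (R : realType) := FundSys {
  kap : R; rate : R; fsC : R; pot : R -> R;
  phi : R -> R; phi1 : R -> R; psi : R -> R; psi1 : R -> R;
  kap_gt0 : 0 < kap; rate_gt0 : 0 < rate; cont_pot : continuous pot;
  dv_phi : dv phi phi1; dv_phi1 : dv phi1 (fun x => pot x * phi x);
  dv_psi : dv psi psi1; dv_psi1 : dv psi1 (fun x => pot x * psi x);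
  phi_odd : forall x, phi (- x) = - phi x;
  psi_even : forall x, psi (- x) = psi x;
  phi1_0 : phi1 0 = kap; psi_0 : psi 0 = -1;
  wronskian : forall x, phi x * psi1 x - phi1 x * psi x = kap;
  bd_phi : bd rate fsC phi; bd_phi1 : bd rate fsC phi1;
  bd_psi : bd (- rate) fsC psi; bd_psi1 : bd (- rate) fsC psi1 }.

Section Green.
Variables (R : realType) (S : fundsys R).
Implicit Types (f g : R -> R) (x b M : R).
Local Notation kap := (kap S).
Local Notation al := (rate S).
Local Notation C0 := (fsC S).
Local Notation phi := (phi S).
Local Notation psi := (psi S).
Local Notation phi1 := (phi1 S).
Local Notation psi1 := (psi1 S).

(** Variation of constants for [- y'' + pot y = f]. The growing [psi] carries the tail integral of
    [phi * f], and the decaying [phi] carries the integral of [psi * f] from [0], which controls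
    both terms at plus infinity. The derivative at [0] vanishes, because [prim] and [psi1] vanish
    there. *)
Definition green f x :=
  (phi x * prim (fun y => psi y * f y) x
   + psi x * (pinf (fun y => phi y * f y) - prim (fun y => phi y * f y) x)) / kap.

Definition green1 f x :=
  (phi1 x * prim (fun y => psi y * f y) x
   + psi1 x * (pinf (fun y => phi y * f y) - prim (fun y => phi y * f y) x)) / kap.

Let kapN0 : kap != 0. Proof. exact: lt0r_neq0 (kap_gt0 S). Qed.
Let cphi : continuous phi := dv_cont (dv_phi S).
Let cpsi : continuous psi := dv_cont (dv_psi S).

Lemma phi_0 : phi 0 = 0.
Proof. by have := phi_odd S 0; rewrite oppr0 => /eqP; rewrite -addr_eq0 -mulr2n mulrn_eq0 => /eqP. Qed.

Lemma psi1_odd x : psi1 (- x) = - psi1 x.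
Proof.
have := dv_inj (dv_neg (dv_psi S)) (dv_psi S) (psi_even S) x.
by move=> <-; rewrite opprK.
Qed.

Lemma psi1_0 : psi1 0 = 0.
Proof. by have := psi1_odd 0; rewrite oppr0 => /eqP; rewrite -addr_eq0 -mulr2n mulrn_eq0 => /eqP. Qed.

Lemma dv_green f : continuous f -> dv (green f) (green1 f).
Proof.
move=> cf; have P1 := dv_prim (cont_mul cpsi cf); have P2 := dv_prim (cont_mul cphi cf).
have H := dv_add (dv_mul (dv_phi S) P1)
  (dv_mul (dv_psi S) (dv_sub (dv_cst (pinf (fun y => phi y * f y))) P2)).
apply: dv_eq (dv_ext (dv_scale kap^-1 H) _) _ => x; rewrite /green /green1.
  by rewrite mulrC.
by field.
Qed.

Lemma dv_green1 f : continuous f ->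
  dv (green1 f) (fun x => pot S x * green f x - f x).
Proof.
move=> cf; have P1 := dv_prim (cont_mul cpsi cf); have P2 := dv_prim (cont_mul cphi cf).
have H := dv_add (dv_mul (dv_phi1 S) P1)
  (dv_mul (dv_psi1 S) (dv_sub (dv_cst (pinf (fun y => phi y * f y))) P2)).
apply: dv_eq (dv_ext (dv_scale kap^-1 H) _) _ => x; rewrite /green /green1.
  by rewrite mulrC.
rewrite [X in _ = _ - X](_ : _ = (phi x * psi1 x - phi1 x * psi x) * f x / kap).
  by field.
by rewrite wronskian; field.
Qed.

Lemma green_cont f : continuous f -> continuous (green f).
Proof. by move/dv_green; exact: dv_cont. Qed.

Lemma bd_phi_mul b M f : bd b M f -> bd (al + b) (C0 * M) (fun x => phi x * f x).
Proof. by move=> hf; apply: bd_mul => //; exact: bd_phi. Qed.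

Lemma fsC_ge0 : 0 <= C0. Proof. exact: bd_ge0 (bd_phi S). Qed.

(** The pairs [(phi, psi)] and [(phi1, psi1)] obey the same bounds, so [p] and [q] serve for [green]
    and [green1] at once. The integral of [psi * f] grows at most like [exp ((al - b) x)], the tail
    of [phi * f] decays like [exp (- (al + b) x)], and after multiplication both are of order
    [exp (- b x)]. *)
Lemma green_half b M f (p : R -> R) (q : R -> R) x : 0 <= b -> b < al -> continuous f -> bd b M f ->
  bd al C0 p -> bd (- al) C0 q -> 0 <= x ->
  `|(p x * prim (fun y => psi y * f y) x
   + q x * (pinf (fun y => phi y * f y) - prim (fun y => phi y * f y) x)) / kap|
  <= (2 * C0 ^+ 2 / (al - b) / kap) * M * expR (- (b * `|x|)).
Proof.
move=> b0 bal cf hf hp hq x0.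
have M0 := bd_ge0 hf; have C00 := fsC_ge0; have al0 := rate_gt0 S.
have d0 : 0 < al - b by rewrite subr_gt0.
have s0 : 0 < al + b by rewrite ltr_wpDr.
have E1 : `|prim (fun y => psi y * f y) x| <= C0 * M / (al - b) * expR ((al - b) * x).
  have P := dv_prim (cont_mul cpsi cf).
  have H := dv_scale (C0 * M / (al - b)) (dv_expl (al - b)).
  have := dv_abs P H x0; rewrite prim0 subr0 => /(_ _)/le_trans; apply.
    move=> z z0 _; have := bd_mul (bd_psi S) hf z; rewrite [`|z|]gtr0_norm // => /le_trans; apply.
    have -> : - ((- al + b) * z) = (al - b) * z by ring.
    rewrite le_eqVlt; apply/orP; left; apply/eqP.
    by field; exact: lt0r_neq0.
  rewrite mulr0 expR0 gerBl; apply: mulr_ge0 => //; apply: divr_ge0; last exact: ltW.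
  exact: mulr_ge0.
have E2 : `|pinf (fun y => phi y * f y) - prim (fun y => phi y * f y) x|
    <= C0 * M / (al - b) * expR (- ((al + b) * x)).
  apply: le_trans (pinf_tail s0 (cont_mul cphi cf) (bd_phi_mul hf) x0) _.
  apply: ler_wpM2r; first exact: expR_ge0.
  apply: ler_wpM2l; first exact: mulr_ge0.
  by rewrite lef_pV2 ?posrE // lerD2l; lra.
have H1 := hp x; have H2 := hq x; rewrite (ger0_norm x0) in H1 H2 *.
rewrite normrM [`|kap^-1|]ger0_norm ?invr_ge0 ?(ltW (kap_gt0 S)) //.
rewrite [leRHS](_ : _ = (2 * C0 ^+ 2 / (al - b) * M * expR (- (b * x))) / kap); last by ring.
rewrite ler_pM2r ?invr_gt0 ?(kap_gt0 S) //.
apply: le_trans (ler_normD _ _) _; rewrite !normrM.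
have F1 : C0 * expR (- (al * x)) * (C0 * M / (al - b) * expR ((al - b) * x)) = C0 ^+ 2 / (al - b) * M * expR (- (b * x)).
  have -> : - (b * x) = - (al * x) + (al - b) * x by ring.
  by rewrite expRD; ring.
have F2 : C0 * expR (- (- al * x)) * (C0 * M / (al - b) * expR (- ((al + b) * x))) = C0 ^+ 2 / (al - b) * M * expR (- (b * x)).
  have -> : - (b * x) = - (- al * x) + - ((al + b) * x) by ring.
  by rewrite expRD; ring.
rewrite [leRHS](_ : _ = C0 ^+ 2 / (al - b) * M * expR (- (b * x)) + C0 ^+ 2 / (al - b) * M * expR (- (b * x))); last by ring.
by apply: lerD; [rewrite -F1|rewrite -F2]; apply: ler_pM.
Qed.

(** The two cases in which [green f] is also controlled at minus infinity. There the factor of [psi]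
    tends to the integral of [phi * f] over the whole line, which vanishes by parity if [f] is even,
    and for odd [f] if its half over the half-line does. *)
Definition admissible f := (forall x, f (- x) = f x) \/
  ((forall x, f (- x) = - f x) /\ pinf (fun x => phi x * f x) = 0).

Lemma green_even f x : continuous f -> (forall x, f (- x) = f x) -> green f (- x) = green f x.
Proof.
move=> cf e; rewrite /green psi_even phi_odd prim_even ?prim_odd ?mulrNN //.
- exact: cont_mul.
- by move=> z; rewrite phi_odd e mulNr.
- exact: cont_mul.
- by move=> z; rewrite psi_even e.
Qed.

Lemma green_odd f x : continuous f -> (forall x, f (- x) = - f x) ->
  pinf (fun x => phi x * f x) = 0 -> green f (- x) = - green f x.
Proof.
move=> cf e e0; rewrite /green psi_even phi_odd e0 !sub0r prim_odd ?prim_even //.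
- by ring.
- exact: cont_mul.
- by move=> z; rewrite phi_odd e mulrNN.
- exact: cont_mul.
- by move=> z; rewrite psi_even e mulrN.
Qed.

Lemma green_norm f x : continuous f -> admissible f ->
  `|green f (- x)| = `|green f x| /\ `|green1 f (- x)| = `|green1 f x|.
Proof.
move=> cf [e|[e e0]].
  have G y := green_even y cf e; split; first by rewrite G.
  have := dv_inj (dv_neg (dv_green cf)) (dv_green cf) G x => <-.
  by rewrite normrN.
have G y := green_odd y cf e e0; split; first by rewrite G normrN.
have := dv_inj (dv_neg (dv_green cf)) (dv_opp (dv_green cf)) G x => /oppr_inj <-.
by [].
Qed.

Definition greenC b := 2 * C0 ^+ 2 / (al - b) / kap.

Lemma greenC_ge0 b : b < al -> 0 <= greenC b.
Proof.
move=> bal; have k0 := ltW (kap_gt0 S).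
have d0 : 0 <= al - b by rewrite subr_ge0 ltW.
by rewrite /greenC; apply: divr_ge0 => //; apply: divr_ge0 => //; rewrite mulr_ge0 ?sqr_ge0.
Qed.

Lemma bd_green b M f : 0 <= b -> b < al -> continuous f -> bd b M f -> admissible f ->
  bd b (greenC b * M) (green f) /\ bd b (greenC b * M) (green1 f).
Proof.
move=> b0 bal cf hf adm; split=> x.
  wlog x0 : x / 0 <= x => [H|].
    have [/H//|/ltW x0] := leP 0 x.
    have := H (- x); rewrite normrN (proj1 (green_norm x cf adm)); apply.
    by rewrite oppr_ge0.
  exact: (green_half b0 bal cf hf (bd_phi S) (bd_psi S) x0).
wlog x0 : x / 0 <= x => [H|].
  have [/H//|/ltW x0] := leP 0 x.
  have := H (- x); rewrite normrN (proj2 (green_norm x cf adm)); apply.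
  by rewrite oppr_ge0.
exact: (green_half b0 bal cf hf (bd_phi1 S) (bd_psi1 S) x0).
Qed.

Lemma green_add f g M N x : continuous f -> continuous g -> bd 0 M f -> bd 0 N g ->
  green (fun x => f x + g x) x = green f x + green g x.
Proof.
move=> cf cg hf hg; rewrite /green.
have al0 : 0 < al + 0 by rewrite addr0 (rate_gt0 S).
have E h : (fun y => h y * (f y + g y)) = (fun y => h y * f y + h y * g y).
  by apply/funext => y; rewrite mulrDr.
rewrite !E (pinf_add al0 (cont_mul cphi cf) (cont_mul cphi cg) (bd_phi_mul hf) (bd_phi_mul hg)).
by rewrite !prim_add; [ring|..]; apply: cont_mul.
Qed.

Lemma green_scale a f M x : continuous f -> bd 0 M f ->
  green (fun x => a * f x) x = a * green f x.
Proof.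
move=> cf hf; rewrite /green.
have al0 : 0 < al + 0 by rewrite addr0 (rate_gt0 S).
have E h : (fun y => h y * (a * f y)) = (fun y => a * (h y * f y)).
  by apply/funext => y; rewrite mulrCA.
rewrite !E (pinf_scale a al0 (cont_mul cphi cf) (bd_phi_mul hf)).
by rewrite !prim_scale; [ring|..]; apply: cont_mul.
Qed.

Lemma green_sub f g M N x : continuous f -> continuous g -> bd 0 M f -> bd 0 N g ->
  green (fun x => f x - g x) x = green f x - green g x.
Proof.
move=> cf cg hf hg.
have E : (fun x => f x - g x) = (fun x => f x + (-1) * g x) by apply/funext => y; rewrite mulN1r.
rewrite E (green_add x cf (@cont_scale _ (-1) _ cg) hf (bd_scale (-1) hg)).
by rewrite (green_scale (-1) x cg hg) mulN1r.
Qed.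

Section Representation.
Variables (y y1 f : R -> R) (M : R).
Hypotheses (dy : dv y y1) (dy1 : dv y1 (fun x => pot S x * y x - f x))
  (cf : continuous f) (hf : bd 0 M f) (hy : bd 0 M y) (hy1 : bd 0 M y1)
  (y10 : y1 0 = 0).

(* The Wronskian of [phi] and [y] is a primitive of [- phi f] vanishing at infinity. *)
Lemma wronskian_phi x : phi x * y1 x - phi1 x * y x
  = pinf (fun z => phi z * f z) - prim (fun z => phi z * f z) x.
Proof.
have al0 : 0 < al + 0 by rewrite addr0 (rate_gt0 S).
have cpf := cont_mul cphi cf.
pose W z := phi z * y1 z - phi1 z * y z.
have dW : dv W (fun z => - (phi z * f z)).
  apply: dv_eq (dv_sub (dv_mul (dv_phi S) dy1) (dv_mul (dv_phi1 S) dy)) _ => z.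
  by ring.
have E z : prim (fun z => phi z * f z) z = W 0 - W z.
  have d : dv (fun z => - W z) (fun z => phi z * f z).
    by apply: dv_eq (dv_opp dW) _ => t; rewrite opprK.
  by rewrite (prim_unique z cpf d) opprK addrC.
have hW : bd al (C0 * M + C0 * M) W.
  apply: bd_add; first exact: bd_mul0 (bd_phi S) hy1.
  by apply: bd_opp; exact: bd_mul0 (bd_phi1 S) hy.
have limW : W z @[z --> +oo] --> (0 : R).
  have H : (C0 * M + C0 * M) * expR (- (al * z)) @[z --> +oo] --> (0 : R).
    rewrite -[X in _ --> X](mulr0 (C0 * M + C0 * M)).
    by apply: cvgM; [exact: cvg_cst|apply: cvg_exp_decay; exact: rate_gt0].
  have HN : - ((C0 * M + C0 * M) * expR (- (al * z))) @[z --> +oo] --> (0 : R).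
    by rewrite -oppr0; exact: cvgN H.
  apply: (squeeze_cvgr _ HN H); near=> z.
  have z0 : 0 <= z by near: z; apply: nbhs_pinfty_ge; exact: num_real.
  by have := hW z; rewrite ler_norml ger0_norm.
rewrite (@pinf_val _ _ (W 0)); last first.
  have -> : prim (fun z => phi z * f z) = (fun z => W 0 - W z) by apply/funext.
  by rewrite -[X in _ --> X]subr0; apply: cvgB; [exact: cvg_cst|].
by rewrite E /W; ring.
Unshelve. all: by end_near. Qed.

(** Cramer's rule: the Wronskians of [y] with [phi] and with [psi] are explicit primitives, and that
    of [phi] and [psi] is the constant [kap]. Boundedness of [y] fixes the first primitive at
    infinity, and [y1 0 = 0] fixes the second at [0]. *)
Lemma green_repr x : y x = green f x.
Proof.
have E2 : psi x * y1 x - psi1 x * y x = - prim (fun z => psi z * f z) x.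
  have d : dv (fun z => - (psi z * y1 z - psi1 z * y z)) (fun z => psi z * f z).
    apply: dv_eq (dv_opp (dv_sub (dv_mul (dv_psi S) dy1) (dv_mul (dv_psi1 S) dy))) _ => z.
    by ring.
  rewrite (prim_unique x (cont_mul cpsi cf) d) psi1_0 y10 mulr0 mul0r.
  by rewrite !subr0 oppr0 subr0 opprK.
rewrite /green -wronskian_phi; apply: (mulfI kapN0); rewrite mulrCA divff // mulr1.
have -> : prim (fun z => psi z * f z) x = - (psi x * y1 x - psi1 x * y x) by rewrite E2 opprK.
by rewrite -[in LHS](wronskian S x); ring.
Qed.

(** The Fredholm condition for odd [y]: the Wronskian of [phi] and [y] vanishes at infinity and,
    since [phi] and [y] are zero at [0], also at [0]. *)
Lemma green_solvable : y 0 = 0 -> pinf (fun z => phi z * f z) = 0.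
Proof.
move=> y0; have := wronskian_phi 0.
by rewrite phi_0 y0 mul0r mulr0 prim0 !subr0.
Qed.
End Representation.
End Green.

(** * Explicit fundamental systems for the Poeschl-Teller potentials *)

Section Sech.
Variables (R : realType) (k : R).
Hypothesis k0 : 0 < k.
Implicit Types (a b x : R).

Definition chs x : R := expR (k * x) + expR (- (k * x)).
Definition lsech x : R := ln 2 - ln (chs x).
(** [sech (k x)] to the real power [a]. As an exponential it has one differentiation rule for
    positive and negative [a], both of which enter the second solution. *)
Definition spow a x : R := expR (a * lsech x).
Definition tnh x : R := tanh (k * x).

Lemma chs_gt0 x : 0 < chs x. Proof. by rewrite addr_gt0 ?expR_gt0. Qed.

Lemma tnhE x : tnh x = (expR (k * x) - expR (- (k * x))) / chs x.
Proof. by []. Qed.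

Lemma dv_chs : dv chs (fun x => k * (expR (k * x) - expR (- (k * x)))).
Proof.
apply: dv_eq (dv_add (dv_expl k) (dv_exp (dv_opp (dv_scale k (@dv_id R))))) _ => x.
by ring.
Qed.

Lemma dv_lsech : dv lsech (fun x => - k * tnh x).
Proof.
apply: dv_eq (dv_sub (dv_cst (ln 2)) (dv_ln chs_gt0 dv_chs)) _ => x.
by rewrite tnhE; ring.
Qed.

Lemma chs_inv x : expR (- ln (chs x)) = (chs x)^-1.
Proof. by rewrite expRN lnK // posrE chs_gt0. Qed.

Lemma dv_tnh : dv tnh (fun x => k * (1 - tnh x ^+ 2)).
Proof.
have H := dv_mul (dv_sub (dv_expl k) (dv_exp (dv_opp (dv_scale k (@dv_id R)))))
  (dv_exp (dv_opp (dv_ln chs_gt0 dv_chs))).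
apply: dv_eq (dv_ext H _) _ => x; rewrite chs_inv // tnhE /chs.
by field; exact: lt0r_neq0 (chs_gt0 x).
Qed.

Lemma dv_spow a : dv (spow a) (fun x => - (a * k) * tnh x * spow a x).
Proof. by apply: dv_eq (dv_exp (dv_scale a dv_lsech)) _ => x; rewrite /spow; ring. Qed.

Lemma spowD a b x : spow (a + b) x = spow a x * spow b x.
Proof. by rewrite /spow mulrDl expRD. Qed.

Lemma spowNr a x : spow a x * spow (- a) x = 1.
Proof. by rewrite -spowD subrr /spow mul0r expR0. Qed.

Lemma sech_gt0 x : 0 < sech x :> R.
Proof. by rewrite divr_gt0 // addr_gt0 ?expR_gt0. Qed.

Lemma ln_sech x : ln (sech (k * x)) = lsech x.
Proof. by rewrite /sech -/(chs x) ln_div // posrE ?chs_gt0. Qed.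

Lemma spowE a x : sech (k * x) `^ a = spow a x.
Proof. by rewrite /powR gt_eqF ?sech_gt0 // ln_sech. Qed.

Lemma sech_sqr x : sech (k * x) ^+ 2 = 1 - tnh x ^+ 2.
Proof.
rewrite tnhE /sech -/(chs x).
have c0 := lt0r_neq0 (chs_gt0 x).
have E : expR (k * x) * expR (- (k * x)) = 1 by rewrite -expRD subrr expR0.
apply: (mulIf (expf_neq0 2 c0)).
have -> : (2 / chs x) ^+ 2 * chs x ^+ 2 = 4 by field.
have -> : (1 - ((expR (k * x) - expR (- (k * x))) / chs x) ^+ 2) * chs x ^+ 2
   = chs x ^+ 2 - (expR (k * x) - expR (- (k * x))) ^+ 2 by field.
rewrite /chs [RHS](_ : _ = 4 * (expR (k * x) * expR (- (k * x)))); last by ring.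
by rewrite E mulr1.
Qed.

Lemma tnh_le1 x : `|tnh x| <= 1.
Proof.
by rewrite -(@ler_pXn2r _ 2) ?nnegrE // expr1n real_normK ?num_real // -subr_ge0 -sech_sqr sqr_ge0.
Qed.

Lemma chs_even x : chs (- x) = chs x.
Proof. by rewrite /chs mulrN opprK addrC. Qed.

Lemma tnh_odd x : tnh (- x) = - tnh x.
Proof. by rewrite !tnhE chs_even mulrN opprK; ring. Qed.

Lemma lsech_even x : lsech (- x) = lsech x.
Proof. by rewrite /lsech chs_even. Qed.

Lemma spow_even a x : spow a (- x) = spow a x.
Proof. by rewrite /spow lsech_even. Qed.

(** The inequalities [exp (k |x|) <= chs x <= 2 exp (k |x|)] in logarithmic form. *)
Lemma lsech_bounds x : - (k * `|x|) <= lsech x <= ln 2 - k * `|x|.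
Proof.
wlog x0 : x / 0 <= x => [H|].
  by have [/H//|/ltW] := leP 0 x; rewrite -oppr_ge0 => /H; rewrite lsech_even normrN.
have y0 : 0 <= k * x by rewrite mulr_ge0 // ltW.
rewrite (ger0_norm x0) /lsech; apply/andP; split.
  rewrite lerBrDr -lerBrDl opprK -[X in _ <= _ + X]expRK -lnM ?posrE ?expR_gt0 //.
  rewrite ler_ln ?posrE ?chs_gt0 ?mulr_gt0 ?expR_gt0 //.
  rewrite mulr2n mulrDl mul1r lerD2l ler_expR; lra.
rewrite lerD2l lerN2 -[leLHS]expRK ler_ln ?posrE ?chs_gt0 ?expR_gt0 //.
by rewrite lerDl expR_ge0.
Qed.

Lemma bd_spow a : 0 <= a -> bd (a * k) (expR (a * ln 2)) (spow a).
Proof.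
move=> a0 x; rewrite ger0_norm ?expR_ge0 // -expRD ler_expR.
have /andP[_ h] := lsech_bounds x.
by have := ler_wpM2l a0 h; lra.
Qed.

Lemma bd_spowN a : 0 <= a -> bd (- (a * k)) 1 (spow (- a)).
Proof.
move=> a0 x; rewrite ger0_norm ?expR_ge0 // mul1r ler_expR.
have /andP[h _] := lsech_bounds x.
by have := ler_wpM2l a0 h; lra.
Qed.

Section System.
Variable q : R.
Hypothesis q0 : 0 < q.

Definition hpot x := k ^+ 2 * (q ^+ 2 - (q + 1) * (q + 2) * (1 - tnh x ^+ 2)).
Definition hphi x := spow q x * tnh x.
Definition hphi1 x := k * (1 - (q + 1) * tnh x ^+ 2) * spow q x.
(* [hpsi] is the second solution given by reduction of order from [hphi], with
   the singularity of [1 / hphi ^+ 2] at [0] integrated by parts away. *)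
Definition hS : R -> R := prim (fun x => spow (- q) x ^+ 2).
Definition hpsi x := (2 * q + 1) * k * (hphi x * hS x) - spow (- q) x.
Definition hpsi1 x := (2 * q + 1) * k * (hphi1 x * hS x) + k * (q + 1) * (spow (- q) x * tnh x).

Lemma dv_hS : dv hS (fun x => spow (- q) x ^+ 2).
Proof. by apply: dv_prim; exact: (dv_cont (dv_sqr (dv_spow (- q)))). Qed.

Lemma dv_hphi : dv hphi hphi1.
Proof. by apply: dv_eq (dv_mul (dv_spow q) dv_tnh) _ => x; rewrite /hphi1; ring. Qed.

Lemma dv_hphi1 : dv hphi1 (fun x => hpot x * hphi x).
Proof.
have H := dv_scale k (dv_mul (dv_sub (dv_cst 1) (dv_scale (q + 1) (dv_sqr dv_tnh))) (dv_spow q)).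
apply: dv_eq (dv_ext H _) _ => x; first by rewrite /hphi1; ring.
by rewrite /hpot /hphi; ring.
Qed.

Lemma dv_hpsi : dv hpsi hpsi1.
Proof.
apply: dv_eq (dv_sub (dv_scale ((2 * q + 1) * k) (dv_mul dv_hphi dv_hS)) (dv_spow (- q))) _ => x.
have -> : hphi x * spow (- q) x ^+ 2 = (spow q x * spow (- q) x) * (spow (- q) x * tnh x).
  by rewrite /hphi; ring.
by rewrite spowNr mul1r /hpsi1; ring.
Qed.

Lemma dv_hpsi1 : dv hpsi1 (fun x => hpot x * hpsi x).
Proof.
apply: dv_eq (dv_add (dv_scale ((2 * q + 1) * k) (dv_mul dv_hphi1 dv_hS))
  (dv_scale (k * (q + 1)) (dv_mul (dv_spow (- q)) dv_tnh))) _ => x.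
have -> : hphi1 x * spow (- q) x ^+ 2
    = (spow q x * spow (- q) x) * (k * (1 - (q + 1) * tnh x ^+ 2) * spow (- q) x).
  by rewrite /hphi1; ring.
by rewrite spowNr mul1r /hpsi /hpot; ring.
Qed.

Lemma cont_hpot : continuous hpot.
Proof.
apply: (@cont_scale R (k ^+ 2)); apply: cont_sub; first exact: cont_cst.
apply: (@cont_scale R ((q + 1) * (q + 2))); apply: cont_sub; first exact: cont_cst.
exact: (dv_cont (dv_sqr dv_tnh)).
Qed.

Lemma hphi_odd x : hphi (- x) = - hphi x.
Proof. by rewrite /hphi spow_even tnh_odd mulrN. Qed.

Lemma hS_odd x : hS (- x) = - hS x.
Proof.
apply: prim_even => [|z]; first exact: (dv_cont (dv_sqr (dv_spow (- q)))).
by rewrite spow_even.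
Qed.

Lemma hpsi_even x : hpsi (- x) = hpsi x.
Proof. by rewrite /hpsi hphi_odd hS_odd mulrNN spow_even. Qed.

Lemma tnh_0 : tnh 0 = 0. Proof. by rewrite tnhE mulr0 oppr0 subrr mul0r. Qed.

Lemma spow_0 a : spow a 0 = 1.
Proof. by rewrite /spow /lsech /chs mulr0 oppr0 expR0 subrr mulr0 expR0. Qed.

Lemma hphi1_0 : hphi1 0 = k.
Proof. by rewrite /hphi1 tnh_0 spow_0 expr0n mulr0 subr0 !mulr1. Qed.

Lemma hpsi_0 : hpsi 0 = -1.
Proof. by rewrite /hpsi /hphi tnh_0 !(mulr0, mul0r) spow_0 sub0r. Qed.

Lemma hwronskian x : hphi x * hpsi1 x - hphi1 x * hpsi x = k.
Proof.
rewrite [LHS](_ : _ = k * (spow q x * spow (- q) x)); first by rewrite spowNr mulr1.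
by rewrite /hpsi1 /hpsi /hphi /hphi1; ring.
Qed.

Let E := expR (q * ln 2).
Lemma bd_tnh : bd 0 1 tnh. Proof. by apply/bd0P; exact: tnh_le1. Qed.

Lemma bd_hphi : bd (q * k) E hphi.
Proof. by rewrite -[E]mulr1; apply: bd_mul0 bd_tnh; exact: bd_spow (ltW q0). Qed.

Lemma bd_hphi1 : bd (q * k) (E * (k * (q + 2))) hphi1.
Proof.
have -> : hphi1 = (fun x => spow q x * (k * (1 - (q + 1) * tnh x ^+ 2))).
  by apply/funext => x; rewrite /hphi1 mulrC.
apply: bd_mul0; first exact: bd_spow (ltW q0).
apply/bd0P => x; rewrite normrM gtr0_norm // ler_pM2l //.
have t1 : tnh x ^+ 2 <= 1 by rewrite -subr_ge0 -sech_sqr sqr_ge0.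
have t0 := sqr_ge0 (tnh x).
have u0 : 0 <= (q + 1) * tnh x ^+ 2 by rewrite mulr_ge0 // addr_ge0 // ltW.
have u1 : (q + 1) * tnh x ^+ 2 <= q + 1 by rewrite ler_piMr // addr_ge0 // ltW.
by rewrite ler_norml; apply/andP; split; lra.
Qed.

(** The integrand is at most [exp (2 q k |z|)]. Multiplied by [hphi], which decays at rate [q k],
    this gives the growth rate [q k] of the second solution. *)
Lemma bd_hS : bd (- (2 * q * k)) (1 / (2 * q * k)) hS.
Proof.
have c0 : 0 < 2 * q * k by rewrite !mulr_gt0.
move=> x; wlog x0 : x / 0 <= x => [H|].
  have [/H//|/ltW] := leP 0 x; rewrite -oppr_ge0 => /H.
  by rewrite hS_odd !normrN.
rewrite (ger0_norm x0) mulNr opprK.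
have dE := dv_scale (1 / (2 * q * k)) (dv_expl (2 * q * k)).
have := dv_abs dv_hS dE x0; rewrite /hS prim0 subr0 => /(_ _)/le_trans; apply.
  move=> z z0 _; have := bd_spowN (ltW q0) z; rewrite (gtr0_norm z0) mul1r mulNr opprK => h.
  rewrite mul1r mulKf ?lt0r_neq0 // normrX.
  have -> : 2 * q * k * z = q * k * z + q * k * z by ring.
  by rewrite expRD expr2 ler_pM.
by rewrite gerBl mulr0 expR0 mulr1 divr_ge0 // ltW.
Qed.

Lemma bd_hpsi : bd (- (q * k)) (`|(2 * q + 1) * k| * (E * (1 / (2 * q * k))) + 1) hpsi.
Proof.
apply: bd_add; last by apply: bd_opp; exact: bd_spowN (ltW q0).
apply: bd_scale.
have -> : - (q * k) = q * k + - (2 * q * k) by ring.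
by apply: bd_mul; [exact: bd_hphi|exact: bd_hS].
Qed.

Lemma bd_hpsi1 : bd (- (q * k))
  (`|(2 * q + 1) * k| * ((E * (k * (q + 2))) * (1 / (2 * q * k))) + `|k * (q + 1)| * (1 * 1)) hpsi1.
Proof.
apply: bd_add; last first.
  by apply: bd_scale; apply: bd_mul0 bd_tnh; exact: bd_spowN (ltW q0).
apply: bd_scale.
have -> : - (q * k) = q * k + - (2 * q * k) by ring.
by apply: bd_mul; [exact: bd_hphi1|exact: bd_hS].
Qed.

(** The sum of the four constants, because a [fundsys] has one constant for all its bounds. *)
Definition hC : R := E + E * (k * (q + 2)) + (`|(2 * q + 1) * k| * (E * (1 / (2 * q * k))) + 1)
 + (`|(2 * q + 1) * k| * ((E * (k * (q + 2))) * (1 / (2 * q * k))) + `|k * (q + 1)| * (1 * 1)).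

Lemma bd_hC : [/\ bd (q * k) hC hphi, bd (q * k) hC hphi1,
  bd (- (q * k)) hC hpsi & bd (- (q * k)) hC hpsi1].
Proof.
have h1 := bd_ge0 bd_hphi; have h2 := bd_ge0 bd_hphi1.
have h3 := bd_ge0 bd_hpsi; have h4 := bd_ge0 bd_hpsi1.
by split; [apply: bd_le bd_hphi|apply: bd_le bd_hphi1|apply: bd_le bd_hpsi|apply: bd_le bd_hpsi1];
  rewrite /hC; lra.
Qed.

Let bd1 := let: And4 p _ _ _ := bd_hC in p.
Let bd2 := let: And4 _ p _ _ := bd_hC in p.
Let bd3 := let: And4 _ _ p _ := bd_hC in p.
Let bd4 := let: And4 _ _ _ p := bd_hC in p.

Definition hsys : fundsys R 
  := @FundSys R k (q * k) hC hpot hphi hphi1 hpsi hpsi1 k0 (mulr_gt0 q0 k0) cont_hpot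
    dv_hphi dv_hphi1 dv_hpsi dv_hpsi1 hphi_odd hpsi_even hphi1_0 hpsi_0 hwronskian bd1 bd2 bd3 bd4.
End System.
End Sech.

(** * The contraction *)

Section Picard.
Variables (R : realType) (I : Type).
Implicit Types (x y l : I -> R).

Lemma half_cvg0 (D : R) : D / 2 ^+ n @[n --> \oo] --> (0 : R).
Proof.
rewrite -(mulr0 D); apply: cvgM; first exact: cvg_cst.
under eq_fun do rewrite -exprVn; apply: cvg_expr.
by rewrite ger0_norm // invf_lt1 // ltr1n.
Qed.

Lemma half_zero (a D : R) : (forall n : nat, `|a| <= D / 2 ^+ n) -> a = 0.
Proof.
move=> h; apply/eqP; rewrite -normr_le0.
by apply: (cvgr_to_ge (half_cvg0 D)); near=> n; exact: h.
Unshelve. all: by end_near. Qed.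

(** Banach's fixed point theorem without a normed space: sup distances are pointwise bounds by an
    explicit number, completeness is closure of [Q] under pointwise limits, and the ratio [1 / 2]
    turns every error into [D / 2 ^+ n]. *)
Lemma picard (Q : (I -> R) -> Prop) (F : (I -> R) -> I -> R) x0 (D : R) :
  Q x0 -> (forall x, Q x -> Q (F x)) ->
  (forall (u : nat -> I -> R) l, (forall n, Q (u n)) ->
     (forall i, u n i @[n --> \oo] --> l i) -> Q l) ->
  (forall x y d, Q x -> Q y -> (forall i, `|x i - y i| <= d) ->
     forall i, `|F x i - F y i| <= d / 2) ->
  (forall x y i, Q x -> Q y -> `|x i - y i| <= D) ->
  exists2 l, Q l & F l = l.
Proof.
move=> Q0 QF Qc Fc QD; pose u n := iter n F x0.
have Qu n : Q (u n) by elim: n => // n; exact: QF.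
have H n x y : Q x -> Q y -> forall i, `|iter n F x i - iter n F y i| <= D / 2 ^+ n.
  move=> Qx Qy; have Qi m z : Q z -> Q (iter m F z) by move=> Qz; elim: m => // m; exact: QF.
  elim: n => [|n IH] i; first by rewrite expr0 divr1; exact: QD.
  rewrite exprSr invfM mulrA /=; apply: Fc => //; exact: Qi.
have Hu m n i : `|u (n + m)%N i - u n i| <= D / 2 ^+ n.
  by rewrite /u iterD; apply: H => //; exact: Qu.
have cu i : cvgn (u^~ i).
  apply: cauchy_cvg; apply: cauchy_exP => e e0.
  have [N _ hN] : \forall n \near \oo, `|0 - D / 2 ^+ n| < e.
    by have /cvgrPdist_lt := half_cvg0 D; exact.
  exists (u N i); exists N => // p Np; rewrite /ball /= distrC -(subnKC Np).
  apply: le_lt_trans (Hu _ _ _) (le_lt_trans _ (hN N (leqnn N))).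
  by rewrite sub0r normrN ler_norm.
pose l i := limn (u^~ i).
have ul i : u n i @[n --> \oo] --> l i by exact: cu.
have Ql : Q l by exact: (Qc u).
have lu n i : `|l i - u n i| <= D / 2 ^+ n.
  have : `|u (m + n)%N i - u n i| @[m --> \oo] --> `|l i - u n i|.
    apply: cvg_norm; apply: cvgB; last exact: cvg_cst.
    by have := ul i; rewrite -(cvg_shiftn n (u^~ i)).
  move=> /cvgr_to_le; apply; near=> m; rewrite addnC; exact: Hu.
exists l => //; apply/funext => i; apply/eqP; rewrite -subr_eq0; apply/eqP.
apply: (@half_zero _ (D + D)) => n.
(* As [u n.+1 = F (u n)], the contraction bounds one difference and the distance to the limit bounds
   the other, each by [D / 2 ^+ n]. *)
rewrite -(subrKA (u n.+1 i)); apply: le_trans (ler_normD _ _) _; rewrite mulrDl; apply: lerD.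
  apply: le_trans (Fc _ _ _ Ql (Qu n) (lu n) i) _.
  rewrite ler_piMr // ?divr_ge0 ?exprn_ge0 ?invf_le1 ?ler1n //.
  exact: le_trans (normr_ge0 _) (QD _ _ i Ql Ql).
rewrite distrC; apply: le_trans (lu _ _) _.
apply: ler_wpM2l; first exact: le_trans (normr_ge0 _) (QD _ _ i Ql Ql).
by rewrite lef_pV2 ?posrE ?exprn_gt0 // exprS ler_peMl ?exprn_ge0 // ler1n.
Unshelve. all: by end_near. Qed.
End Picard.

(* [good b F]: a map [F] into functions, bounded in the norm weighted by
   [expR (b * `|x|)] and Lipschitz in the sup norm. *)
Section Good.
Variables (R : realType) (X : Type) (P : X -> Prop) (nr : R -> X -> X -> Prop).
Hypothesis nr_ge0 : forall d x y, nr d x y -> 0 <= d.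
Implicit Types (F G : X -> R -> R) (s t : X -> R) (b : R).

Definition good b F := exists2 C : R, 0 <= C & forall x, P x ->
  [/\ continuous (F x), bd b C (F x) &
      forall y d, P y -> nr d x y -> bd 0 (C * d) (fun z => F x z - F y z)].

(** A scalar is treated as a constant function, so that the rules for [good] cover it. *)
Definition goodS s := good 0 (fun x _ => s x).

Lemma good_ext b F G : (forall x, P x -> F x = G x) -> good b F -> good b G.
Proof.
move=> e [C C0 h]; exists C => // x Px; have [c1 c2 c3] := h x Px.
by rewrite -e //; split => // y d Py xy; rewrite -e //; exact: c3.
Qed.

Lemma good_cst b M (f : R -> R) : continuous f -> bd b M f -> good b (fun _ => f).
Proof.
move=> cf hf; exists M; first exact: bd_ge0 hf.
move=> x Px; split=> // y d Py xy; apply/bd0P => z.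
by rewrite subrr normr0 mulr_ge0 ?(bd_ge0 hf) // (nr_ge0 xy).
Qed.

Lemma goodS_cst (a : R) : goodS (fun=> a).
Proof. by apply: (@good_cst 0 `|a|); [exact: cont_cst|exact/bd0P]. Qed.

Lemma good_weak b b' F : b' <= b -> good b F -> good b' F.
Proof.
move=> bb [C C0 h]; exists C => // x Px; have [c1 c2 c3] := h x Px; split => //.
exact: bd_weak c2.
Qed.

Lemma good_add b F G : good b F -> good b G -> good b (fun x z => F x z + G x z).
Proof.
move=> [C C0 h] [C' C0' h']; exists (C + C'); first exact: addr_ge0.
move=> x Px; have [c1 c2 c3] := h x Px; have [d1 d2 d3] := h' x Px; split.
- exact: cont_add.
- exact: bd_add.
move=> y d Py xy; rewrite mulrDl => z.
by rewrite opprD addrACA; exact: bd_add (c3 y d Py xy) (d3 y d Py xy) z.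
Qed.

Lemma good_mul b F G : 0 <= b -> good b F -> good 0 G -> good b (fun x z => F x z * G x z).
Proof.
move=> b0 [C C0 h] [C' C0' h']; exists (C * C' + C * C').
  by rewrite addr_ge0 // mulr_ge0.
move=> x Px; have [c1 c2 c3] := h x Px; have [d1 d2 d3] := h' x Px; split.
- exact: cont_mul.
- apply: bd_le (bd_mul0 c2 d2); rewrite lerDl mulr_ge0 //.
move=> y d Py xy; have [e1 e2 _] := h y Py => z.
have -> : F x z * G x z - F y z * G y z = (F x z - F y z) * G x z + F y z * (G x z - G y z) by ring.
have := bd_add (bd_mul0 (c3 y d Py xy) d2) (bd_mul0 (bd_weak C0 b0 e2) (d3 y d Py xy)) z.
by rewrite [C * d * C' + _](_ : _ = (C * C' + C * C') * d) //; ring.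
Qed.

Lemma good_scale b s F : 0 <= b -> goodS s -> good b F -> good b (fun x z => s x * F x z).
Proof.
move=> b0 gs gF; apply: good_ext (good_mul b0 gF gs) => x Px.
by apply/funext => z; rewrite mulrC.
Qed.

Lemma goodS_mul s t : goodS s -> goodS t -> goodS (fun x => s x * t x).
Proof. exact: good_mul. Qed.

Lemma goodS_add s t : goodS s -> goodS t -> goodS (fun x => s x + t x).
Proof. exact: good_add. Qed.

(** The bound uses the operator norm at weight [b], the Lipschitz part that at weight [0]. The
    latter applies the operator to a difference [F x - F y], which must itself be admissible; hence
    the parity alternative is one for the whole family. *)
Lemma good_green (S : fundsys R) b F : 0 <= b -> b < rate S -> good b F ->
  (forall x, P x -> forall z, F x (- z) = F x z) \/
  (forall x, P x -> (forall z, F x (- z) = - F x z) /\ pinf (fun z => phi S z * F x z) = 0) ->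
  good b (fun x => green S (F x)).
Proof.
move=> b0 bal [C C0 h] par.
have al0 : 0 < rate S + 0 by rewrite addr0 (rate_gt0 S).
have adm x : P x -> admissible S (F x).
  by case: par => p Px; [left; exact: p|right; exact: p].
have admB x y : P x -> P y -> admissible S (fun z => F x z - F y z).
  move=> Px Py; case: par => p; [left => z; by rewrite !p|right].
  have [c1 c2 _] := h x Px; have [d1 d2 _] := h y Py.
  have [p1 p2] := p x Px; have [q1 q2] := p y Py; split=> [z|]; first by rewrite p1 q1; ring.
  rewrite (_ : (fun z => _) = (fun z => phi S z * F x z + (-1) * (phi S z * F y z))); last first.
    by apply/funext => z; ring.
  have cp : continuous (phi S) := dv_cont (dv_phi S).
  have H1 := bd_phi_mul S (bd_weak C0 b0 c2); have H2 := bd_phi_mul S (bd_weak C0 b0 d2).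
  rewrite (pinf_add al0 (cont_mul cp c1) (@cont_scale _ (-1) _ (cont_mul cp d1)) H1 (bd_scale (-1) H2)).
  by rewrite (pinf_scale (-1) al0 (cont_mul cp d1) H2) p2 q2 mulr0 addr0.
have al1 : 0 < rate S by exact: rate_gt0.
exists (greenC S b * C + greenC S 0 * C).
  by rewrite addr_ge0 // mulr_ge0 // greenC_ge0.
move=> x Px; have [c1 c2 c3] := h x Px; split.
- exact: green_cont.
- have [H _] := bd_green b0 bal c1 c2 (adm x Px).
  by apply: bd_le H; rewrite lerDl mulr_ge0 // greenC_ge0.
move=> y d Py xy; have [d1 d2 _] := h y Py.
have [H _] := bd_green (lexx 0) al1 (cont_sub c1 d1) (c3 y d Py xy) (admB x y Px Py).
move=> z; rewrite -(green_sub S z c1 d1 (bd_weak C0 b0 c2) (bd_weak C0 b0 d2)).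
apply: bd_le H z; rewrite mulrA ler_wpM2r ?(nr_ge0 xy) // lerDr mulr_ge0 //.
exact: greenC_ge0.
Qed.

Lemma good_pinf (S : fundsys R) F : good 0 F -> goodS (fun x => pinf (fun z => phi S z * F x z)).
Proof.
move=> [C C0 h]; have al0 : 0 < rate S + 0 by rewrite addr0 (rate_gt0 S).
have cp : continuous (phi S) := dv_cont (dv_phi S).
have K0 : 0 <= fsC S / (rate S + 0) by rewrite divr_ge0 ?fsC_ge0 // ltW.
exists (fsC S / (rate S + 0) * C); first exact: mulr_ge0.
move=> x Px; have [c1 c2 c3] := h x Px; split; first exact: cont_cst.
  by apply/bd0P => _; rewrite mulrAC; apply: (pinf_bound al0 (cont_mul cp c1)); exact: bd_phi_mul.
move=> y d Py xy; have [d1 d2 _] := h y Py; apply/bd0P => _.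
have H1 := bd_phi_mul S c2; have H2 := bd_phi_mul S d2.
rewrite -mulN1r -(pinf_scale (-1) al0 (cont_mul cp d1) H2).
rewrite -(pinf_add al0 (cont_mul cp c1) (@cont_scale _ (-1) _ (cont_mul cp d1)) H1 (bd_scale (-1) H2)).
rewrite (_ : (fun z => _) = (fun z => phi S z * (F x z - F y z))); last first.
  by apply/funext => z; ring.
rewrite -mulrA mulrAC; apply: (pinf_bound al0); first by apply: cont_mul => //; exact: cont_sub.
exact: bd_phi_mul (c3 y d Py xy).
Qed.

Lemma goodS_inv s (e : R) : 0 < e -> (forall x, P x -> e <= `|s x|) -> goodS s ->
  goodS (fun x => (s x)^-1).
Proof.
move=> e0 he [C C0 h]; have ei : 0 <= e^-1 by rewrite invr_ge0 ltW.
have s0 x : P x -> s x != 0 by move=> Px; rewrite -normr_gt0 (lt_le_trans e0) // he.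
have si x : P x -> `|(s x)^-1| <= e^-1.
  by move=> Px; rewrite normfV lef_pV2 ?posrE ?normr_gt0 ?s0 // he.
exists (e^-1 + e^-1 * e^-1 * C); first by rewrite addr_ge0 ?mulr_ge0.
move=> x Px; have [_ _ c3] := h x Px; split; first exact: cont_cst.
  apply/bd0P => _; apply: le_trans (si x Px) _.
  by rewrite lerDl !mulr_ge0.
move=> y d Py xy; apply/bd0P => _; have := c3 y d Py xy => /bd0P /(_ 0) H.
have -> : (s x)^-1 - (s y)^-1 = (s x)^-1 * (s y)^-1 * (s y - s x).
  by field; rewrite !s0.
rewrite mulrDl !normrM distrC -mulrA.
apply: le_trans (_ : e^-1 * (e^-1 * (C * d)) <= _); last first.
  by rewrite -!mulrA lerDr mulr_ge0 // (nr_ge0 xy).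
by rewrite ler_pM ?mulr_ge0 ?si // ler_pM ?si.
Qed.
End Good.

Section PointwiseLimits.
Variable R : realType.

Lemma lim_bound (u : nat -> R) (l c : R) : u n @[n --> \oo] --> l ->
  (forall n, `|u n| <= c) -> `|l| <= c.
Proof.
by move=> ul h; apply: (cvgr_to_le (cvg_norm ul)); near=> n; exact: h.
Unshelve. all: by end_near. Qed.

Lemma lip_cont (L : R) (f : R -> R) : (forall x y, `|f x - f y| <= L * `|x - y|) -> continuous f.
Proof.
move=> h x; apply/cvgrPdist_lt => e e0.
have L0 : 0 <= L by have := h 0 1; rewrite sub0r normrN normr1 mulr1; exact: le_trans.
have L1 : 0 < L + 1 by rewrite ltr_wpDl.
near=> y; apply: le_lt_trans (h x y) _.
apply: le_lt_trans (_ : (L + 1) * `|x - y| < e); first by rewrite ler_wpM2r // lerDl.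
rewrite mulrC -ltr_pdivlMr //; near: y.
exact: (@cvgr_dist_lt _ _ _ _ _ (fun y => y) x cvg_id _ (divr_gt0 e0 L1)).
Unshelve. all: by end_near. Qed.
End PointwiseLimits.

(** * The fixed point problem for the rescaled unknowns *)

Section Nonlinear.
Variables (R : realType) (S1 S2 : fundsys R) (k : R).
Hypothesis k0 : 0 < k.
Local Notation g := (phi S2).
Local Notation pair := ((R -> R) * (R -> R))%type.
Implicit Types (X Y : pair) (b d : R).

(* A pair [X = (B, z)] stands for [A = a B] and [V = mu (beta X * Y1f X + z)] with
   [a ^ 2 = mu beta X]. Since [Nn X + beta X * Dn X = 0], the right-hand side [A2f X]
   of the equation for [B] is orthogonal to [phi S2]. *)
Definition Jf (f : R -> R) : R := pinf (fun z => g z * f z).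
Definition Y1f X : R -> R := green S1 (fun x => X.1 x * X.1 x).
Definition Nn X : R := Jf X.1 + k * Jf (fun x => X.2 x * X.1 x).
Definition Dn X : R := k * Jf (fun x => Y1f X x * X.1 x).
Definition beta X : R := - (Nn X * (Dn X)^-1).
Definition vf X (x : R) : R := beta X * Y1f X x + X.2 x.
Definition A2f X (x : R) : R := (1 + k * vf X x) * X.1 x.
Definition V2f X (x : R) : R := 2^-1 * (vf X x * vf X x).
Definition F1 X : R -> R := green S2 (A2f X).
Definition F2 X : R -> R := green S1 (V2f X).
(** The fixed point for [mu = 0], the centre of the class on which the maps contract. *)
Definition base : pair := (g, fun=> 0).

(* Fixed points exist for a weight [b > 0], so that they decay, and are unique
   already among bounded functions, [b = 0]. *)
Record cls b d X : Prop := Cls {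
  cls_c1 : continuous X.1; cls_c2 : continuous X.2;
  cls_odd : forall x, X.1 (- x) = - X.1 x;
  cls_even : forall x, X.2 (- x) = X.2 x;
  cls_near : bd 0 d (fun x => X.1 x - g x);
  cls_bd1 : bd b (fsC S2 + 1) X.1; cls_bd2 : bd b d X.2 }.

Definition near2 d X Y := bd 0 d (fun x => X.1 x - Y.1 x) /\ bd 0 d (fun x => X.2 x - Y.2 x).

Definition fixpt mu X :=
  (forall x, X.1 x = g x + mu * F1 X x) /\ (forall x, X.2 x = mu * F2 X x).

Lemma near2_ge0 d X Y : near2 d X Y -> 0 <= d. Proof. by case=> /bd_ge0. Qed.

Let cg : continuous g := dv_cont (dv_phi S2).
Let al2 : 0 < rate S2 + 0. Proof. by rewrite addr0 (rate_gt0 S2). Qed.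

Lemma cls_le b d d' X : d <= d' -> cls b d X -> cls b d' X.
Proof. by move=> dd [? ? ? ? h1 h2 h3]; split=> //; [exact: bd_le h1|exact: bd_le h3]. Qed.

Section Weight.
Variable b : R.
Hypotheses (b0 : 0 <= b) (b1 : b < rate S1) (b2 : b < rate S2).

Lemma bd_weight M : 0 <= M -> bd (rate S2) M `<=` bd b M.
Proof. by move=> M0 f; apply: bd_weak => //; exact: ltW. Qed.

Lemma base_cls d : 0 <= d -> cls b d base.
Proof.
move=> d0; split => //=.
- exact: cont_cst.
- exact: phi_odd.
- by apply/bd0P => x; rewrite subrr normr0.
- apply: (bd_weight (ler_wpDr ler01 (fsC_ge0 S2))).
  by apply: bd_le (bd_phi S2); rewrite lerDl.
- by move=> x; rewrite normr0 mulr_ge0 ?expR_ge0.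
Qed.

Lemma cls_near2 d X : cls b d X -> near2 d X base.
Proof.
move=> h; split; first exact: cls_near h.
have := bd_weak (bd_ge0 (cls_near h)) b0 (cls_bd2 h).
by move=> /bd0P H; apply/bd0P => x; rewrite subr0.
Qed.

Notation gd d := (good (cls b d) near2).
Notation gdS d := (goodS (cls b d) near2).

Lemma good_B d c : c <= b -> gd d c (fun X => X.1).
Proof.
move=> cb; apply: (good_weak cb); have M0 := fsC_ge0 S2.
exists (fsC S2 + 2); first by rewrite addr_ge0.
move=> X h; split; first exact: cls_c1 h.
  by apply: bd_le (cls_bd1 h); rewrite lerD2l; lra.
move=> Y e _ H; have e0 := near2_ge0 H; apply: bd_le (proj1 H).
by rewrite ler_peMl //; lra.
Qed.

Lemma good_z d c : 0 <= d -> c <= b -> gd d c (fun X => X.2).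
Proof.
move=> d0 cb; apply: (good_weak cb).
exists (d + 1); first by rewrite addr_ge0.
move=> X h; split; first exact: cls_c2 h.
  by apply: bd_le (cls_bd2 h); lra.
move=> Y e _ H; have e0 := near2_ge0 H; apply: bd_le (proj2 H).
by rewrite ler_peMl //; lra.
Qed.

Lemma sqr_even X x : (forall x, X.1 (- x) = - X.1 x) -> X.1 (- x) * X.1 (- x) = X.1 x * X.1 x.
Proof. by move=> h; rewrite h mulrNN. Qed.

Lemma good_Y1 d c : 0 <= c -> c <= b -> gd d c Y1f.
Proof.
move=> c0 cb; apply: (good_green near2_ge0) => //; first exact: le_lt_trans b1.
  by apply: good_mul => //; exact: good_B.
by left => X h x; exact: sqr_even (cls_odd h).
Qed.

Lemma Y1_even d X x : cls b d X -> Y1f X (- x) = Y1f X x.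
Proof.
move=> h; apply: green_even; first by apply: cont_mul; exact: cls_c1 h.
by move=> z; exact: sqr_even (cls_odd h).
Qed.

Lemma good_Dn d : gdS d Dn.
Proof.
rewrite /Dn; apply: goodS_mul; first exact: (goodS_cst _ near2_ge0).
apply: good_pinf; apply: good_mul => //; first exact: good_Y1.
exact: good_B.
Qed.

Lemma good_Nn d : 0 <= d -> gdS d Nn.
Proof.
move=> d0; rewrite /Nn; apply: goodS_add; first by apply: good_pinf; exact: good_B.
apply: goodS_mul; first exact: (goodS_cst _ near2_ge0).
apply: good_pinf; apply: good_mul => //; first exact: good_z.
exact: good_B.
Qed.

(** The solvability functional is affine in the coefficient [bt]. With [bt = beta X] this yields
    orthogonality; for a given solution it forces the coefficient of that solution to be [beta X],
    hence the arbitrary [bt]. *)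
Lemma Jf_expand d X (bt : R) : 0 <= d -> cls b d X ->
  Jf (fun x => (1 + k * (bt * Y1f X x + X.2 x)) * X.1 x) = Nn X + bt * Dn X.
Proof.
move=> d0' h.
have [C1 _ /(_ X h) [cY hY _]] := good_Y1 d (lexx 0) b0.
have [C2 _ /(_ X h) [cB hB _]] := good_B d b0.
have [C3 _ /(_ X h) [cz hz _]] := good_z d0' b0.
have HB := bd_phi_mul S2 hB.
have HYB := bd_phi_mul S2 (bd_mul0 hY hB); have HzB := bd_phi_mul S2 (bd_mul0 hz hB).
have cgB := cont_mul cg cB; have cgY := cont_mul cg (cont_mul cY cB).
have cgz := cont_mul cg (cont_mul cz cB).
rewrite /Jf (_ : (fun z => _) = (fun z => g z * X.1 z + (k * bt * (g z * (Y1f X z * X.1 z))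
   + k * (g z * (X.2 z * X.1 z))))); last first.
  by apply/funext => z; ring.
rewrite (pinf_add al2 cgB (cont_add (@cont_scale _ (k * bt) _ cgY) (@cont_scale _ k _ cgz)) HB
  (bd_add (bd_scale (k * bt) HYB) (bd_scale k HzB))).
rewrite (pinf_add al2 (@cont_scale _ (k * bt) _ cgY) (@cont_scale _ k _ cgz)
  (bd_scale (k * bt) HYB) (bd_scale k HzB)).
rewrite (pinf_scale _ al2 cgY HYB) (pinf_scale _ al2 cgz HzB).
by rewrite /Nn /Dn /Jf; ring.
Qed.

Lemma Nn_base : Nn base = Jf g.
Proof.
rewrite /Nn /base /=; rewrite [X in _ + k * X](_ : _ = 0) ?mulr0 ?addr0 //.
rewrite /Jf; rewrite (_ : (fun z => _) = (fun z => 0 * g z)); last first.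
  by apply/funext => z; rewrite !mul0r mulr0.
by rewrite (pinf_scale 0 (rate_gt0 S2) cg (bd_phi S2)) mul0r.
Qed.

Lemma Jg_gt0 : (forall x, 0 < x -> 0 < g x) -> 0 < Jf g.
Proof.
move=> gp; apply: (@pinf_gt0 _ (rate S2 + rate S2) (fsC S2 * fsC S2)).
- by rewrite addr_gt0 // rate_gt0.
- exact: cont_mul.
- exact: bd_mul (bd_phi S2) (bd_phi S2).
- by move=> x x0; rewrite mulr_gt0 // gp.
Qed.

Hypothesis gp : forall x, 0 < x -> 0 < g x.
(** Half of the inner product of [g^2] with [L1^-1 (g^2)], the integrand being even; [Dn base] is
    [k * D]. *)
Let D := Jf (fun x => Y1f base x * g x).
Hypothesis D0 : D != 0.

(** At [base] one has [Nn = Jf g > 0] and [Dn = k * D]. Both depend on the pair in a Lipschitz way,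
    so nearby they keep at least half of these values, which gives [beta] a denominator bounded
    below and a definite sign. *)
Lemma small_class : exists2 d : R, 0 < d <= 1 & forall X, cls b d X ->
  [/\ k * `|D| / 2 <= `|Dn X|, 0 < Dn X * D & 0 < Nn X].
Proof.
(* The constants are taken on the class of radius [1], so that they do not depend on the radius [m]
   chosen below. *)
have [C C0 hC] := good_Dn 1; have [C' C'0 hC'] := good_Nn (@ler01 R).
have G0 := Jg_gt0 gp.
have kD : 0 < k * `|D| / 2 by rewrite divr_gt0 // mulr_gt0 // normr_gt0.
(* The deviations from [base] are at most [C * m] and [C' * m], to be kept below half of the central
   values; the [+ 1] avoids a zero divisor. *)
pose m := Num.min 1 (Num.min (k * `|D| / 2 / (C + 1)) (Jf g / 2 / (C' + 1))).
have C1 : 0 < C + 1 by rewrite ltr_wpDl.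
have C'1 : 0 < C' + 1 by rewrite ltr_wpDl.
have m0 : 0 < m by rewrite /m !lt_min ltr01 (divr_gt0 kD C1) !divr_gt0.
have m1 : m <= 1 by rewrite /m ge_min lexx.
have m2 : C * m <= k * `|D| / 2.
  apply: le_trans (_ : (C + 1) * m <= _); first by rewrite ler_wpM2r ?(ltW m0) // lerDl.
  by rewrite mulrC -ler_pdivlMr // /m !ge_min lexx orbT.
have m3 : C' * m <= Jf g / 2.
  apply: le_trans (_ : (C' + 1) * m <= _); first by rewrite ler_wpM2r ?(ltW m0) // lerDl.
  by rewrite mulrC -ler_pdivlMr // /m !ge_min lexx !orbT.
exists m; first by rewrite m0.
move=> X hX; have hX1 := cls_le m1 hX.
have [_ _ /(_ base m (base_cls ler01) (cls_near2 hX)) /bd0P /(_ 0) H1] := hC X hX1.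
have [_ _ /(_ base m (base_cls ler01) (cls_near2 hX)) /bd0P /(_ 0) H2] := hC' X hX1.
have {}H1 := le_trans H1 m2; have {}H2 := le_trans H2 m3.
rewrite Nn_base in H2; rewrite -/(Dn base) [Dn base]/Dn -/D in H1.
have kDn : `|k * D| = k * `|D| by rewrite normrM gtr0_norm.
split.
- have := ler_normB (Dn X) (Dn X - k * D); rewrite subKr kDn; lra.
- have DD : 0 < D * D by rewrite -expr2 exprn_even_gt0.
  have : `|(Dn X - k * D) * D| <= k * `|D| / 2 * `|D| by rewrite normrM ler_wpM2r.
  have -> : k * `|D| / 2 * `|D| = k * (D * D) / 2.
    by rewrite -[D * D]expr2 -real_normK ?num_real // expr2; ring.
  rewrite ler_norml => /andP[+ _]; have := mulr_gt0 k0 DD; lra.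
- by move: H2; rewrite ler_norml => /andP[+ _]; lra.
Qed.

Section Small.
Variable d : R.
Hypotheses (d0 : 0 < d) (d1 : d <= 1).
Hypothesis sm : forall X, cls b d X ->
  [/\ k * `|D| / 2 <= `|Dn X|, 0 < Dn X * D & 0 < Nn X].

Let d0' : 0 <= d := ltW d0.

Lemma Dn_neq0 X : cls b d X -> Dn X != 0.
Proof. by case/sm => _ H _; apply: contraTneq H => ->; rewrite mul0r ltxx. Qed.

Lemma good_beta : gdS d beta.
Proof.
have H : gdS d (fun X => (-1) * (Nn X * (Dn X)^-1)).
  apply: goodS_mul; first exact: (goodS_cst _ near2_ge0).
  apply: goodS_mul; first exact: good_Nn.
  apply: (goodS_inv near2_ge0 (e := k * `|D| / 2)); last exact: good_Dn.
    by rewrite divr_gt0 // mulr_gt0 // normr_gt0.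
  by move=> X /sm[].
by apply: good_ext H => X _; apply/funext => x; rewrite /beta mulN1r.
Qed.

(** The origin of the sign condition on [mu]: the product [mu * beta X] has to be the square of the
    amplitude. *)
Lemma beta_sign X : cls b d X -> beta X * D < 0.
Proof.
move=> h; have [_ H1 H2] := sm h; rewrite /beta mulNr oppr_lt0 -mulrA mulr_gt0 //.
have n0 := Dn_neq0 h.
have -> : (Dn X)^-1 * D = (Dn X)^-1 ^+ 2 * (Dn X * D) by field.
by rewrite mulr_gt0 // exprn_even_gt0 // invr_neq0.
Qed.

Lemma good_v c : 0 <= c -> c <= b -> gd d c vf.
Proof.
move=> c0 cb; apply: good_add; last exact: good_z.
apply: good_scale => //; first exact: good_beta.
exact: good_Y1.
Qed.

Lemma good_A2 : gd d b A2f.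
Proof.
have H : gd d b (fun X x => X.1 x * (1 + k * vf X x)).
  apply: good_mul => //; first exact: good_B.
  apply: good_add; first exact: (goodS_cst _ near2_ge0).
  apply: (good_scale (s := fun=> k)) => //; first exact: (goodS_cst _ near2_ge0).
  exact: good_v.
by apply: good_ext H => X _; apply/funext => x; rewrite mulrC.
Qed.

Lemma good_V2 : gd d b V2f.
Proof.
apply: (good_scale (s := fun=> 2^-1)) => //; first exact: (goodS_cst _ near2_ge0).
by apply: good_mul => //; exact: good_v.
Qed.

Lemma v_even X x : cls b d X -> vf X (- x) = vf X x.
Proof. by move=> h; rewrite /vf (Y1_even x h) (cls_even h). Qed.

Lemma V2_even X x : cls b d X -> V2f X (- x) = V2f X x.
Proof. by move=> h; rewrite /V2f v_even. Qed.

Lemma A2_odd X x : cls b d X -> A2f X (- x) = - A2f X x.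
Proof. by move=> h; rewrite /A2f v_even // (cls_odd h) mulrN. Qed.

Lemma A2_solvable X : cls b d X -> Jf (A2f X) = 0.
Proof.
move=> h; have n0 := Dn_neq0 h.
rewrite (Jf_expand (beta X) d0' h) /beta; by field.
Qed.

Lemma good_F1 : gd d b F1.
Proof.
apply: (good_green near2_ge0) => //; first exact: good_A2.
right => X h; split; last exact: A2_solvable.
by move=> z; exact: A2_odd.
Qed.

Lemma good_F2 : gd d b F2.
Proof.
apply: (good_green near2_ge0) => //; first exact: good_V2.
by left => X h z; exact: V2_even.
Qed.

(** The Lipschitz bounds in the space variable come from the bound on [green1]. Their constant is
    uniform over the class, which supplies the equicontinuity for passing to pointwise limits. *)
Lemma F_estimates : exists2 C : R, 0 < C & forall X, cls b d X ->
  [/\ bd b C (F1 X) /\ bd b C (F2 X),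
      forall x y, `|F1 X x - F1 X y| <= C * `|x - y|,
      forall x y, `|F2 X x - F2 X y| <= C * `|x - y| &
      forall Y e, cls b d Y -> near2 e X Y ->
        bd 0 (C * e) (fun x => F1 X x - F1 Y x) /\ bd 0 (C * e) (fun x => F2 X x - F2 Y x)].
Proof.
have [C1 C10 h1] := good_F1; have [C2 C20 h2] := good_F2.
have [C3 C30 h3] := good_A2; have [C4 C40 h4] := good_V2.
have r1 := rate_gt0 S1; have r2 := rate_gt0 S2.
have g1 := greenC_ge0 r1; have g2 := greenC_ge0 r2.
have p1 := mulr_ge0 g2 C30; have p2 := mulr_ge0 g1 C40.
pose C := C1 + C2 + greenC S2 0 * C3 + greenC S1 0 * C4 + 1.
have L1 : C1 <= C by rewrite /C; lra.
have L2 : C2 <= C by rewrite /C; lra.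
have L3 : greenC S2 0 * C3 <= C by rewrite /C; lra.
have L4 : greenC S1 0 * C4 <= C by rewrite /C; lra.
exists C; first by rewrite /C; lra.
move=> X hX; have [_ b1' l1] := h1 X hX; have [_ b2' l2] := h2 X hX.
have [c3 b3 _] := h3 X hX; have [c4 b4 _] := h4 X hX.
have [_ G3] := bd_green (lexx 0) r2 c3 (bd_weak C30 b0 b3)
  (or_intror (conj (fun x => A2_odd x hX) (A2_solvable hX))).
have [_ G4] := bd_green (lexx 0) r1 c4 (bd_weak C40 b0 b4) (or_introl (fun x => V2_even x hX)).
move/bd0P in G3; move/bd0P in G4.
split.
- by split; [exact: bd_le b1'|exact: bd_le b2'].
- by move=> x y; apply: (dv_lip x y (dv_green S2 c3)) => z; exact: le_trans (G3 z) L3.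
- by move=> x y; apply: (dv_lip x y (dv_green S1 c4)) => z; exact: le_trans (G4 z) L4.
move=> Y e hY XY; have e0 := near2_ge0 XY; split.
  by apply: bd_le (l1 Y e hY XY); rewrite ler_wpM2r.
by apply: bd_le (l2 Y e hY XY); rewrite ler_wpM2r.
Qed.

Lemma fixpt_exists : exists2 e : R, 0 < e & forall mu, `|mu| <= e ->
  (exists X, cls b d X /\ fixpt mu X) /\
  (forall X Y, cls b d X -> cls b d Y -> fixpt mu X -> fixpt mu Y ->
    X.1 =1 Y.1 /\ X.2 =1 Y.2).
Proof.
have [C C0 hC] := F_estimates; have f0 := fsC_ge0 S2; have d1_ := d1; have d0_ := d0.
(* [|mu| * C <= d / 2] keeps iterates in the class of radius [d], and with [d <= 1] it also gives
   the contraction ratio [1 / 2]. *)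
pose e := Num.min 1 (d / 2 / C).
have e0 : 0 < e by rewrite /e lt_min ltr01 !divr_gt0.
exists e => // mu hmu.
have mu1 : `|mu| <= 1 by apply: le_trans hmu _; rewrite /e ge_min lexx.
have muC : `|mu| * C <= d / 2.
  by rewrite -ler_pdivlMr //; apply: le_trans hmu _; rewrite /e ge_min lexx orbT.
have muC2 : `|mu| * C <= 2^-1 by apply: le_trans muC _; rewrite ler_piMl ?invr_ge0.
have muE q (a : R) : 0 <= q -> `|a| <= C * q -> `|mu * a| <= q / 2.
  move=> q0 h; rewrite normrM; apply: le_trans (_ : `|mu| * (C * q) <= _).
    by rewrite ler_wpM2l.
  by rewrite mulrA mulrC ler_wpM2l.
pose DD := fsC S2 + 1 + (fsC S2 + 1).
have clsD X Y : cls b d X -> cls b d Y -> near2 DD X Y.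
  move=> hX hY; split; apply: bd_add.
  - by apply: bd_weak (cls_bd1 hX) => //; rewrite addr_ge0.
  - by apply: bd_opp; apply: bd_weak (cls_bd1 hY) => //; rewrite addr_ge0.
  - by apply: bd_le (bd_weak d0' b0 (cls_bd2 hX)); lra.
  - by apply: bd_opp; apply: bd_le (bd_weak d0' b0 (cls_bd2 hY)); lra.
split; last first.
  move=> X Y hX hY [X1 X2] [Y1 Y2].
  (* Uniqueness: the contraction is iterated, starting from the diameter bound [DD] of the class. *)
  have K n : near2 (DD / 2 ^+ n) X Y.
    elim: n => [|n IH]; first by rewrite expr0 divr1; exact: clsD.
    have [_ _ _ /(_ Y _ hY IH) [/bd0P H1 /bd0P H2]] := hC X hX.
    have q0 := near2_ge0 IH.
    rewrite exprSr invfM mulrA; split; apply/bd0P => x.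
      rewrite X1 Y1 [g x + _ - _](_ : _ = mu * (F1 X x - F1 Y x)); last by ring.
      exact: muE.
    rewrite X2 Y2 -mulrBr; exact: muE.
  split=> x; apply/eqP; rewrite -subr_eq0; apply/eqP; apply: (@half_zero _ _ DD) => n.
    by have [/bd0P H _] := K n; exact: H.
  by have [_ /bd0P H] := K n; exact: H.
(* [picard] acts on a single function, so the pair is indexed by [bool * R]. *)
pose pr (t : bool * R -> R) : pair := (fun x => t (true, x), fun x => t (false, x)).
pose Fm (t : bool * R -> R) (i : bool * R) :=
  if i.1 then g i.2 + mu * F1 (pr t) i.2 else mu * F2 (pr t) i.2.
pose L := fsC S2 + C.
(* Continuity alone does not survive pointwise limits; a common Lipschitz constant does, and implies
   it. *)
pose Q t := cls b d (pr t) /\ forall c x y, `|t (c, x) - t (c, y)| <= L * `|x - y|.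
have lg x y : `|g x - g y| <= fsC S2 * `|x - y|.
  apply: (dv_lip x y (dv_phi S2)) => z.
  by have /bd0P := bd_weak f0 (ltW (rate_gt0 S2)) (bd_phi1 S2); exact.
have muL (a q : R) : 0 <= q -> `|a| <= C * q -> `|mu * a| <= C * q.
  move=> q0 h; rewrite normrM; apply: le_trans (ler_wpM2r (normr_ge0 _) mu1) _.
  by rewrite mul1r.
have QF t : Q t -> Q (Fm t).
  move=> [ht _]; have [[B1 B2] l1 l2 _] := hC _ ht; split; last first.
    move=> c x y; rewrite /Fm /L /=; case: c.
      rewrite opprD addrACA -mulrBr mulrDl; apply: le_trans (ler_normD _ _) _.
      by apply: lerD; [exact: lg|exact: muL].
    rewrite -mulrBr; apply: le_trans (muL _ _ (normr_ge0 _) (l2 x y)) _.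
    by rewrite ler_wpM2r // lerDr.
  have c3 : continuous (A2f (pr t)) by have [? _ /(_ _ ht)[]] := good_A2.
  have c4 : continuous (V2f (pr t)) by have [? _ /(_ _ ht)[]] := good_V2.
  have muB f : bd b C f -> bd b (d / 2) (fun x => mu * f x).
    move=> h; apply: bd_le (bd_scale mu h); exact: muC.
  split; rewrite /Fm /=.
  - by apply: cont_add => //; apply: cont_scale; exact: green_cont.
  - by apply: cont_scale; exact: green_cont.
  - move=> x; rewrite phi_odd /F1 (green_odd x c3 (fun z => A2_odd z ht) (A2_solvable ht)).
    by ring.
  - by move=> x; rewrite /F2 (green_even S1 x c4 (fun z => V2_even z ht)).
  - apply/bd0P => x; rewrite addrAC subrr add0r.
    have /bd0P /(_ x) := bd_weak (ltW (divr_gt0 d0 (ltr0Sn R 1))) b0 (muB _ B1).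
    by move/le_trans; apply; lra.
  - have H := bd_add (bd_weight f0 (bd_phi S2)) (muB _ B1).
    by apply: bd_le H; rewrite lerD2l; lra.
  - by apply: bd_le (muB _ B2); lra.
have Q0 : Q (fun i => if i.1 then g i.2 else 0).
  split; first exact: (base_cls d0').
  move=> c x y; rewrite /L; case: c => /=.
    by apply: le_trans (lg x y) _; rewrite ler_wpM2r // lerDl ltW.
  by rewrite subrr normr0 mulr_ge0 // addr_ge0 // ltW.
have [|||l [hl _] Fl] := @picard R (bool * R)%type Q Fm _ DD Q0 QF.
- move=> u l Qu ul.
  have ll c x y : `|l (c, x) - l (c, y)| <= L * `|x - y|.
    apply: (lim_bound (cvgB (ul (c, x)) (ul (c, y)))) => n.
    by case: (Qu n) => _; exact.
  split => //; split => /=.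
  - by apply: lip_cont => x y; exact: ll.
  - by apply: lip_cont => x y; exact: ll.
  - move=> x; apply/eqP; rewrite -addr_eq0 -normr_le0.
    apply: (lim_bound (cvgD (ul (true, - x)) (ul (true, x)))) => n /=.
    by case: (Qu n) => [h _]; have := cls_odd h x => /= ->; rewrite addNr normr0.
  - move=> x; apply/eqP; rewrite -subr_eq0 -normr_le0.
    apply: (lim_bound (cvgB (ul (false, - x)) (ul (false, x)))) => n /=.
    by case: (Qu n) => [h _]; have := cls_even h x => /= ->; rewrite subrr normr0.
  - move=> x; apply: (lim_bound (cvgB (ul (true, x)) (cvg_cst _))) => n /=.
    by case: (Qu n) => [h _]; exact: (cls_near h x).
  - move=> x; apply: (lim_bound (ul (true, x))) => n /=.
    by case: (Qu n) => [h _]; exact: (cls_bd1 h x).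
  - move=> x; apply: (lim_bound (ul (false, x))) => n /=.
    by case: (Qu n) => [h _]; exact: (cls_bd2 h x).
- move=> s t e' [hs _] [ht _] st [c x].
  have N : near2 e' (pr s) (pr t) by split; apply/bd0P => y; exact: st.
  have [_ _ _ /(_ _ _ ht N) [/bd0P H1 /bd0P H2]] := hC _ hs.
  have e'0 := near2_ge0 N; rewrite /Fm; case: c => /=.
    rewrite [g x + _ - _](_ : _ = mu * (F1 (pr s) x - F1 (pr t) x)); last by ring.
    exact: muE.
  by rewrite -mulrBr; exact: muE.
- move=> s t [c x] [hs _] [ht _]; have [/bd0P H1 /bd0P H2] := clsD _ _ hs ht.
  by case: c; [exact: H1|exact: H2].
exists (pr l); split=> //; split=> x /=; first by rewrite -[in LHS]Fl.
by rewrite -[in LHS]Fl.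
Qed.
End Small.
End Weight.
End Nonlinear.

(** * Weak derivatives *)

Section Smooth.
Variable R : realType.
Implicit Types (f g : R -> R) (P : (R -> R) -> Prop).

Definition smooth f := forall n x, derivable (derive1n n f) x 1.

(** A coinduction principle that replaces formulas for higher derivatives: membership in [P] passes
    to every iterated derivative. *)
Lemma smooth_stable P : (forall f, P f -> exists2 f', dv f f' & P f') ->
  forall f, P f -> smooth f.
Proof.
move=> h f Pf n; have : P (derive1n n f).
  elim: n => [//|n IH]; have [f' df Pf'] := h _ IH.
  by rewrite derive1nS; have -> : (derive1n n f)^`()%classic = f' by apply/funext; exact: dv_val.
by case/h => f' df _; exact: dv_derivable df.
Qed.

Lemma smooth_dv f : smooth f -> exists2 f', dv f f' & smooth f'.
Proof.
move=> sf; exists (f^`()%classic).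
  by move=> x; rewrite derive1E; apply/derivableP; exact: sf 0%N x.
by move=> n x; have := sf n.+1 x; rewrite /derive1n iterSr.
Qed.

Lemma smooth_prim f f' : dv f f' -> smooth f' -> smooth f.
Proof.
move=> df sf; apply: (@smooth_stable (fun g => g = f \/ smooth g)); last by left.
move=> g [->|/smooth_dv[g' dg sg]]; [by exists f'; [|right]|by exists g'; [|right]].
Qed.

Lemma smooth_affine f a s t : smooth f -> smooth (fun x => a * f (s * x + t)).
Proof.
move=> sf; apply: (@smooth_stable (fun g => exists a s t f, smooth f /\ g = fun x => a * f (s * x + t))).
  move=> _ [{}a [{}s [{}t [h [/smooth_dv[h' dh sh] ->]]]]].
  exists (fun x => (a * s) * h' (s * x + t)); last by exists (a * s), s, t, h'.
  have H := dv_scale a (dv_comp dh (dv_add (dv_scale s (@dv_id R)) (dv_cst t))).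
  by apply: dv_eq H _ => x; ring.
by exists a, s, t, f.
Qed.

Lemma smooth_add f g : smooth f -> smooth g -> smooth (fun x => f x + g x).
Proof.
move=> sf sg; apply: (@smooth_stable (fun h => exists f g, [/\ smooth f, smooth g & h = fun x => f x + g x])).
  move=> _ [a [b [/smooth_dv[a' da sa] /smooth_dv[b' db sb] ->]]].
  by exists (fun x => a' x + b' x); [exact: dv_add|exists a', b'].
by exists f, g.
Qed.

Lemma quad_derive0 f (C x : R) : f x = 0 -> (forall y, `|f y| <= C * `|y - x| ^+ 2) ->
  is_derive x 1 f 0.
Proof.
move=> fx h; have C0 : 0 <= C.
  by have := h (x + 1); rewrite addrAC subrr add0r normr1 expr1n mulr1; exact: le_trans.
have H : y^-1 *: (f (y *: (1 : R) + x) - f x) @[y --> 0^'] --> (0 : R).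
  apply/cvgrPdist_lt => e e0; have C1 : 0 < C + 1 by rewrite ltr_wpDl.
  near=> y; rewrite sub0r normrN fx subr0 /GRing.scale /= mulr1.
  have y0 : y != 0 by near: y; exact: nbhs_dnbhs_neq.
  have ny0 : 0 < `|y| by rewrite normr_gt0.
  rewrite normrM normfV mulrC ltr_pdivrMr //; apply: le_lt_trans (h _) _.
  rewrite addrK expr2 mulrA ltr_pM2r //.
  apply: le_lt_trans (_ : (C + 1) * `|y| < e); first by rewrite ler_wpM2r // lerDl.
  rewrite mulrC -ltr_pdivlMr //; near: y; apply: dnbhs0_lt; exact: divr_gt0.
split; first by apply/cvg_ex; exists 0.
exact: cvg_lim H.
Unshelve. all: by end_near. Qed.

(** Functions [p w^m exp (- w)] with [w = 1 / (1 - x^2)], extended by zero: a family closed under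
    differentiation, as [smooth_stable] requires. *)
Definition bump (p : {poly R}) (m : nat) x : R :=
  if `|x| < 1 then p.[x] * (1 - x ^+ 2)^-1 ^+ m * expR (- (1 - x ^+ 2)^-1) else 0.

(* From differentiating [p w^m exp(-w)] with [w = 1 / (1 - x^2)], [w' = 2 x w^2]. *)
Definition bump_next (p : {poly R}) (m : nat) : {poly R} :=
  p^`() * (1 - 'X^2) ^+ 2 + (2 * m%:R) *: ('X * p * (1 - 'X^2)) - 2 *: ('X * p).

Lemma sqr_lt1 (x : R) : `|x| < 1 -> 0 < 1 - x ^+ 2.
Proof. by move=> x1; rewrite subr_gt0 -real_normK ?num_real // exprn_ilt1. Qed.

Lemma poly_bound (p : {poly R}) : exists2 K : R, 0 <= K & forall x, `|x| <= 1 -> `|p.[x]| <= K.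
Proof.
elim/poly_ind: p => [|p c [K K0 h]]; first by exists 0 => // x _; rewrite horner0 normr0.
exists (K + `|c|); first by rewrite addr_ge0.
move=> x x1; rewrite !hornerE; apply: le_trans (ler_normD _ _) _; rewrite lerD2r normrM.
by apply: le_trans (ler_piMr _ x1) _ => //; exact: h.
Qed.

(** The Taylor term of order [m + 2] gives [exp w >= w^(m+2) / (m+2)!], hence
    [w^m exp (- w) <= (m+2)! (1 - x^2)^2]; the factor [4] bounds [(1 + |x|)^2]. *)
Lemma bump_decay p m : exists C : R, forall x, `|bump p m x| <= C * Num.max 0 (1 - `|x|) ^+ 2.
Proof.
have [K K0 hK] := poly_bound p; exists (K * ((m.+2)`!%:R * 4)) => x.
rewrite /bump; case: ifPn => [x1|_]; last by rewrite normr0 !mulr_ge0 // sqr_ge0.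
have u0 := sqr_lt1 x1; set u := 1 - x ^+ 2 in u0 *.
rewrite max_r ?subr_ge0 ?(ltW x1) // -mulrA normrM -mulrA ler_pM ?hK ?(ltW x1) //.
have ui : 0 < u^-1 by rewrite invr_gt0.
rewrite ger0_norm; last by rewrite mulr_ge0 ?expR_ge0 // exprn_ge0 // ltW.
have E : u^-1 ^+ m * expR (- u^-1) <= (m.+2)`!%:R * u ^+ 2.
  have f0 : 0 < (m.+2)`!%:R :> R by rewrite ltr0n fact_gt0.
  have H := expR_ge1Dxn m.+1 (ltW ui).
  have {}H : u^-1 ^+ m.+2 / (m.+2)`!%:R <= expR u^-1 by apply: le_trans H; rewrite lerDr.
  rewrite expRN ler_pdivrMr ?expR_gt0 //.
  apply: le_trans (_ : (m.+2)`!%:R * u ^+ 2 * (u^-1 ^+ m.+2 / (m.+2)`!%:R) <= _); last first.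
    by rewrite ler_wpM2l // mulr_ge0 ?sqr_ge0 ?ltW.
  set F := (m.+2)`!%:R in f0 *; rewrite -[m.+2]addn2 exprD le_eqVlt; apply/orP; left; apply/eqP.
  by field; rewrite (lt0r_neq0 u0) (lt0r_neq0 f0).
apply: le_trans E _; rewrite -mulrA ler_wpM2l //.
have -> : u = (1 - `|x|) * (1 + `|x|) by rewrite /u -[x ^+ 2]real_normK ?num_real //; ring.
rewrite exprMn mulrC ler_wpM2r ?sqr_ge0 //.
have -> : 4 = 2 ^+ 2 :> R by ring.
by rewrite ler_pXn2r ?nnegrE ?addr_ge0 //; lra.
Qed.

Lemma dv_bump p m : dv (bump p m) (bump (bump_next p m) m.+2).
Proof.
move=> x; have [x1|x1] := ltP `|x| 1.
  have u0 := sqr_lt1 x1; have un := lt0r_neq0 u0.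
  apply: (@near_eq_is_derive _ _ _ (fun x => p.[x] * (1 - x ^+ 2)^-1 ^+ m * expR (- (1 - x ^+ 2)^-1))).
    near=> y; rewrite /bump ifT //; near: y.
    by apply: cvgr_lt x1; apply: cvg_norm; exact: cvg_id.
  have du : is_derive x 1 (fun y : R => 1 - y ^+ 2) (- (2 * x)).
    have := dv_sub (dv_cst 1) (dv_sqr (@dv_id R)) x.
    by rewrite mulr1 sub0r.
  have dw : is_derive x 1 (fun y : R => (1 - y ^+ 2)^-1) (2 * x * (1 - x ^+ 2)^-1 ^+ 2).
    rewrite [X in is_derive _ _ _ X](_ : _ = - (1 - x ^+ 2) ^- 2 *: - (2 * x)).
      exact: is_deriveV.
    by rewrite /GRing.scale /=; field.
  pose w := (1 - x ^+ 2)^-1.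
  have dwm : is_derive x 1 (fun y : R => (1 - y ^+ 2)^-1 ^+ m) ((m%:R * w ^+ m.-1) *: (2 * x * w ^+ 2)).
    have -> : (fun y : R => (1 - y ^+ 2)^-1 ^+ m) = (fun y : R => (1 - y ^+ 2)^-1) ^+ m.
      by apply/funext => y; rewrite fctE.
    exact: is_deriveX.
  have d1 : is_derive x 1 (fun y : R => p.[y] * (1 - y ^+ 2)^-1 ^+ m)
      (p.[x] *: ((m%:R * w ^+ m.-1) *: (2 * x * w ^+ 2)) + w ^+ m *: p^`().[x]).
    by apply: is_deriveM.
  have de : is_derive x 1 (fun y : R => expR (- (1 - y ^+ 2)^-1))
      (expR (- (1 - x ^+ 2)^-1) * (- (2 * x * (1 - x ^+ 2)^-1 ^+ 2))).
    by apply: (@is_derive1_comp _ (@expR R)); exact: is_deriveN.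
  rewrite [X in is_derive _ _ _ X](_ : _ = (p.[x] * w ^+ m) *: (expR (- w) * (- (2 * x * w ^+ 2)))
     + expR (- w) *: (p.[x] *: ((m%:R * w ^+ m.-1) *: (2 * x * w ^+ 2)) + w ^+ m *: p^`().[x])).
    by apply: is_deriveM.
  have hE : (bump_next p m).[x] = p^`().[x] * (1 - x ^+ 2) ^+ 2
      + 2 * m%:R * x * p.[x] * (1 - x ^+ 2) - 2 * x * p.[x].
    by rewrite /bump_next !hornerE /=; ring.
  have sE (a b : R) : a *: b = a * b by [].
  rewrite /bump x1 hE !sE -/w.
  case: m {dwm d1 hE} => [|m]; first by rewrite expr0 /w; field.
  rewrite [w ^+ m.+3]exprS [w ^+ m.+2]exprS [w ^+ m.+1]exprS.
  have -> : m.+1.-1 = m by [].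
  by rewrite /w; field.
(* For [|x| >= 1] one has [1 - |y| <= |y - x|], so the decay bound is quadratic in the distance to
   [x]. *)
have [C hC] := bump_decay p m.
have b0 : bump p m x = 0 by rewrite /bump ltNge x1.
have b1 : bump (bump_next p m) m.+2 x = 0 by rewrite /bump ltNge x1.
rewrite b1; apply: (@quad_derive0 _ `|C|) => // y; apply: le_trans (hC y) _.
apply: le_trans (ler_wpM2r (sqr_ge0 _) (ler_norm C)) _; rewrite ler_wpM2l //.
rewrite ler_pXn2r ?nnegrE ?le_max ?lexx // ge_max normr_ge0 /=.
have := ler_normD y (x - y); rewrite addrC subrK distrC => h; lra.
Unshelve. all: by end_near. Qed.

Lemma smooth_bump p m : smooth (bump p m).
Proof.
apply: (@smooth_stable (fun f => exists p m, f = bump p m)); last by exists p, m.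
move=> _ [q [n ->]]; exists (bump (bump_next q n) n.+2); first exact: dv_bump.
by exists (bump_next q n), n.+2.
Qed.
End Smooth.

(** * Integrals over segments and primitives of locally integrable functions *)

Section SegmentIntegral.
Variable R : realType.
Notation mu := (@lebesgue_measure R).
Implicit Types (u v w f g : R -> R) (a b x y e : R).

Lemma cont_meas f : continuous f -> measurable_fun [set: R] f.
Proof. by move=> cf; exact: measurable_realfun.continuous_measurable_fun. Qed.

Lemma iloc_mul u f : iloc u -> continuous f -> iloc (fun x => u x * f x).
Proof.
move=> iu cf a b.
apply: (@integrableMl _ _ _ mu `[a, b] _ (EFin \o u) f) => //.
  exact: measurable_funS (cont_meas cf).
have cp : compact (f @` `[a, b]).
  apply: continuous_compact; last exact: segment_compact.
  by apply: continuous_subspaceT => x; exact: cf.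
have [M [Mr hM]] := compact_bounded cp; exists M; split => // N MN x abx.
by apply: hM => //; exists x.
Qed.

Lemma iloc_scale a f : iloc f -> iloc (fun x => a * f x).
Proof. by move=> hf c d; apply: (@integrableZl _ _ _ mu _ _ a (EFin \o f)). Qed.

Lemma iloc_sub f g : iloc f -> iloc g -> iloc (fun x => f x - g x).
Proof. by move=> hf hg a b; apply: (@integrableB _ _ _ mu _ _ (EFin \o f) (EFin \o g)). Qed.

Lemma iloc_abs f : iloc f -> iloc (fun x => `|f x|).
Proof. by move=> hf a b; exact: integrable_norm. Qed.

Lemma iloc_cst a : iloc (fun _ : R => a).
Proof. by apply: cont_iloc; exact: cont_cst. Qed.

Definition sint a b f : R := \int[mu]_(t in `[a, b]) f t.

Lemma sint_supp a b f : (forall t, ~~ (a <= t <= b) -> f t = 0) -> \int[mu]_t f t = sint a b f.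
Proof.
move=> h; rewrite /sint [RHS]Rintegral_mkcond; congr (Rintegral _ _ _).
apply/funext => t; rewrite patchE; case: ifPn => //; rewrite notin_setE /= in_itv /= => H.
by rewrite h //; apply/negP.
Qed.

Lemma sint_eq a b f g : (forall t, a <= t <= b -> f t = g t) -> sint a b f = sint a b g.
Proof. by move=> h; apply: eq_Rintegral => t; rewrite inE /= in_itv /=; exact: h. Qed.

Lemma sint_add a b f g : iloc f -> iloc g -> sint a b (fun x => f x + g x) = sint a b f + sint a b g.
Proof. by move=> hf hg; exact: RintegralD. Qed.

Lemma sint_sub a b f g : iloc f -> iloc g -> sint a b (fun x => f x - g x) = sint a b f - sint a b g.
Proof. by move=> hf hg; exact: RintegralB. Qed.

Lemma sint_scale a b c f : iloc f -> sint a b (fun x => c * f x) = c * sint a b f.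
Proof. by move=> hf; exact: RintegralZl. Qed.

Lemma sint_le a b f g : iloc f -> iloc g -> (forall t, a <= t <= b -> f t <= g t) ->
  sint a b f <= sint a b g.
Proof. by move=> hf hg h; apply: le_Rintegral => // t /=; rewrite in_itv /=; exact: h. Qed.

Lemma sint_abs a b f g : iloc f -> iloc g -> (forall t, a <= t <= b -> `|f t| <= g t) ->
  `|sint a b f| <= sint a b g.
Proof.
move=> hf hg h; apply: le_trans (le_normr_Rintegral _ (hf a b)) _ => //.
exact: sint_le (iloc_abs hf) hg h.
Qed.

Lemma sint_ftc F f a b : continuous f -> dv F f -> a <= b -> sint a b f = F b - F a.
Proof.
move=> cf dF ab; rewrite /sint -prim_sub //; last exact: cont_iloc.
by rewrite !(prim_unique _ cf dF); ring.
Qed.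

Lemma sint_split f a b c : iloc f -> a <= b -> b <= c -> sint a c f = sint a b f + sint b c f.
Proof. exact: int_split. Qed.

Lemma prim_cont f : iloc f -> continuous (prim f).
Proof.
move=> hf x; pose a := x - 1; pose b := x + 1.
have ax : a < x by rewrite /a ltrBlDr ltrDl.
have xb : x < b by rewrite /b ltrDl.
have := parameterized_integral_continuous (ltW (lt_trans ax xb)) (hf a b).
move/(continuous_within_itvP _ (lt_trans ax xb)) => [+ _ _].
move=> /(_ x); rewrite in_itv /= ax xb => /(_ isT) H.
have : {for x, continuous (fun y => prim f a + sint a y f)}.
  by apply: cvgD; [exact: cvg_cst|exact: H].
have E y : a <= y -> prim f a + sint a y f = prim f y.
  by move=> ay; rewrite /sint -prim_sub // addrC subrK.
rewrite /prop_for /continuous_at E ?(ltW ax) // => C.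
apply: cvg_trans C; apply: near_eq_cvg; near=> y.
by rewrite E //; near: y; exact: lt_le_nbhsr.
Unshelve. all: by end_near. Qed.

Lemma locint_iff f : locally_integrable [set: R] f <-> measurable_fun [set: R] f /\ iloc f.
Proof.
split=> [h|[mf h]]; first by split; [case: h|exact: locint_iloc].
split => //; first exact: openT.
move=> K _ cK.
have [M [Mr hM]] := compact_bounded cK.
have KM : K `<=` `[- (M + 1), M + 1].
  move=> t Kt; have := hM (M + 1); rewrite ltrDl ltr01 => /(_ isT t Kt).
  by rewrite /= in_itv /= ler_norml.
have /integrableP[_] := h (- (M + 1)) (M + 1).
apply: le_lt_trans; apply: ge0_subset_integral => //.
- exact: measurable_realfun.compact_measurable.
- apply/measurable_realfun.measurable_EFinP; apply: measurableT_comp => //.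
  exact: measurable_funS mf.
Qed.
End SegmentIntegral.

(** * Mollifiers, smooth plateaus and Lebesgue points *)

Section Mollifier.
Variable R : realType.
Notation mu := (@lebesgue_measure R).
Implicit Types (u v w f g : R -> R) (a b x y t e : R).

Definition rho : R -> R := bump 1 1.

Lemma rhoE x : `|x| < 1 -> rho x = (1 - x ^+ 2)^-1 * expR (- (1 - x ^+ 2)^-1).
Proof. by move=> h; rewrite /rho /bump h hornerC mul1r expr1. Qed.

Lemma rho_out x : 1 <= `|x| -> rho x = 0.
Proof. by move=> h; rewrite /rho /bump ltNge h. Qed.

Lemma rho_ge0 x : 0 <= rho x.
Proof.
have [h|/rho_out->//] := ltP `|x| 1; rewrite rhoE // mulr_ge0 ?expR_ge0 //.
by rewrite invr_ge0 ltW // sqr_lt1.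
Qed.

Lemma rho_cont : continuous rho. Proof. exact: dv_cont (dv_bump 1 1). Qed.

Let mass := prim rho 1 - prim rho (-1).

Lemma mass_gt0 : 0 < mass.
Proof.
have p0 : 0 < rho 0.
  by rewrite rhoE ?normr0 // expr0n subr0 invr1 mul1r expR_gt0.
have [c /andP[c0 c1]] := dv_mvt (dv_prim rho_cont) (@ltr01 R).
rewrite prim0 !subr0 mulr1 => E1.
have rc : 0 < rho c.
  have h : `|c| < 1 by rewrite gtr0_norm.
  by rewrite rhoE // mulr_gt0 ?expR_gt0 // invr_gt0 sqr_lt1.
have N : prim rho (-1) <= 0.
  have m1 : (-1 : R) <= 0 by rewrite lerN10.
  have := dv_ler (dv_cst 0) (dv_prim rho_cont) m1.
  by rewrite prim0 subrr sub0r oppr_ge0; apply => *; exact: rho_ge0.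
by rewrite /mass E1; lra.
Qed.

(** A smooth transition from [0] left of [-1] to [1] right of [1]. *)
Definition hstep t : R := (prim rho t - prim rho (-1)) / mass.
Definition hbump t : R := rho t / mass.

Lemma dv_hstep : dv hstep hbump.
Proof.
have H := dv_scale mass^-1 (dv_sub (dv_prim rho_cont) (dv_cst (prim rho (-1)))).
by apply: dv_eq (dv_ext H _) _ => t; rewrite ?subr0 mulrC.
Qed.

Lemma hbump_ge0 t : 0 <= hbump t.
Proof. by rewrite divr_ge0 ?rho_ge0 // ltW // mass_gt0. Qed.

Lemma hstep_homo x y : x <= y -> hstep x <= hstep y.
Proof.
move=> xy; rewrite -subr_ge0; have := dv_ler (dv_cst 0) dv_hstep xy.
by rewrite subrr; apply => *; exact: hbump_ge0.
Qed.

Lemma hstep_lo t : t <= -1 -> hstep t = 0.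
Proof.
move=> t1; have h z : t < z -> z < -1 -> hbump z = 0.
  by move=> _ z1; rewrite /hbump rho_out ?mul0r // ler_normr; apply/orP; right; lra.
have := dv_ler (dv_cst 0) dv_hstep t1; have := dv_ler dv_hstep (dv_cst 0) t1.
rewrite !subrr => A B; have {}A := A (fun z p q => eq_ind_r (fun s => s <= 0) (lexx 0) (h z p q)).
have {}B := B (fun z p q => eq_ind_r (fun s => 0 <= s) (lexx 0) (h z p q)).
have H1 : hstep (-1) = 0 by rewrite /hstep subrr mul0r.
by apply/eqP; rewrite eq_le; lra.
Qed.

Lemma hstep_hi t : 1 <= t -> hstep t = 1.
Proof.
move=> t1; have h z : 1 < z -> z < t -> hbump z = 0.
  by move=> z1 _; rewrite /hbump rho_out ?mul0r // ler_normr; apply/orP; left; lra.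
have := dv_ler (dv_cst 0) dv_hstep t1; have := dv_ler dv_hstep (dv_cst 0) t1.
rewrite !subrr => A B; have {}A := A (fun z p q => eq_ind_r (fun s => s <= 0) (lexx 0) (h z p q)).
have {}B := B (fun z p q => eq_ind_r (fun s => 0 <= s) (lexx 0) (h z p q)).
have H1 : hstep 1 = 1 by rewrite /hstep divff // lt0r_neq0 // mass_gt0.
by apply/eqP; rewrite eq_le; lra.
Qed.

Lemma hstep_itv t : 0 <= hstep t <= 1.
Proof.
apply/andP; split.
  have [h|h] := leP t (-1); first by rewrite hstep_lo.
  by rewrite -(hstep_lo (lexx (-1))) hstep_homo // ltW.
have [h|h] := leP 1 t; first by rewrite hstep_hi.
by rewrite -(hstep_hi (lexx 1)) hstep_homo // ltW.
Qed.

Lemma hbump_bound : exists2 K, 0 < K & forall t, hbump t <= K.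
Proof.
have [C hC] := bump_decay (1 : {poly R}) 1; have m0 := mass_gt0.
exists ((`|C| + 1) / mass); first by rewrite divr_gt0 // ltr_wpDl.
move=> t; rewrite /hbump ler_pM2r ?invr_gt0 //.
apply: le_trans (ler_norm _) _; apply: le_trans (hC t) _.
apply: le_trans (ler_wpM2r (sqr_ge0 _) (ler_norm C)) _.
apply: le_trans (_ : `|C| * 1 <= _); last by rewrite mulr1 lerDl.
by rewrite ler_wpM2l // exprn_ile1 // ?ge_max ?le_max ?lexx // ler01 gerBl normr_ge0.
Qed.

Lemma smooth_hbump : smooth hbump.
Proof.
have := @smooth_affine R rho mass^-1 1 0 (@smooth_bump R 1 1).
by congr smooth; apply/funext => t; rewrite /hbump mul1r addr0 mulrC.
Qed.

Lemma smooth_hstep : smooth hstep. Proof. exact: smooth_prim dv_hstep smooth_hbump. Qed.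

(** The factor [1] and the shape of the argument match [smooth_affine]. For [e > 0] the transition
    takes place across [[x - e, x + e]], and [moll] is its derivative. *)
Definition step e x t : R := 1 * hstep (e^-1 * t + - (e^-1 * x)).
Definition moll e x t : R := e^-1 * hbump (e^-1 * t + - (e^-1 * x)).

Lemma smooth_step e x : smooth (step e x). Proof. exact: smooth_affine smooth_hstep. Qed.
Lemma smooth_moll e x : smooth (moll e x). Proof. exact: smooth_affine smooth_hbump. Qed.

Lemma dv_step e x : dv (step e x) (moll e x).
Proof.
have H := dv_scale 1 (dv_comp dv_hstep (dv_add (dv_scale e^-1 (@dv_id R)) (dv_cst (- (e^-1 * x))))).
by apply: dv_eq H _ => t; rewrite /moll; ring.
Qed.

Lemma moll_cont e x : continuous (moll e x).
Proof. by have [f' /dv_cont] := smooth_dv (@smooth_moll e x). Qed.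

Lemma scaled_le e x t a : 0 < e -> (e^-1 * t + - (e^-1 * x) <= a) = (t <= x + e * a).
Proof. by move=> e0; rewrite -mulrBr mulrC ler_pdivrMr // lerBlDl [a * e]mulrC. Qed.

Lemma scaled_ge e x t a : 0 < e -> (a <= e^-1 * t + - (e^-1 * x)) = (x + e * a <= t).
Proof. by move=> e0; rewrite -mulrBr [_^-1 * _]mulrC ler_pdivlMr // lerBrDl [a * e]mulrC. Qed.

Lemma step_lo e x t : 0 < e -> t <= x - e -> step e x t = 0.
Proof. by move=> e0 h; rewrite /step hstep_lo ?mulr0 // scaled_le // mulrN1. Qed.

Lemma step_hi e x t : 0 < e -> x + e <= t -> step e x t = 1.
Proof. by move=> e0 h; rewrite /step hstep_hi ?mulr1 // scaled_ge // mulr1. Qed.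

Lemma step_itv e x t : 0 <= step e x t <= 1.
Proof. by rewrite /step mul1r hstep_itv. Qed.

Lemma moll_out e x t : 0 < e -> ~~ (x - e <= t <= x + e) -> moll e x t = 0.
Proof.
move=> e0 h; rewrite /moll /hbump rho_out ?mul0r ?mulr0 //.
rewrite ler_normr lerNr scaled_ge // scaled_le // mulr1 mulrN1.
by move: h; rewrite negb_and -!ltNge => /orP[|] /ltW ->; rewrite ?orbT.
Qed.

Lemma moll_mass e x : 0 < e -> sint (x - e) (x + e) (moll e x) = 1.
Proof.
move=> e0; rewrite (sint_ftc (moll_cont (e := e) (x := x)) (dv_step e x)); last by lra.
by rewrite (step_lo e0 (lexx (x - e))) (step_hi e0 (lexx (x + e))) subr0.
Qed.

Lemma compact_supp f a b : (forall t, ~~ (a <= t <= b) -> f t = 0) ->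
  compact (closure [set t | f t != 0]).
Proof.
move=> h; apply: (@subclosed_compact _ _ `[a, b]); first exact: closed_closure.
  exact: segment_compact.
rewrite closureE => t /(_ [set` `[a, b]]); apply; split; first exact: itv_closed.
by move=> z /= /eqP fz; rewrite in_itv /=; apply/negP => /negP /h.
Qed.

Lemma moll_test e x : 0 < e -> test_function (moll e x).
Proof.
by move=> e0; split; [exact: smooth_moll|apply: compact_supp => t; exact: moll_out].
Qed.

(** A smoothed indicator of [[x, y]]. Its derivative is a mollifier at [x] minus one at [y], so the
    weak derivative identity tested on it compares [u y - u x] with an integral of [v]. *)
Definition plateau e x y t : R := step e x t - step e y t.

Lemma dv_plateau e x y : dv (plateau e x y) (fun t => moll e x t - moll e y t).
Proof. exact: dv_sub (dv_step e x) (dv_step e y). Qed.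

Lemma plateau_out e x y t : 0 < e -> x <= y -> ~~ (x - e <= t <= y + e) -> plateau e x y t = 0.
Proof.
move=> e0 xy; rewrite negb_and -!ltNge => /orP[] h; rewrite /plateau.
  by rewrite !step_lo ?subrr //; lra.
by rewrite !step_hi ?subrr //; lra.
Qed.

Lemma plateau_test e x y : 0 < e -> x <= y -> test_function (plateau e x y).
Proof.
move=> e0 xy; split; last by apply: compact_supp => t; exact: plateau_out.
have := smooth_add (@smooth_step e x) (@smooth_affine _ _ (-1) 1 0 (@smooth_step e y)).
by congr smooth; apply/funext => t; rewrite /plateau mul1r addr0 mulN1r.
Qed.

(* Real-valued form, with explicit quantifiers, of the library's [lebesgue_pt]. *)
Definition leb_pt w x := forall d, 0 < d -> exists2 e0, 0 < e0 & forall e, 0 < e -> e < e0 ->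
  sint (x - e) (x + e) (fun t => `|w t - w x|) / (2 * e) <= d.

Lemma leb_pt_ae w : locally_integrable [set: R] w -> \forall x \ae mu, leb_pt w x.
Proof.
move=> lw; have iw := locint_iloc lw; have mw : measurable_fun [set: R] w by case: lw.
have := lebesgue_differentiation lw.
apply: filterS; first exact: (ae_filter_ringOfSetsType mu).
move=> x h d d0.
have /fine_cvgP[_ /cvgrPdist_lt/(_ d d0)] := h.
move=> [e0 /= e00 he]; exists e0 => // e ep ee.
have /= := he e; rewrite sub0r normrN gtr0_norm // => /(_ ee ep).
rewrite sub0r normrN /davg /iavg lebesgue_measure_ball ?(ltW ep) //.
have -> : (\int[mu]_(y in ball x e) `|(EFin ((center (w x) \o w) y))| )%E
   = (sint (x - e) (x + e) (fun t => `|w t - w x|))%:E.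
  rewrite /sint /Rintegral fineK; last first.
    apply: integrable_fin_num => //.
    by apply: (iloc_abs (iloc_sub iw (iloc_cst (w x)))).
  rewrite ball_itv (integral_itv_bndoo true false) //.
  apply/measurable_realfun.measurable_EFinP.
  apply: measurable_funS (measurableT) _ _ => //.
  apply: measurableT_comp => //; exact: measurable_realfun.measurable_funB.
move=> /(le_lt_trans (ler_norm _)) /ltW; rewrite inver gt_eqF ?mulrn_wgt0 //=.
by rewrite [in X in _ -> X]mulrC mulr_natl.
Qed.

Lemma moll_lim w x d : iloc w -> leb_pt w x -> 0 < d -> exists2 e0, 0 < e0 &
  forall e, 0 < e -> e < e0 ->
    `|sint (x - e) (x + e) (fun t => w t * moll e x t) - w x| <= d.
Proof.
move=> iw lp d0; have [K K0 hK] := hbump_bound.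
(* The kernel is at most [K / e] on an interval of length [2 e], hence the divisor [2 * K]. *)
have [e0 e00 he] := lp (d / (2 * K)) (divr_gt0 d0 (mulr_gt0 (ltr0Sn R 1) K0)).
exists e0 => // e ep ee; have cm := moll_cont (e := e) (x := x).
have iwm := iloc_mul iw cm.
have -> : w x = sint (x - e) (x + e) (fun t => w x * moll e x t).
  by rewrite sint_scale ?moll_mass ?mulr1 //; exact: cont_iloc.
rewrite -sint_sub //; last exact: iloc_mul (iloc_cst _) cm.
have id := iloc_abs (iloc_sub iw (iloc_cst (w x))).
have iR := iloc_scale (K / e) id.
apply: le_trans (sint_abs _ iR _) _.
- by apply: iloc_sub => //; exact: iloc_mul (iloc_cst _) cm.
- move=> t _; rewrite -mulrBl normrM mulrC ler_wpM2r //.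
  have ei : 0 <= e^-1 by rewrite invr_ge0 ltW.
  rewrite ger0_norm; last by rewrite /moll mulr_ge0 ?hbump_ge0.
  by rewrite /moll mulrC ler_wpM2r.
rewrite sint_scale //.
have := he e ep ee; rewrite ler_pdivrMr ?mulr_gt0 // => H.
apply: le_trans (ler_wpM2l _ H) _; first by rewrite divr_ge0 ?ltW.
rewrite le_eqVlt; apply/orP; left; apply/eqP; field.
by rewrite (lt0r_neq0 ep) (lt0r_neq0 K0).
Qed.
End Mollifier.

(** * Functions with a weak derivative are primitives of it *)

Section WeakDerivative.
Variable R : realType.
Notation mu := (@lebesgue_measure R).
Implicit Types (u v w f g : R -> R) (a b x y t e d : R).

Lemma small0 a : (forall d, 0 < d -> `|a| <= d) -> a = 0.
Proof.
move=> h; apply/eqP; rewrite -normr_le0; apply/ler_addgt0Pr => d d0.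
by rewrite add0r; exact: h.
Qed.

Lemma ae_and (P Q : R -> Prop) : (\forall x \ae mu, P x) -> (\forall x \ae mu, Q x) ->
  \forall x \ae mu, P x /\ Q x.
Proof.
move=> hP hQ; have F := ae_filter_ringOfSetsType mu.
exact: filterI hP hQ.
Qed.

Lemma ae_imp (P Q : R -> Prop) : (forall x, P x -> Q x) -> (\forall x \ae mu, P x) ->
  \forall x \ae mu, Q x.
Proof.
by move=> PQ hP; apply: (@filterS _ _ (ae_filter_ringOfSetsType mu) P).
Qed.

Lemma aeE f g : (\forall x \ae mu, f x = g x) <-> f = g %[ae mu].
Proof. by split; apply: ae_imp => x; [move=> ->|exact]. Qed.

Lemma ae_dense (P : R -> Prop) x e : 0 < e -> (\forall y \ae mu, P y) ->
  exists2 y, x < y < x + e & P y.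
Proof.
move=> e0 [N [mN N0 sub]]; apply: contrapT => H.
have : (mu `]x, (x + e)%R[ <= mu N)%E.
  apply: le_measure; rewrite ?inE //= => y; rewrite /= in_itv /= => xy.
  by apply: sub => Py; apply: H; exists y.
rewrite N0 lebesgue_measure_itv /= lte_fin ltrDl e0 -EFinD addrAC subrr add0r lee_fin.
by rewrite leNgt e0.
Qed.

Lemma plateau_itv e x y t : 0 < e -> x <= y -> 0 <= plateau e x y t <= 1.
Proof.
move=> e0 xy; have /andP[a1 a2] := step_itv e x t; have /andP[b1 b2] := step_itv e y t.
have h : step e y t <= step e x t.
  rewrite /step !mul1r; apply: hstep_homo.
  by rewrite lerD2l lerN2 ler_wpM2l // invr_ge0 ltW.
by rewrite /plateau; lra.
Qed.

(** Test with [plateau e x y] for small [e]. The error [d] is split into four parts [d / 4]: the two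
    mollified values of [u] at Lebesgue points, and the two transition zones in the integral of
    [v]. *)
Lemma weak_increment u v x y : weak_derivative u v -> leb_pt u x -> leb_pt u y -> x < y ->
  u y - u x = prim v y - prim v x.
Proof.
move=> [lu lv wk] px py xy; have iu := locint_iloc lu; have iv := locint_iloc lv.
have iav := iloc_abs iv.
apply/eqP; rewrite -subr_eq0; apply/eqP; apply: small0 => d d0.
have d4 : 0 < d / 4 by rewrite divr_gt0.
have [e1 e10 h1] := moll_lim iu px d4; have [e2 e20 h2] := moll_lim iu py d4.
(* The primitive of [|v|] is continuous, so a short transition zone contributes little. *)
have osc z : exists2 e0, 0 < e0 & forall e, 0 < e -> e < e0 ->
    sint (z - e) (z + e) (fun t => `|v t|) <= d / 4.
  have /cvgrPdist_lt/(_ (d / 8)) := prim_cont iav (x := z).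
  rewrite divr_gt0 // => /(_ isT) [e0 /= e00 H]; exists e0 => // e ep ee.
  rewrite /sint -prim_sub //; last lra.
  have A := H (z + e); have B := H (z - e).
  rewrite /ball /= in A B.
  have {}A : `|prim (fun t => `|v t|) z - prim (fun t => `|v t|) (z + e)| < d / 8.
    by apply: A; rewrite opprD addrA subrr add0r normrN gtr0_norm.
  have {}B : `|prim (fun t => `|v t|) z - prim (fun t => `|v t|) (z - e)| < d / 8.
    by apply: B; rewrite subKr gtr0_norm.
  by clear -A B; move: A B; rewrite !ltr_norml => /andP[A1 A2] /andP[B1 B2]; lra.
have [e3 e30 h3] := osc x; have [e4 e40 h4] := osc y.
(* Half of the minimum lies strictly below each threshold and satisfies [2 e <= y - x], so the
   transition zones do not overlap. *)
pose e := Num.min (Num.min e1 e2) (Num.min (Num.min e3 e4) (y - x)) / 2.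
have m0 : 0 < Num.min (Num.min e1 e2) (Num.min (Num.min e3 e4) (y - x)).
  by rewrite !lt_min e10 e20 e30 e40 subr_gt0.
have e0 : 0 < e by rewrite divr_gt0.
have em : e < Num.min (Num.min e1 e2) (Num.min (Num.min e3 e4) (y - x)) by rewrite /e; lra.
have e2m : e + e <= y - x.
  by rewrite -splitr !ge_min lexx !orbT.
have [f1 f2 f4 f5] : [/\ x - e <= x, x <= x + e, y - e <= y & y <= y + e].
  by split; rewrite ?gerBl ?lerDl ltW.
have f3 : x + e <= y - e by clear -e2m; lra.
have f6 : x + e <= y + e by rewrite lerD2r ltW.
have f7 : x + e <= y by exact: le_trans f3 f4.
have f9 : x <= y + e by exact: le_trans f2 f6.
have f8 : y - e <= y + e by exact: le_trans f4 f5.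
move: em; rewrite !lt_min => /andP[/andP[ee1 ee2] /andP[/andP[ee3 ee4] _]].
have {}h1 := h1 e e0 ee1; have {}h2 := h2 e e0 ee2.
have {}h3 := h3 e e0 ee3; have {}h4 := h4 e e0 ee4.
have xy' := ltW xy.
have cp : continuous (plateau e x y) := dv_cont (dv_plateau e x y).
have ivp := iloc_mul iv cp.
have Eu : \int[mu]_t (u t * derive1 (plateau e x y) t)
    = sint (x - e) (x + e) (fun t => u t * moll e x t) - sint (y - e) (y + e) (fun t => u t * moll e y t).
  have ix := iloc_mul iu (moll_cont (e := e) (x := x)).
  have iy := iloc_mul iu (moll_cont (e := e) (x := y)).
  have sx z : \int[mu]_t (u t * moll e z t) = sint (z - e) (z + e) (fun t => u t * moll e z t).
    by apply: sint_supp => t h; rewrite moll_out ?mulr0.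
  have sxy z : x <= z -> z <= y ->
      \int[mu]_t (u t * moll e z t) = sint (x - e) (y + e) (fun t => u t * moll e z t).
    move=> xz zy; apply: sint_supp => t h; rewrite moll_out ?mulr0 //.
    by apply: contra h => /andP[q1 q2]; clear -q1 q2 xz zy; apply/andP; split; lra.
  rewrite -!sx (sxy x) // (sxy y) // -sint_sub //.
  rewrite -(@sint_supp _ (x - e) (y + e)) => [|t h]; last first.
    have q z : x <= z -> z <= y -> ~~ (z - e <= t <= z + e).
      move=> xz zy; apply: contra h => /andP[q1 q2]; clear -q1 q2 xz zy.
      by apply/andP; split; lra.
    by rewrite !moll_out ?mulr0 ?subrr // q.
  apply: eq_Rintegral => t _; rewrite (dv_val (dv_plateau e x y)).
  by rewrite mulrBr.
have Ev : \int[mu]_t (v t * plateau e x y t) = sint (x - e) (y + e) (fun t => v t * plateau e x y t).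
  by apply: sint_supp => t h; rewrite plateau_out ?mulr0.
have := wk _ (plateau_test e0 xy'); rewrite Eu Ev => W.
have mid : sint (x + e) (y - e) (fun t => v t * plateau e x y t) = sint (x + e) (y - e) v.
  apply: sint_eq => t /andP[t1 t2].
  by rewrite /plateau (step_hi e0 t1) (step_lo e0 t2) subr0 mulr1.
have bnd a b (f : R -> R) : iloc f -> (forall t, `|f t| <= `|v t|) ->
    `|sint a b f| <= sint a b (fun t => `|v t|) by move=> hf hh; exact: sint_abs.
have p1 t : `|v t * plateau e x y t| <= `|v t|.
  by rewrite normrM; have /andP[q0 q1] := plateau_itv t e0 xy'; rewrite (ger0_norm q0) ler_piMr.
have p2 t : `|v t * plateau e x y t - v t| <= `|v t|.
  rewrite -[X in _ - X]mulr1 -mulrBr normrM; have /andP[q0 q1] := plateau_itv t e0 xy'.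
  by rewrite ler_piMr // distrC ger0_norm ?subr_ge0 // gerBl.
have ivd := iloc_sub ivp iv.
(* The integral of [v] from [x] to [y] contains nothing to the left of [x] and all of [v] to the
   right; both defects are dominated by [|v|]. *)
have g1 : `|sint (x - e) x (fun t => v t * plateau e x y t)
    + (sint x (x + e) (fun t => v t * plateau e x y t) - sint x (x + e) v)| <= d / 4.
  apply: le_trans (ler_normD _ _) _; apply: le_trans h3.
  rewrite (@sint_split _ _ (x - e) x (x + e)) //; apply: lerD; first exact: bnd.
  by rewrite -sint_sub //; exact: bnd.
have g2 : `|sint y (y + e) (fun t => v t * plateau e x y t)
    + (sint (y - e) y (fun t => v t * plateau e x y t) - sint (y - e) y v)| <= d / 4.
  apply: le_trans (ler_normD _ _) _; apply: le_trans h4.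
  rewrite addrC (@sint_split _ _ (y - e) y (y + e)) //; apply: lerD; last exact: bnd.
  by rewrite -sint_sub //; exact: bnd.
have S1 : sint (x - e) (y + e) (fun t => v t * plateau e x y t) =
    sint (x - e) x (fun t => v t * plateau e x y t) + sint x (x + e) (fun t => v t * plateau e x y t)
    + sint (x + e) (y - e) v
    + sint (y - e) y (fun t => v t * plateau e x y t) + sint y (y + e) (fun t => v t * plateau e x y t).
  rewrite (@sint_split _ _ _ x) //.
  rewrite (@sint_split _ _ x (x + e)) //.
  rewrite (@sint_split _ _ (x + e) (y - e)) //.
  rewrite (@sint_split _ _ (y - e) y) //.
  by rewrite mid !addrA.
have S2 : sint x y v = sint x (x + e) v + sint (x + e) (y - e) v + sint (y - e) y v.
  rewrite (@sint_split _ _ x (x + e)) //.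
  by rewrite (@sint_split _ _ (x + e) (y - e)) ?addrA.
have P : prim v y - prim v x = sint x y v by rewrite prim_sub.
rewrite P S2; rewrite S1 in W.
move: h1 h2 g1 g2; rewrite !ler_norml => /andP[a1 a2] /andP[b1 b2] /andP[c1 c2] /andP[k1 k2].
by clear -W a1 a2 b1 b2 c1 c2 k1 k2; lra.
Qed.

(** The constant is read off at one Lebesgue point [x0], and [weak_increment] connects it with
    almost every other point. *)
Lemma weak_rep u v : weak_derivative u v -> exists c, \forall x \ae mu, u x = c + prim v x.
Proof.
move=> wk; have [lu _ _] := wk; have L := leb_pt_ae lu.
have [x0 _ p0] := ae_dense 0 (@ltr01 R) L.
exists (u x0 - prim v x0); apply: ae_imp L => x px.
have [xx|xx|->] := ltgtP x x0.
- by have := weak_increment wk px p0 xx; lra.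
- by have := weak_increment wk p0 px xx; lra.
- by rewrite subrK.
Qed.

Lemma int_ae_eq f g (h : R -> R) : measurable_fun [set: R] f -> measurable_fun [set: R] g ->
  measurable_fun [set: R] h ->
  (\forall x \ae mu, f x = g x) -> \int[mu]_t (f t * h t) = \int[mu]_t (g t * h t).
Proof.
move=> mf mg mh fg; rewrite /Rintegral; congr fine; apply: ae_eq_integral => //.
- by apply/measurable_realfun.measurable_EFinP; exact: measurable_realfun.measurable_funM.
- by apply/measurable_realfun.measurable_EFinP; exact: measurable_realfun.measurable_funM.
- by apply: ae_imp fg => x -> _.
Qed.

Lemma test_cont f : test_function f -> continuous f /\ continuous (derive1 f).
Proof.
move=> [sf _]; have [f1 d1 /smooth_dv[f2 d2 _]] := smooth_dv sf.
split; first exact: dv_cont d1.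
have -> : derive1 f = f1 by apply/funext; exact: dv_val.
exact: dv_cont d2.
Qed.

Lemma weak_ae u u' v v' : measurable_fun [set: R] u' -> measurable_fun [set: R] v' ->
  (\forall x \ae mu, u x = u' x) -> (\forall x \ae mu, v x = v' x) ->
  weak_derivative u v -> weak_derivative u' v'.
Proof.
move=> mu' mv' eu ev [lu lv wk].
have K f g : measurable_fun [set: R] g -> (\forall x \ae mu, f x = g x) ->
    locally_integrable [set: R] f -> locally_integrable [set: R] g.
  move=> mg fg lf; have [mf _ hf] := lf; split => //; first exact: openT.
  move=> K _ cK; have := hf K (fun _ _ => I) cK.
  congr (_ < _)%E; apply: ae_eq_integral => //.
  - exact: measurable_realfun.compact_measurable.
  - apply/measurable_realfun.measurable_EFinP; apply: measurableT_comp => //.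
    exact: measurable_funS mf.
  - apply/measurable_realfun.measurable_EFinP; apply: measurableT_comp => //.
    exact: measurable_funS mg.
  - by apply: ae_imp fg => x -> _.
split; [exact: K eu lu|exact: K ev lv|] => p tp.
have [cp cp'] := test_cont tp; have [mu_ _ _] := lu; have [mv_ _ _] := lv.
rewrite -(int_ae_eq mu_ mu' (cont_meas cp') eu) -(int_ae_eq mv_ mv' (cont_meas cp) ev).
exact: wk.
Qed.

(** At a Lebesgue point of [v - v'] its value is the limit of its mollifications, and these vanish
    because [v] and [v'] have the same pairing with every test function. *)
Lemma weak_unique u v v' : weak_derivative u v -> weak_derivative u v' ->
  \forall x \ae mu, v x = v' x.
Proof.
move=> [lu lv wk] [_ lv' wk'].
have lw : locally_integrable [set: R] (fun x => v x - v' x) by exact: locally_integrableB.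
have iw := locint_iloc lw; have iv := locint_iloc lv; have iv' := locint_iloc lv'.
apply: ae_imp (leb_pt_ae lw) => x px.
apply/eqP; rewrite -subr_eq0; apply/eqP; apply: small0 => d d0.
have [e0 e00 h] := moll_lim iw px d0.
have e20 : 0 < e0 / 2 by rewrite divr_gt0.
have := h (e0 / 2) e20; rewrite ltr_pdivrMr // ltr_pMr // ltr1n => /(_ isT).
rewrite [X in `|X - _|](_ : _ = 0) ?sub0r ?normrN //.
set e := e0 / 2 in e20 *.
have S f : sint (x - e) (x + e) (fun t => f t * moll e x t) = \int[mu]_t (f t * moll e x t).
  by apply/esym; apply: sint_supp => t ht; rewrite moll_out ?mulr0.
have cm := moll_cont (e := e) (x := x).
rewrite (@sint_eq _ _ _ _ (fun t => v t * moll e x t - v' t * moll e x t)); last first.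
  by move=> t _; rewrite mulrBl.
rewrite sint_sub; [|exact: iloc_mul|exact: iloc_mul]; rewrite !S.
have A := wk _ (moll_test x e20); have := wk' _ (moll_test x e20).
by rewrite A => /oppr_inj ->; rewrite subrr.
Qed.

Lemma test_supp p : test_function p -> dv p (derive1 p) /\
  exists2 N : R, 0 <= N & forall t, ~~ (- N <= t <= N) -> p t = 0 /\ derive1 p t = 0.
Proof.
move=> [sp kp].
have dp : dv p (derive1 p).
  by move=> x; rewrite derive1E; apply/derivableP; exact: sp 0%N x.
split=> //; have [M [Mr hM]] := compact_bounded kp.
(* The margin makes [p] vanish off the open interval, so a point outside the closed one has a
   neighbourhood on which [p] is zero, and the derivative vanishes there too. *)
pose N : R := `|M| + 1.
have out t : ~~ (- N < t < N) -> p t = 0.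
  move=> h; apply: contrapT => /eqP pt; move/negP: h; apply.
  have MN' : M < `|M| + 2^-1 by rewrite (le_lt_trans (ler_norm M)) // ltrDl invr_gt0.
  have cl : closure [set x | p x != 0] t by exact: subset_closure.
  have : `|t| <= `|M| + 2^-1 by exact: hM _ MN' t cl.
  rewrite ler_norml /N => /andP[A B].
  have h2 : 2^-1 < 1 :> R by rewrite invf_lt1 // ltr1n.
  by apply/andP; split; lra.
exists N; first by rewrite addr_ge0.
move=> t h; split; first by apply: out; apply: contra h => /andP[/ltW -> /ltW ->].
rewrite derive1E; have H : is_derive t 1 p 0.
  apply: (@near_eq_is_derive _ _ _ (fun=> 0)).
  move: h; rewrite negb_and -!ltNge => /orP[] h; near=> z.
    have zN : z < - N by near: z; exact: lt_nbhsl.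
    by rewrite out //; apply/negP => /andP[]; lra.
  have zN : N < z by near: z; exact: lt_nbhsr.
  by rewrite out //; apply/negP => /andP[]; lra.
by rewrite derive_val.
Unshelve. all: by end_near. Qed.

Lemma weak_classical u u1 : dv u u1 -> continuous u1 -> weak_derivative u u1.
Proof.
move=> du c1; have cu := dv_cont du.
split; [by apply/locint_iff; split; [exact: cont_meas|exact: cont_iloc] ..|].
move=> p tp; have [cp cp'] := test_cont tp; have [dp [N N0 out]] := test_supp tp.
(* Enlarging [N] puts both endpoints outside the support interval, so the boundary terms of the
   integration by parts vanish. *)
have N1 : 0 < N + 1 by rewrite ltr_wpDl.
have outN t : ~~ (- (N + 1) <= t <= N + 1) -> p t = 0 /\ derive1 p t = 0.
  move=> h; apply: out; apply: contra h => /andP[h1 h2].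
  by rewrite opprD (le_trans _ h1) ?gerDl ?lerN10 //= (le_trans h2) // lerDl.
have iN : - (N + 1) <= N + 1 by rewrite ge0_cp // ltW.
rewrite (@sint_supp _ (- (N + 1)) (N + 1)); last by move=> t /outN[_ ->]; rewrite mulr0.
rewrite (@sint_supp _ (- (N + 1)) (N + 1)); last by move=> t /outN[-> _]; rewrite mulr0.
have := sint_ftc (cont_add (cont_mul c1 cp) (cont_mul cu cp')) (dv_mul du dp) iN.
have [-> _] : p (N + 1) = 0 /\ derive1 p (N + 1) = 0.
  by apply: out; rewrite negb_and -!ltNge; apply/orP; right; rewrite ltrDl.
have [-> _] : p (- (N + 1)) = 0 /\ derive1 p (- (N + 1)) = 0.
  by apply: out; rewrite negb_and -!ltNge; apply/orP; left; rewrite ltrN2 ltrDl.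
rewrite !mulr0 subrr sint_add; [|by apply: cont_iloc; exact: cont_mul ..].
by move=> /eqP; rewrite addrC addr_eq0 => /eqP.
Qed.

Lemma weak_sub u v u' v' : weak_derivative u v -> weak_derivative u' v' ->
  weak_derivative (fun x => u x - u' x) (fun x => v x - v' x).
Proof.
move=> [lu lv wk] [lu' lv' wk'].
split; [exact: locally_integrableB|exact: locally_integrableB|].
move=> p tp; have [cp cp'] := test_cont tp; have [dp [N N0 out]] := test_supp tp.
have Hd f : \int[mu]_t (f t * derive1 p t) = sint (- N) N (fun t => f t * derive1 p t).
  by apply: sint_supp => t /out[_ ->]; rewrite mulr0.
have Hp f : \int[mu]_t (f t * p t) = sint (- N) N (fun t => f t * p t).
  by apply: sint_supp => t /out[-> _]; rewrite mulr0.
have iu := iloc_mul (locint_iloc lu) cp'; have iu' := iloc_mul (locint_iloc lu') cp'.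
have iv := iloc_mul (locint_iloc lv) cp; have iv' := iloc_mul (locint_iloc lv') cp.
rewrite Hd Hp (sint_eq (g := fun t => u t * derive1 p t - u' t * derive1 p t)); last first.
  by move=> t _; rewrite mulrBl.
rewrite [in RHS](sint_eq (g := fun t => v t * p t - v' t * p t)); last first.
  by move=> t _; rewrite mulrBl.
by rewrite !sint_sub // -!Hd -!Hp wk // wk' // opprB opprK addrC.
Qed.
End WeakDerivative.

(** * Integrals of even functions, square integrability and the Sobolev bound *)

Section SquareIntegrable.
Variable R : realType.
Notation mu := (@lebesgue_measure R).
Implicit Types (u v w f g : R -> R) (a b x y t M : R).

Lemma ae_neg (P : R -> Prop) : (\forall x \ae mu, P x) -> \forall x \ae mu, P (- x).
Proof.
move=> [N [mN N0 sub]]; exists ((fun x : R => - x) @^-1` N); split.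
- have mo : measurable_fun [set: R] (fun x : R => - x).
    by apply: cont_meas; exact: dv_cont (dv_opp (@dv_id R)).
  by rewrite -[X in measurable X]setTI; exact: mo.
- by rewrite -N0 -(lebesgue_measureN mN).
- by move=> x /= h; exact: sub.
Qed.

Lemma cont_ae_eq f g : continuous f -> continuous g -> (\forall x \ae mu, f x = g x) -> f =1 g.
Proof.
move=> cf cg fg x; apply/eqP; rewrite -subr_eq0; apply/eqP; apply: small0 => d d0.
have /cvgrPdist_lt/(_ d d0) := cont_sub cf cg (x := x).
move=> [e /= e0 he]; have [y /andP[xy yx] E] := ae_dense x e0 fg.
have := he y; rewrite /ball /= E subrr subr0 => H; apply: ltW; apply: H.
by rewrite ltr_norml; apply/andP; split; lra.
Qed.

Lemma even_integral_ge0 b M f : 0 < b -> continuous f -> bd b M f -> (forall x, 0 <= f x) ->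
  (forall x, f (- x) = f x) -> (\int[mu]_x (f x)%:E = (2 * pinf f)%:E)%E.
Proof.
move=> b0 cf hf f0 fe; rewrite ge0_symfun_integralT //; last by move=> x /=; rewrite fe.
rewrite -set_itvcy (@ge0_continuous_FTC2y _ f (prim f) 0 (pinf f)) //.
- by rewrite prim0 sube0.
- by apply: continuous_subspaceT => x; exact: cf.
- exact: pinf_cvg hf.
- by move=> x _; exact: dv_derivable (dv_prim cf) x.
- by apply: cvg_at_right_filter; exact: (dv_cont (dv_prim cf)).
- by move=> x _; exact: dv_val (dv_prim cf) x.
Qed.

Lemma bd_expabs b M : 0 <= M -> bd b M (fun x => M * expabs b x).
Proof. by move=> M0 x; rewrite normrM (ger0_norm M0) ger0_norm ?expR_ge0. Qed.

Lemma bd_integrable b M f : 0 < b -> measurable_fun [set: R] f -> bd b M f ->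
  mu.-integrable [set: R] (EFin \o f).
Proof.
move=> b0 mf hf; have M0 := bd_ge0 hf.
have ch : continuous (fun x => M * expabs b x) := @cont_scale R M _ (@cont_expabs R b).
apply: (@le_integrable _ _ _ mu _ _ _ (fun x => (M * expabs b x)%:E)) => //.
- exact/measurable_realfun.measurable_EFinP.
- move=> x _; rewrite lee_fin [leRHS]ger0_norm ?mulr_ge0 ?expR_ge0 //; exact: hf.
apply/integrableP; split.
  by apply/measurable_realfun.measurable_EFinP; exact: cont_meas.
under eq_integral do rewrite gee0_abs ?lee_fin ?mulr_ge0 ?expR_ge0 //.
rewrite (even_integral_ge0 b0 ch (bd_expabs b M0)) ?ltry //.
- by move=> x; rewrite mulr_ge0 ?expR_ge0.
- by move=> x; rewrite /expabs normrN.
Qed.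

(** The signed case follows from the nonnegative one by the splitting [f = (f + h) - h] of
    [pinf_cvg]. *)
Lemma even_integral b M f : 0 < b -> continuous f -> bd b M f -> (forall x, f (- x) = f x) ->
  \int[mu]_x f x = 2 * pinf f.
Proof.
move=> b0 cf hf fe; have M0 := bd_ge0 hf; pose h x := M * expabs b x.
have ch : continuous h := @cont_scale R M _ (@cont_expabs R b).
have hh : bd b M h := bd_expabs b M0.
have he x : h (- x) = h x by rewrite /h /expabs normrN.
have h0 x : 0 <= h x by rewrite mulr_ge0 ?expR_ge0.
have cs := cont_add cf ch; have hs := bd_add hf hh.
have s0 x : 0 <= f x + h x.
  by rewrite -lerBlDr sub0r lerNl; apply: le_trans (hf x); rewrite -normrN; exact: ler_norm.
have E1 : \int[mu]_x (f x + h x) = 2 * pinf (fun x => f x + h x).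
  rewrite /Rintegral (even_integral_ge0 b0 cs hs s0) //.
  by move=> x; rewrite fe he.
have E2 : \int[mu]_x h x = 2 * pinf h by rewrite /Rintegral (even_integral_ge0 b0 ch hh h0).
have If := bd_integrable b0 (cont_meas cf) hf; have Ih := bd_integrable b0 (cont_meas ch) hh.
have E3 : \int[mu]_x f x + 2 * pinf h = 2 * (pinf f + pinf h).
  by rewrite -E2 -(pinf_add b0 cf ch hf hh) -E1 RintegralD.
by rewrite -[LHS](addrK (2 * pinf h)) E3 mulrDr addrK.
Qed.

Lemma inL2P f : inL2 f <-> measurable_fun [set: R] f /\
  mu.-integrable [set: R] (EFin \o (fun x => f x ^+ 2)).
Proof.
split=> [h|[mf If]].
  split; last exact: Lfun2_integrable_sqr.
  by move: h; rewrite /inL2 inE => /andP[]; rewrite inE.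
rewrite /inL2 inE; apply/andP; split; rewrite inE //=.
rewrite /finite_norm unlock; apply: poweR_lty.
move/integrableP : If => [_]; congr (_ < _)%E; apply: eq_integral => x _.
by rewrite /= normrX -powR_mulrn.
Qed.

Lemma inL2_ae f g : measurable_fun [set: R] g -> (\forall x \ae mu, f x = g x) ->
  inL2 f -> inL2 g.
Proof.
move=> mg fg /inL2P[mf If]; apply/inL2P; split => //.
have m2 (h : R -> R) : measurable_fun [set: R] h -> measurable_fun [set: R] (fun x => h x ^+ 2).
  by move=> mh; exact: measurable_realfun.measurable_funX.
apply/integrableP; split; first by apply/measurable_realfun.measurable_EFinP; exact: m2.
have E (h : R -> R) : (\int[mu]_x `|(EFin \o (fun x => h x ^+ 2)%R) x| = \int[mu]_x (h x ^+ 2)%:E)%E.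
  by apply: eq_integral => x _; rewrite /= ger0_norm ?sqr_ge0.
move/integrableP : If => [_]; rewrite !E; congr (_ < _)%E; apply: ae_eq_integral => //.
- by apply/measurable_realfun.measurable_EFinP; exact: m2.
- by apply/measurable_realfun.measurable_EFinP; exact: m2.
- by apply: ae_imp fg => x -> _.
Qed.

Lemma bd_inL2 b M f : 0 < b -> measurable_fun [set: R] f -> bd b M f -> inL2 f.
Proof.
move=> b0 mf hf; apply/inL2P; split => //.
have h2 := bd_mul hf hf.
apply: (bd_integrable (b := b + b) (M := M * M)).
- exact: addr_gt0.
- exact: measurable_realfun.measurable_funX.
- by move=> x; rewrite expr2; exact: h2.
Qed.

Lemma ip_sqr_ge0 f : 0 <= ip f f.
Proof. by apply: Rintegral_ge0 => x _; rewrite -expr2 sqr_ge0. Qed.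

(** [M^2 / b] is the integral of [M^2 exp (- 2 b |x|)] over the line. *)
Lemma ip_bd b M f : 0 < b -> measurable_fun [set: R] f -> bd b M f -> ip f f <= M ^+ 2 / b.
Proof.
move=> b0 mf hf; have M0 := bd_ge0 hf; have bb : 0 < b + b by rewrite addr_gt0.
pose h x := (M * M) * expabs (b + b) x.
have ch : continuous h := @cont_scale R (M * M) _ (@cont_expabs R (b + b)).
have hh : bd (b + b) (M * M) h by apply: bd_expabs; rewrite mulr_ge0.
have h2 := bd_mul hf hf.
have m2 : measurable_fun [set: R] (fun x => f x * f x) by exact: measurable_realfun.measurable_funM.
apply: le_trans (_ : \int[mu]_x h x <= _).
  apply: le_Rintegral => //; [exact: bd_integrable h2| exact: bd_integrable (cont_meas ch) hh|].
  by move=> x _; apply: le_trans (ler_norm _) (h2 x).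
rewrite (even_integral bb ch hh); last by move=> x; rewrite /h /expabs normrN.
have := pinf_bound bb ch hh => /(le_trans (ler_norm _)) H.
apply: le_trans (ler_wpM2l _ H) _ => //.
rewrite le_eqVlt; apply/orP; left; apply/eqP; field.
by rewrite !lt0r_neq0.
Qed.

Lemma ip_ae f f' g g' : measurable_fun [set: R] f -> measurable_fun [set: R] f' ->
  measurable_fun [set: R] g -> measurable_fun [set: R] g' ->
  (\forall x \ae mu, f x = f' x) -> (\forall x \ae mu, g x = g' x) -> ip f g = ip f' g'.
Proof.
move=> mf mf' mg mg' ff gg.
have C (p q : R -> R) : \int[mu]_x (p x * q x) = \int[mu]_x (q x * p x).
  by apply: eq_Rintegral => x _; rewrite mulrC.
by rewrite /ip (int_ae_eq mf mf' mg ff) C (int_ae_eq mg mg' mf' gg) C.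
Qed.

Lemma sint_ip f a b : continuous f -> inL2 f -> sint a b (fun x => f x ^+ 2) <= ip f f.
Proof.
move=> cf /inL2P[mf If].
rewrite /sint /ip Rintegral_mkcond.
have I2 : mu.-integrable `[a, b] (EFin \o (fun x => f x ^+ 2)) by exact: integrableS If.
have E : (fun x => f x * f x) = (fun x => f x ^+ 2) by apply/funext => x; rewrite expr2.
rewrite E; apply: le_Rintegral => //.
  by rewrite -restrict_EFin -integrable_mkcond.
by move=> x _; rewrite patchE; case: ifP => // _; exact: sqr_ge0.
Qed.

(** Some [y] in [[x, x + 1]] has [u(y)^2] equal to the mean of [u^2] there, and from [y] to [x] the
    square changes by at most the integral of [2 |u u'| <= u^2 + u'^2]. *)
Lemma sobolev_sup u u1 : dv u u1 -> continuous u1 -> inL2 u -> inL2 u1 ->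
  forall x, u x ^+ 2 <= 2 * (ip u u + ip u1 u1).
Proof.
move=> du c1 Lu Lu1 x; have cu := dv_cont du.
have c2 f : continuous f -> continuous (fun x => f x ^+ 2).
  move=> cf; have -> : (fun x => f x ^+ 2) = (fun x => f x * f x); last exact: cont_mul.
  by apply/funext => z; rewrite expr2.
have xx : x < x + 1 by rewrite ltrDl.
have [y /andP[xy yx]] := dv_mvt (dv_prim (c2 _ cu)) xx.
rewrite addrAC subrr add0r mulr1 (prim_sub (cont_iloc (c2 _ cu)) (ltW xx)) => E.
have H1 := sint_ip x (x + 1) cu Lu; rewrite /sint E in H1.
have dP := dv_add (dv_prim (c2 _ cu)) (dv_prim (c2 _ c1)).
have {}dP : `|u y ^+ 2 - u x ^+ 2| <= sint x y (fun z => u z ^+ 2) + sint x y (fun z => u1 z ^+ 2).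
  rewrite /sint -(prim_sub (cont_iloc (c2 _ cu)) (ltW xy)) -(prim_sub (cont_iloc (c2 _ c1)) (ltW xy)).
  rewrite addrACA -opprD; apply: (dv_abs (dv_sqr du) dP (ltW xy)) => z _ _.
  have := sqr_ge0 (u z - u1 z); have := sqr_ge0 (u z + u1 z).
  by rewrite ler_norml !expr2 => h1 h2; apply/andP; split; lra.
have H2 := sint_ip x y cu Lu; have H3 := sint_ip x y c1 Lu1.
move: dP; rewrite ler_norml => /andP[A B]; clear -A B H1 H2 H3.
by have := ip_sqr_ge0 u1; lra.
Qed.
End SquareIntegrable.

(** * The space H^2 and C^1 representatives *)

Section H2.
Variable R : realType.
Notation mu := (@lebesgue_measure R).
Implicit Types (u v w f g y : R -> R) (b M x : R).

Lemma locint_meas f : locally_integrable [set: R] f -> measurable_fun [set: R] f.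
Proof. by case. Qed.

Lemma weak_meas u v : weak_derivative u v -> measurable_fun [set: R] u /\ measurable_fun [set: R] v.
Proof. by case=> /locint_meas ? /locint_meas ?. Qed.

Lemma wD_spec u v : weak_derivative u v ->
  weak_derivative u (wD u) /\ \forall x \ae mu, v x = wD u x.
Proof.
move=> wk; have H : weak_derivative u (wD u).
  by apply: (@xgetPex _ _ [set v | weak_derivative u v]); exists v.
by split => //; exact: weak_unique wk H.
Qed.

Lemma wD_spec2 u v w : weak_derivative u v -> weak_derivative v w ->
  [/\ weak_derivative u (wD u), weak_derivative (wD u) (wD (wD u)),
      \forall x \ae mu, v x = wD u x & \forall x \ae mu, w x = wD (wD u) x].
Proof.
move=> wk wk2; have [H E] := wD_spec wk.
have [mv mw] := weak_meas wk2; have [_ mD] := weak_meas H.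
have ww : \forall x \ae mu, w x = w x by apply: ae_imp E.
have K : weak_derivative (wD u) w := weak_ae mD mw E ww wk2.
by have [H2_ E2] := wD_spec K; split.
Qed.

Lemma H2_wD u : H2 u -> [/\ weak_derivative u (wD u), weak_derivative (wD u) (wD (wD u)),
  inL2 (wD u) & inL2 (wD (wD u))].
Proof.
move=> [Lu [v [w [wk Lv wk2 Lw]]]]; have [A B C D] := wD_spec2 wk wk2.
have [_ m1] := weak_meas A; have [_ m2] := weak_meas B.
by split=> //; [exact: inL2_ae C Lv|exact: inL2_ae D Lw].
Qed.

Lemma H2normE u f f1 f2 : H2 u -> continuous f -> continuous f1 -> continuous f2 ->
  (\forall x \ae mu, u x = f x) -> (\forall x \ae mu, wD u x = f1 x) ->
  (\forall x \ae mu, wD (wD u) x = f2 x) ->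
  H2norm u ^+ 2 = ip f f + ip f1 f1 + ip f2 f2.
Proof.
move=> hu c0 c1 c2 e0 e1 e2; have [A B _ _] := H2_wD hu.
have [m0 m1] := weak_meas A; have [_ m2] := weak_meas B.
rewrite /H2norm sqr_sqrtr; last by rewrite !addr_ge0 // ip_sqr_ge0.
have n0 := cont_meas c0; have n1 := cont_meas c1; have n2 := cont_meas c2.
by rewrite (ip_ae m0 n0 m0 n0 e0 e0) (ip_ae m1 n1 m1 n1 e1 e1) (ip_ae m2 n2 m2 n2 e2 e2).
Qed.

(** By [ip_bd] each of the three squared norms is at most [M^2 / b]. *)
Lemma H2_classical b M u u1 u2 : 0 < b -> dv u u1 -> dv u1 u2 -> continuous u2 ->
  bd b M u -> bd b M u1 -> bd b M u2 ->
  [/\ H2 u, \forall x \ae mu, wD u x = u1 x, \forall x \ae mu, wD (wD u) x = u2 x &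
      H2norm u <= M * Num.sqrt (3 / b)].
Proof.
move=> b0 d0 d1 c2 h0 h1 h2; have c0 := dv_cont d0; have c1 := dv_cont d1.
have w0 := weak_classical d0 c1; have w1 := weak_classical d1 c2.
have [A B C D] := wD_spec2 w0 w1.
have m0 := cont_meas c0; have m1 := cont_meas c1; have m2 := cont_meas c2.
have hu : H2 u.
  split; first exact: bd_inL2 h0.
  by exists u1, u2; split=> //; [exact: bd_inL2 h1|exact: bd_inL2 h2].
have E1 : \forall x \ae mu, wD u x = u1 x by apply: ae_imp C.
have E2 : \forall x \ae mu, wD (wD u) x = u2 x by apply: ae_imp D.
have E0 : \forall x \ae mu, u x = u x by apply: ae_imp E1.
split => //; have M0 := bd_ge0 h0.
rewrite -(@ler_pXn2r _ 2) ?nnegrE ?sqrtr_ge0 ?mulr_ge0 ?sqrtr_ge0 //.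
rewrite (H2normE hu c0 c1 c2 E0 E1 E2) exprMn sqr_sqrtr ?divr_ge0 ?(ltW b0) //.
have := ip_bd b0 m0 h0; have := ip_bd b0 m1 h1; have := ip_bd b0 m2 h2.
rewrite mulrCA; lra.
Qed.

Lemma prim_ae f g x : iloc f -> iloc g -> measurable_fun [set: R] f -> measurable_fun [set: R] g ->
  (\forall x \ae mu, f x = g x) -> prim f x = prim g x.
Proof.
move=> hf hg mf mg fg.
have K a b : \int[mu]_(t in `[a, b]) f t = \int[mu]_(t in `[a, b]) g t.
  rewrite /Rintegral; congr fine; apply: ae_eq_integral => //.
  - by apply/measurable_realfun.measurable_EFinP; exact: measurable_funS mf.
  - by apply/measurable_realfun.measurable_EFinP; exact: measurable_funS mg.
  - by apply: ae_imp fg => t -> _.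
by rewrite /prim !K.
Qed.

(** The last clause records [y1] as a primitive of the second weak derivative: once an equation
    identifies that derivative with a continuous function, [y1] is differentiable in the classical
    sense. *)
Definition C1rep u y y1 := [/\ dv y y1, continuous y1, \forall x \ae mu, u x = y x,
  \forall x \ae mu, wD u x = y1 x & exists c, forall x, y1 x = c + prim (wD (wD u)) x].

Lemma H2_rep u : H2 u -> exists y y1, C1rep u y y1.
Proof.
move=> hu; have [A B _ _] := H2_wD hu.
have [m0 m1] := weak_meas A; have [_ m2] := weak_meas B.
have [c1 e1] := weak_rep B; have [c0 e0] := weak_rep A.
have i1 : iloc (wD u) by apply: locint_iloc; case: A.
have i2 : iloc (wD (wD u)) by apply: locint_iloc; case: B.
pose y1 x := c1 + prim (wD (wD u)) x.
have cy1 : continuous y1 by apply: cont_add; [exact: cont_cst|exact: prim_cont].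
pose y x := c0 + prim y1 x.
exists y, y1; apply: And5; [|exact: cy1| |exact: e1|by exists c1].
  by apply: dv_eq (dv_add (dv_cst c0) (dv_prim cy1)) _ => x; rewrite add0r.
apply: ae_imp e0 => x ->; rewrite /y; congr (_ + _).
apply: prim_ae; [exact: i1|exact: cont_iloc|exact: m1|exact: cont_meas|exact: e1].
Qed.

Lemma C1rep_dv u y y1 f : H2 u -> C1rep u y y1 -> continuous f ->
  (\forall x \ae mu, wD (wD u) x = f x) -> dv y1 f.
Proof.
move=> hu [_ _ _ _ [c e]] cf ef; have [_ B _ _] := H2_wD hu; have [_ m2] := weak_meas B.
have i2 : iloc (wD (wD u)) by apply: locint_iloc; case: B.
apply: (dv_ext (f := fun x => c + prim f x)).
  by apply: dv_eq (dv_add (dv_cst c) (dv_prim cf)) _ => x; rewrite add0r.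
move=> x; rewrite e; congr (_ + _); apply/esym.
apply: prim_ae; [exact: i2|exact: cont_iloc|exact: m2|exact: cont_meas|exact: ef].
Qed.

(** The passage from the [H2] norm to sup bounds: [sobolev_sup] is applied to [y] and to [y1], whose
    derivative is [f]. *)
Lemma C1rep_bound u y y1 f : H2 u -> C1rep u y y1 -> continuous f ->
  (\forall x \ae mu, wD (wD u) x = f x) ->
  bd 0 (Num.sqrt 2 * H2norm u) y /\ bd 0 (Num.sqrt 2 * H2norm u) y1.
Proof.
move=> hu rp cf ef; have d1 := C1rep_dv hu rp cf ef.
have [d0 c1 e0 e1 _] := rp; have c0 := dv_cont d0.
have [A B L1_ L2_] := H2_wD hu; have L0 := proj1 hu.
have m0 := cont_meas c0; have m1 := cont_meas c1; have m2 := cont_meas cf.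
have Ly := inL2_ae m0 e0 L0; have Ly1 := inL2_ae m1 e1 L1_; have Lf := inL2_ae m2 ef L2_.
have E := H2normE hu c0 c1 cf e0 e1 ef.
have N0 : 0 <= H2norm u by exact: sqrtr_ge0.
have p0 := ip_sqr_ge0 y; have p1 := ip_sqr_ge0 y1; have p2 := ip_sqr_ge0 f.
have K t : t ^+ 2 <= 2 * H2norm u ^+ 2 -> `|t| <= Num.sqrt 2 * H2norm u.
  move=> h; rewrite -(@ler_pXn2r _ 2) ?nnegrE ?mulr_ge0 ?sqrtr_ge0 //.
  by rewrite exprMn sqr_sqrtr // real_normK // num_real.
split; apply/bd0P => x; apply: K; rewrite E.
  by apply: le_trans (sobolev_sup d0 c1 Ly Ly1 x) _; rewrite ler_wpM2l // lerDl.
apply: le_trans (sobolev_sup d1 cf Ly1 Lf x) _; rewrite ler_wpM2l //.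
by rewrite -addrA lerDr.
Qed.

Lemma C1rep_even u y y1 : C1rep u y y1 -> (fun x => u (- x)) = u %[ae mu] ->
  forall x, y (- x) = y x.
Proof.
move=> [d0 _ e0 _ _] /aeE ev; apply: cont_ae_eq.
- exact: dv_cont (dv_neg d0).
- exact: dv_cont d0.
by apply: ae_imp (ae_and ev (ae_and e0 (ae_neg e0))) => x [+ [<- <-]].
Qed.

Lemma C1rep_odd u y y1 : C1rep u y y1 -> (fun x => u (- x)) = (fun x => - u x) %[ae mu] ->
  forall x, y (- x) = - y x.
Proof.
move=> [d0 _ e0 _ _] /aeE ev; apply: cont_ae_eq.
- exact: dv_cont (dv_neg d0).
- exact: dv_cont (dv_opp d0).
by apply: ae_imp (ae_and ev (ae_and e0 (ae_neg e0))) => x [+ [<- <-]].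
Qed.
End H2.

(** * The bifurcating branch *)

Section Branch.
Variables (R : realType) (S1 S2 : fundsys R) (k : R).
Hypotheses (k0 : 0 < k) (gp : forall x, 0 < x -> 0 < phi S2 x).
Let D := Jf S2 (fun x => Y1f S1 (base S2) x * phi S2 x).
Hypothesis D0 : D != 0.
Implicit Types (V A : R -> R) (mu x : R).

Definition Vrhs V A x : R := pot S1 x * V x - (2^-1 * V x ^+ 2 + A x ^+ 2).
Definition Arhs mu V A x : R := pot S2 x * A x - (mu + k * V x) * A x.

Definition is_sol mu V V1 A A1 := [/\ dv V V1 /\ dv A A1, dv V1 (Vrhs V A),
  dv A1 (Arhs mu V A), forall x, V (- x) = V x & forall x, A (- x) = - A x].

(** [Vrhs] and [Arhs] are the second derivatives, so these are the bounds that [H2_classical]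
    converts into norms. [V] inherits the factor [mu], and [A] the amplitude [a], of order
    [sqrt |mu|]. *)
Lemma branch_exists (P1 P2 : R) : bd 0 P1 (pot S1) -> bd 0 P2 (pot S2) ->
  exists e C b : R, [/\ 0 < e, 0 < C, 0 < b & forall mu, `|mu| <= e -> mu * D < 0 ->
    exists V V1 A A1, [/\ is_sol mu V V1 A A1, exists x, A x != 0,
      [/\ bd b (C * `|mu|) V, bd b (C * `|mu|) V1 & bd b (C * `|mu|) (Vrhs V A)] &
      [/\ bd b (C * Num.sqrt `|mu|) A, bd b (C * Num.sqrt `|mu|) A1 &
          bd b (C * Num.sqrt `|mu|) (Arhs mu V A)]]].
Proof.
move=> hp1 hp2; have r1 := rate_gt0 S1; have r2 := rate_gt0 S2.
(* Positive, to obtain decay, and strictly below both rates, as the Green operators require. *)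
pose b := Num.min (rate S1) (rate S2) / 2.
have m0 : 0 < Num.min (rate S1) (rate S2) by rewrite lt_min r1.
have bpos : 0 < b by rewrite divr_gt0.
have bm : b < Num.min (rate S1) (rate S2) by rewrite /b; lra.
have b0 : 0 <= b := ltW bpos.
have [b1 b2] : b < rate S1 /\ b < rate S2 by move: bm; rewrite lt_min => /andP[].
have [d /andP[d0 d1] sm] := small_class k0 b0 b1 b2 gp D0.
have [e e0 ex] := fixpt_exists k0 b0 b1 b2 D0 d0 d1 sm.
have [Cb Cb0 hb] := good_beta k0 b0 b1 D0 d0 sm.
have [C3 C30 h3] := good_A2 k0 b0 b1 D0 d0 sm.
have [C4 C40 h4] := good_V2 k0 b0 b1 D0 d0 sm.
have f0 := fsC_ge0 S2; set f := fsC S2 in f0 *.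
have G10 := greenC_ge0 b1; set G1 := greenC S1 b in G10 *.
have G20 := greenC_ge0 b2; set G2 := greenC S2 b in G20 *.
have P10 := bd_ge0 hp1; have P20 := bd_ge0 hp2.
pose KB := (f + 1) * (f + 1).
have KB0 : 0 <= KB by rewrite mulr_ge0 // addr_ge0.
pose CV := Cb * (G1 * KB) + G1 * C4.
have GK0 : 0 <= G1 * KB := mulr_ge0 G10 KB0.
have GC0 : 0 <= G1 * C4 := mulr_ge0 G10 C40.
have GA0 : 0 <= G2 * C3 := mulr_ge0 G20 C30.
have CV0 : 0 <= CV by apply: addr_ge0 => //; exact: mulr_ge0.
pose CA := f + G2 * C3.
have CA0 : 0 <= CA by apply: addr_ge0 => //; exact: mulr_ge0.
pose sb := Num.sqrt Cb; have sb0 : 0 <= sb := sqrtr_ge0 _.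
pose C := 1 + (CV + (CV * P1 + (Cb * KB + C4))) + (sb * CA + sb * (CA * P2 + C3)).
have t1 : 0 <= CV * P1 + (Cb * KB + C4).
  by apply: addr_ge0; [exact: mulr_ge0|apply: addr_ge0 => //; exact: mulr_ge0].
have t2 : 0 <= sb * CA by rewrite mulr_ge0.
have t3 : 0 <= sb * (CA * P2 + C3) by apply: mulr_ge0 => //; apply: addr_ge0 => //; exact: mulr_ge0.
have aux (p1 p2 p3 p4 : R) : 0 <= p1 -> 0 <= p2 -> 0 <= p3 -> 0 <= p4 ->
    let s := 1 + (p1 + p2) + (p3 + p4) in [/\ p1 <= s, p2 <= s, p3 <= s, p4 <= s & 0 < s].
  by move=> h1 h2 h3' h4' s; rewrite /s; clear s; split; lra.
have [L1_ L2_ L3_ L4_ C0] := aux _ _ _ _ CV0 t1 t2 t3; rewrite -/C in L1_ L2_ L3_ L4_ C0.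
exists (Num.min e 1), C, b; split=> //; first by rewrite lt_min e0 ltr01.
move=> mu; rewrite le_min => /andP[mue mu1] muD.
have [[X [hX [fx1 fx2]]] _] := ex mu mue.
have bs := beta_sign sm hX; rewrite -/D in bs.
have [_ /bd0P/(_ 0) hbeta _] := hb X hX.
have [cA hA _] := h3 X hX; have [cV hV _] := h4 X hX.
set bt := beta S1 S2 k X in bs hbeta *.
(* Both [bt] and [mu] have the sign opposite to that of [D], so the amplitude can be a square root
   of their product. *)
have bm0 : 0 < bt * mu.
  have DD : 0 < D ^+ 2 by rewrite exprn_even_gt0.
  rewrite -(pmulr_lgt0 _ DD).
  have -> : bt * mu * D ^+ 2 = (bt * D) * (mu * D) by ring.
  by rewrite nmulr_rgt0.
pose a := Num.sqrt (bt * mu).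
have a0 : 0 < a by rewrite sqrtr_gt0.
have aa : a * a = bt * mu by rewrite -expr2 sqr_sqrtr // ltW.
have ale : `|a| <= sb * Num.sqrt `|mu|.
  rewrite (gtr0_norm a0) /a /sb -sqrtrM // ler_wsqrtr //.
  by apply: le_trans (ler_norm _) _; rewrite normrM ler_wpM2r.
pose BB x := X.1 x * X.1 x.
have cB := cls_c1 hX.
have cBB : continuous BB by exact: cont_mul.
have hB : bd b (f + 1) X.1 := cls_bd1 hX.
have f10 : 0 <= f + 1 by rewrite addr_ge0.
have hBB : bd b KB BB by exact: bd_mul0 hB (bd_weak f10 b0 hB).
have BBe x : BB (- x) = BB x by rewrite /BB (cls_odd hX) mulrNN.
have V2e x : V2f S1 S2 k X (- x) = V2f S1 S2 k X x by exact: V2_even hX.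
have A2o x : A2f S1 S2 k X (- x) = - A2f S1 S2 k X x by exact: A2_odd hX.
have [gB gB1] := bd_green b0 b1 cBB hBB (or_introl BBe).
have [gV gV1] := bd_green b0 b1 cV hV (or_introl V2e).
have [gA gA1] := bd_green b0 b2 cA hA (or_intror (conj A2o (A2_solvable b0 b1 d0 sm hX))).
have vE x : vf S1 S2 k X x = bt * green S1 BB x + mu * green S1 (V2f S1 S2 k X) x.
  by rewrite /vf fx2.
have BE x : X.1 x = phi S2 x + mu * green S2 (A2f S1 S2 k X) x by rewrite fx1.
pose V x := mu * (bt * green S1 BB x + mu * green S1 (V2f S1 S2 k X) x).
pose V1 x := mu * (bt * green1 S1 BB x + mu * green1 S1 (V2f S1 S2 k X) x).
pose A x := a * (phi S2 x + mu * green S2 (A2f S1 S2 k X) x).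
pose A1 x := a * (phi1 S2 x + mu * green1 S2 (A2f S1 S2 k X) x).
have VE x : V x = mu * vf S1 S2 k X x by rewrite vE.
have AE x : A x = a * X.1 x by rewrite BE.
have VrE x : Vrhs V A x = pot S1 x * V x - mu * (bt * BB x + mu * V2f S1 S2 k X x).
  have A2E : A x ^+ 2 = bt * mu * (X.1 x * X.1 x) by rewrite AE -aa; ring.
  have V2E : 2^-1 * V x ^+ 2 = mu * (mu * V2f S1 S2 k X x) by rewrite VE /V2f; ring.
  by rewrite /Vrhs A2E V2E /BB; congr (_ - _); ring.
have ArE x : Arhs mu V A x = pot S2 x * A x - a * (mu * A2f S1 S2 k X x).
  have E : (mu + k * V x) * A x = a * (mu * A2f S1 S2 k X x) by rewrite AE VE /A2f; ring.
  by rewrite /Arhs E.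
exists V, V1, A, A1; split.
- split; first split.
  + exact: (dv_scale mu (dv_add (dv_scale bt (dv_green S1 cBB)) (dv_scale mu (dv_green S1 cV)))).
  + exact: (dv_scale a (dv_add (dv_phi S2) (dv_scale mu (dv_green S2 cA)))).
  + have H := dv_scale mu (dv_add (dv_scale bt (dv_green1 S1 cBB)) (dv_scale mu (dv_green1 S1 cV))).
    apply: dv_eq H _ => x.
    by rewrite VrE /V; ring.
  + have H := dv_scale a (dv_add (dv_phi1 S2) (dv_scale mu (dv_green1 S2 cA))).
    apply: dv_eq H _ => x.
    by rewrite ArE /A; ring.
  + by move=> x; rewrite !VE (v_even S1 k x hX).
  + by move=> x; rewrite !AE (cls_odd hX) mulrN.
(* If [A] vanished, so would [X.1] and hence [Nn X], which is positive on the class. *)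
- apply: contrapT => H; have Z x : X.1 x = 0.
    apply: contrapT => /eqP xn; apply: H; exists x.
    by rewrite AE mulf_neq0 // lt0r_neq0.
  have [_ _] := sm X hX; rewrite /Nn /Jf.
  have E (h : R -> R) : (fun z => phi S2 z * (h z * X.1 z)) = (fun z => 0 * phi S2 z).
    by apply/funext => z; rewrite Z !mulr0 mul0r.
  rewrite E (_ : (fun z => phi S2 z * X.1 z) = (fun z => 0 * phi S2 z)); last first.
    by apply/funext => z; rewrite Z mulr0 mul0r.
  by rewrite (pinf_scale 0 r2 (dv_cont (dv_phi S2)) (bd_phi S2)) mul0r mulr0 addr0 ltxx.
- have smu (u c1 c2 : R) : 0 <= c1 -> 0 <= c2 -> `|bt| * c1 + `|mu| * c2 <= Cb * c1 + c2.
    move=> c10 c20; apply: lerD; first by rewrite ler_wpM2r.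
    by rewrite ler_piMl.
  have hV_ : bd b (CV * `|mu|) V.
    apply: bd_le (bd_scale mu (bd_add (bd_scale bt gB) (bd_scale mu gV))).
    by rewrite mulrC ler_wpM2r // smu // mulr_ge0.
  split.
  + by apply: bd_le hV_; rewrite ler_wpM2r.
  + apply: bd_le (bd_scale mu (bd_add (bd_scale bt gB1) (bd_scale mu gV1))).
    by rewrite mulrC ler_wpM2r //; apply: le_trans (smu 0 _ _ _ _) L1_; rewrite // mulr_ge0.
  rewrite (_ : Vrhs V A = (fun x => V x * pot S1 x - mu * (bt * BB x + mu * V2f S1 S2 k X x))); last first.
    by apply/funext => x; rewrite VrE [V x * _]mulrC.
  apply: bd_le (bd_add (bd_mul0 hV_ hp1) (bd_opp (bd_scale mu (bd_add (bd_scale bt hBB) (bd_scale mu hV))))).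
  apply: le_trans (_ : (CV * P1 + (Cb * KB + C4)) * `|mu| <= _); last by rewrite ler_wpM2r.
  rewrite [leRHS]mulrDl; apply: lerD; first by rewrite mulrAC.
  by rewrite mulrC ler_wpM2r // smu.
have mc (c c' : R) : 0 <= c' -> c + `|mu| * c' <= c + c' by move=> c'0; rewrite lerD2l ler_piMl.
have s0 := sqrtr_ge0 `|mu|.
have nf : 0 <= f + `|mu| * (G2 * C3) by apply: addr_ge0 => //; exact: mulr_ge0.
have hA_ : bd b (sb * CA * Num.sqrt `|mu|) A.
  apply: bd_le (bd_scale a (bd_add (bd_weight b2 f0 (bd_phi S2)) (bd_scale mu gA))).
  rewrite [leRHS]mulrAC; apply: ler_pM => //; exact: mc.
split.
- by apply: bd_le hA_; rewrite ler_wpM2r.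
- apply: bd_le (bd_scale a (bd_add (bd_weight b2 f0 (bd_phi1 S2)) (bd_scale mu gA1))).
  apply: le_trans (_ : sb * CA * Num.sqrt `|mu| <= _); last by rewrite ler_wpM2r.
  rewrite [leRHS]mulrAC; apply: ler_pM => //; exact: mc.
rewrite (_ : Arhs mu V A = (fun x => A x * pot S2 x - a * (mu * A2f S1 S2 k X x))); last first.
  by apply/funext => x; rewrite ArE [A x * _]mulrC.
apply: bd_le (bd_add (bd_mul0 hA_ hp2) (bd_opp (bd_scale a (bd_scale mu hA)))).
apply: le_trans (_ : sb * (CA * P2 + C3) * Num.sqrt `|mu| <= _); last by rewrite ler_wpM2r.
have -> : sb * (CA * P2 + C3) * Num.sqrt `|mu| = sb * CA * Num.sqrt `|mu| * P2 + sb * Num.sqrt `|mu| * C3 by ring.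
rewrite lerD2l; apply: ler_pM => //; first by rewrite mulr_ge0.
by rewrite ler_piMl.
Qed.
End Branch.

(** * Every small bounded solution comes from the fixed point *)

Section Uniqueness.
Variables (R : realType) (S1 S2 : fundsys R) (k : R).
Hypotheses (k0 : 0 < k) (gp : forall x, 0 < x -> 0 < phi S2 x).
Let D := Jf S2 (fun x => Y1f S1 (base S2) x * phi S2 x).
Hypothesis D0 : D != 0.
Implicit Types (V A : R -> R) (mu x : R).

(* Removes [A] from the right-hand side of [|A| <= p + o(1) |A|]. *)
Lemma absorb (f : R -> R) (p K0 : R) : bd 0 K0 f ->
  (forall K, bd 0 K f -> bd 0 (p + K / 2) f) -> bd 0 (2 * p) f.
Proof.
move=> h0 h; pose E := K0 + `|2 * p|.
have H n : bd 0 (2 * p + E / 2 ^+ n) f.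
  elim: n => [|n /h].
    apply: bd_le h0; rewrite expr0 divr1 /E.
    by have := ler_norm (- (2 * p)); rewrite normrN; lra.
  apply: bd_le; rewrite exprSr invfM.
  have -> : 2 * p + E * ((2 ^+ n)^-1 / 2) = p + (2 * p + E / 2 ^+ n) / 2 by field; rewrite expf_neq0.
  by [].
apply/bd0P => x; rewrite -subr_le0.
apply: (cvgr_to_ge (half_cvg0 E)); near=> n.
by have /bd0P/(_ x) := H n; rewrite lerBlDl.
Unshelve. all: by end_near. Qed.

Lemma odd_0 (f : R -> R) : (forall x, f (- x) = - f x) -> f 0 = 0.
Proof. by move=> /(_ 0); rewrite oppr0 => h; lra. Qed.

(** Subtracting [a * phi] from [A] leaves an odd function with zero derivative at [0], which
    [green_repr] writes as the Green operator applied to a source of size [|mu|] times [|A|].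
    Absorbing it bounds [A] by a multiple of [|a|]; thus [a] is nonzero and [A / a] is close to
    [phi]. The radius [e] is chosen before [K]. *)
Lemma sol_fixpt (M d : R) : 0 <= M -> 0 < d -> d <= 1 ->
  (forall X, cls S2 0 d X -> [/\ k * `|D| / 2 <= `|Dn S1 S2 k X|, 0 < Dn S1 S2 k X * D & 0 < Nn S2 k X]) ->
  exists2 e : R, 0 < e & forall mu, mu != 0 -> `|mu| <= e ->
    forall V V1 A A1 K, is_sol S1 S2 k mu V V1 A A1 ->
      bd 0 (M * `|mu|) V -> bd 0 K V1 -> bd 0 K A -> bd 0 K A1 -> (exists x, A x != 0) ->
      exists X a, [/\ cls S2 0 d X, fixpt S1 S2 k mu X, V =1 (fun x => mu * vf S1 S2 k X x),
        A =1 (fun x => a * X.1 x) & a * a = mu * beta S1 S2 k X].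
Proof.
move=> M0 d0 d1 sm; have r1 := rate_gt0 S1; have r2 := rate_gt0 S2.
have f0 := fsC_ge0 S2; set f := fsC S2 in f0 *.
have G10 := greenC_ge0 r1; set G1 := greenC S1 0 in G10 *.
have G20 := greenC_ge0 r2; set G2 := greenC S2 0 in G20 *.
have kM0 : 0 <= 1 + k * M by rewrite addr_ge0 ?mulr_ge0 // ltW.
pose kk := G2 * (1 + k * M).
have kk0 : 0 <= kk by rewrite mulr_ge0.
pose c2 := kk * (2 * f); pose c3 := G1 * (2^-1 * (M * M)).
have c20 : 0 <= c2 by apply: mulr_ge0 => //; exact: mulr_ge0.
have c30 : 0 <= c3 by apply: mulr_ge0 => //; apply: mulr_ge0; rewrite ?invr_ge0 ?mulr_ge0.
(* Three thresholds: absorption with factor [1 / 2], closeness of [B] to [phi], and size of [z]. *)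
pose e := Num.min (2^-1 / (kk + 1)) (Num.min (d / (c2 + 1)) (d / (c3 + 1))).
have p1 (c : R) : 0 <= c -> 0 < c + 1 by move=> c0; rewrite ltr_wpDl.
have e0 : 0 < e by rewrite /e !lt_min !divr_gt0 ?p1.
have sm1 (c t mu : R) : 0 <= c -> `|mu| <= t / (c + 1) -> c * `|mu| <= t.
  move=> c0; rewrite ler_pdivlMr ?p1 //; apply: le_trans.
  by rewrite mulrC ler_wpM2l // lerDl.
exists e => // mu mun mue V V1 A A1 K [[dV dA] dV1 dA1 Ve Ao] hV hV1 hA hA1 [x0 Ax0].
move: mue; rewrite !le_min => /andP[/(sm1 _ _ _ kk0) m1 /andP[/(sm1 _ _ _ c20) m2 /(sm1 _ _ _ c30) m3]].
have cV := dv_cont dV; have cA := dv_cont dA.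
have cg : continuous (phi S2) := dv_cont (dv_phi S2).
have hg : bd 0 f (phi S2) by apply: bd_weak (bd_phi S2) => //; exact: ltW.
have hg1 : bd 0 f (phi1 S2) by apply: bd_weak (bd_phi1 S2) => //; exact: ltW.
pose f2 x := (mu + k * V x) * A x.
have cmk : continuous (fun x => mu + k * V x).
  by apply: cont_add; [exact: cont_cst|exact: cont_scale].
have cf2 : continuous f2 by exact: cont_mul.
have hmk : bd 0 (`|mu| * (1 + k * M)) (fun x => mu + k * V x).
  have hc : bd 0 `|mu| (fun _ : R => mu) by apply/bd0P.
  apply: bd_le (bd_add hc (bd_scale k hV)); rewrite (gtr0_norm k0).
  by rewrite le_eqVlt; apply/orP; left; apply/eqP; ring.
have hf2 L : bd 0 L A -> bd 0 (`|mu| * (1 + k * M) * L) f2 by move=> hL; exact: bd_mul0.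
have f2o x : f2 (- x) = - f2 x by rewrite /f2 Ve Ao mulrN.
(* [kap] is the derivative of [phi] at [0], so [y1 0 = 0], as the representation by [green] demands;
   oddness gives [y 0 = 0], and with it solvability. *)
pose a := A1 0 / kap S2.
have kn : kap S2 != 0 := lt0r_neq0 (kap_gt0 S2).
pose y x := A x - a * phi S2 x; pose y1 x := A1 x - a * phi1 S2 x.
have dy : dv y y1 := dv_sub dA (dv_scale a (dv_phi S2)).
have dy1 : dv y1 (fun x => pot S2 x * y x - f2 x).
  apply: dv_eq (dv_sub dA1 (dv_scale a (dv_phi1 S2))) _ => x.
  by rewrite /Arhs /y /f2; ring.
pose KK := K + `|a| * f + `|mu| * (1 + k * M) * K.
have K0 := bd_ge0 hA.
have [q1 q2] : K + `|a| * f <= KK /\ `|mu| * (1 + k * M) * K <= KK.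
  rewrite /KK lerDl lerDr; split; first by rewrite !mulr_ge0.
  by rewrite addr_ge0 // mulr_ge0.
have hy : bd 0 KK y by apply: bd_le q1 _; apply: bd_add => //; apply: bd_opp; exact: bd_scale.
have hy1 : bd 0 KK y1 by apply: bd_le q1 _; apply: bd_add => //; apply: bd_opp; exact: bd_scale.
have y10 : y1 0 = 0 by rewrite /y1 phi1_0 /a divfK ?subrr.
have y0 : y 0 = 0 by rewrite /y phi_0 (odd_0 Ao) mulr0 subrr.
have yE := green_repr dy dy1 cf2 hy hy1 y10.
have sv := green_solvable dy dy1 cf2 hy hy1 y0.
have AE x : A x = a * phi S2 x + green S2 f2 x by rewrite -yE /y addrC subrK.
have hgr L : bd 0 L A -> bd 0 (kk * `|mu| * L) (green S2 f2).
  move=> hL; have [H _] := bd_green (lexx 0) r2 cf2 (hf2 L hL) (or_intror (conj f2o sv)).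
  by apply: bd_le H; rewrite -/G2 le_eqVlt; apply/orP; left; apply/eqP; rewrite /kk; ring.
have hA2 : bd 0 (2 * (`|a| * f)) A.
  apply: absorb hA _ => L hL; have L0 := bd_ge0 hL.
  have -> : A = (fun x => a * phi S2 x + green S2 f2 x) by apply/funext.
  apply: bd_le (bd_add (bd_scale a hg) (hgr L hL)); rewrite lerD2l.
  by rewrite [L / 2]mulrC ler_wpM2r.
have an : a != 0.
  apply/eqP => a00; move/eqP: Ax0; apply; apply/eqP; rewrite -normr_le0.
  by have /bd0P/(_ x0) := hA2; rewrite a00 normr0 mul0r mulr0.
have na0 : `|a| != 0 by rewrite normr_eq0.
pose B x := a^-1 * A x; pose v x := mu^-1 * V x.
have AB x : A x = a * B x by rewrite /B mulVKf.
have Vv x : V x = mu * v x by rewrite /v mulVKf.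
have cB : continuous B := @cont_scale R a^-1 _ cA.
have cv : continuous v := @cont_scale R mu^-1 _ cV.
have hv : bd 0 M v.
  apply: bd_le (bd_scale mu^-1 hV); rewrite normfV mulrCA mulVf ?mulr1 //.
  by rewrite normr_eq0.
have BE x : B x = phi S2 x + a^-1 * green S2 f2 x.
  by rewrite /B AE mulrDr mulKf.
have nearB : bd 0 d (fun x => B x - phi S2 x).
  have -> : (fun x => B x - phi S2 x) = (fun x => a^-1 * green S2 f2 x).
    by apply/funext => x; rewrite BE addrC addKr.
  apply: bd_le (bd_scale a^-1 (hgr _ hA2)); rewrite normfV.
  apply: le_trans m2; rewrite le_eqVlt; apply/orP; left; apply/eqP.
  by rewrite /c2; field.
pose W x := 2^-1 * (v x * v x).
have cW : continuous W by apply: cont_scale; exact: cont_mul.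
have hW : bd 0 (2^-1 * (M * M)) W.
  apply: bd_le (bd_scale 2^-1 (bd_mul0 hv hv)); rewrite ger0_norm //.
have We x : W (- x) = W x by rewrite /W /v !Ve.
have [gW _] := bd_green (lexx 0) r1 cW hW (or_introl We).
(* [z] is defined by its fixed point equation. It is the remainder of [v] after the multiple of
   [Y1f], because [V] is the Green operator applied to [mu^2 W + a^2 B^2]. *)
pose z x := mu * green S1 W x.
have cz : continuous z by apply: cont_scale; exact: green_cont.
have hz : bd 0 d z by apply: bd_le (bd_scale mu gW); rewrite mulrC.
have Bo x : B (- x) = - B x by rewrite /B Ao mulrN.
have hB : bd 0 (f + 1) B.
  have -> : B = (fun x => phi S2 x + (B x - phi S2 x)) by apply/funext => x; ring.
  by apply: bd_le (bd_add hg nearB); rewrite lerD2l.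
have hX : cls S2 0 d (B, z).
  by split=> //= x; rewrite /z (green_even S1 x cW We).
pose BB x := B x * B x.
have cBB : continuous BB by exact: cont_mul.
have hBB : bd 0 ((f + 1) * (f + 1)) BB by exact: (bd_mul0 hB hB).
pose h x := (mu * mu) * W x + (a * a) * BB x.
have ch : continuous h by apply: cont_add; exact: cont_scale.
have hE x : h x = 2^-1 * V x ^+ 2 + A x ^+ 2 by rewrite /h /W /BB AB Vv; ring.
have hhW := bd_scale (mu * mu) hW; have hhB := bd_scale (a * a) hBB.
have hh := bd_add hhW hhB.
set Kh := (_ + _) in hh.
have dV1' : dv V1 (fun x => pot S1 x * V x - h x).
  by apply: dv_eq dV1 _ => x; rewrite /Vrhs hE.
have V10 : V1 0 = 0.
  apply: odd_0 => x; have := dv_inj (dv_neg dV) dV Ve x => <-; by rewrite opprK.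
have Kh0 := bd_ge0 hh.
pose KV := M * `|mu| + K + Kh.
have [s1 s2 s3] : [/\ M * `|mu| <= KV, K <= KV & Kh <= KV].
  have Mm : 0 <= M * `|mu| by rewrite mulr_ge0.
  by rewrite /KV; clear -Mm K0 Kh0; split; lra.
have VE := green_repr dV dV1' ch (bd_le s1 hV) (bd_le s2 hV1) V10.
have {}VE x : V x = mu * mu * green S1 W x + a * a * green S1 BB x.
  rewrite VE (green_add S1 x (@cont_scale R (mu * mu) _ cW) (@cont_scale R (a * a) _ cBB) hhW hhB).
  by rewrite (green_scale S1 (mu * mu) x cW hW) (green_scale S1 (a * a) x cBB hBB).
pose bt := a * a / mu.
have vE x : v x = bt * Y1f S1 (B, z) x + z x.
  by rewrite /v VE /Y1f /z /bt /= -/BB; field.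
(* The source [f2] is orthogonal to [phi] by [sv]. By [Jf_expand] this condition is affine in [bt]
   with nonzero slope, so it determines [bt]. *)
have btE : bt = beta S1 S2 k (B, z).
  have n0 := Dn_neq0 sm hX.
  have := Jf_expand k (lexx 0) r1 bt (ltW d0) hX.
  rewrite (_ : (fun x => _) = (fun x => (1 + k * v x) * B x)); last by apply/funext => x; rewrite vE.
  have -> : Jf S2 (fun x => (1 + k * v x) * B x) = 0.
    have cvB : continuous (fun x => (1 + k * v x) * B x).
      by apply: cont_mul => //; apply: cont_add; [exact: cont_cst|exact: cont_scale].
    have hvB : bd 0 ((1 + `|k| * M) * (f + 1)) (fun x => (1 + k * v x) * B x).
      apply: bd_mul0 hB; apply: bd_add; last exact: bd_scale.
      by apply/bd0P => _; rewrite normr1.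
    have r20 : 0 < rate S2 + 0 by rewrite addr0.
    have := pinf_scale (mu * a) r20 (cont_mul cg cvB) (bd_phi_mul S2 hvB).
    rewrite (_ : (fun x => mu * a * _) = (fun x => phi S2 x * f2 x)); last first.
      by apply/funext => x; rewrite /f2 Vv AB; ring.
    by rewrite sv => E; apply: (mulfI (mulf_neq0 mun an)); rewrite mulr0 E.
  move=> /esym/eqP; rewrite addr_eq0 => /eqP E.
  by rewrite /beta E; field.
have vfE x : vf S1 S2 k (B, z) x = v x by rewrite vE /vf -btE.
exists (B, z), a; split => //.
- split => x /=; last first.
    by rewrite /z; congr (_ * green S1 _ x); apply/funext => t; rewrite /V2f !vfE.
  rewrite BE /F1; congr (_ + _).
  have cA2 : continuous (A2f S1 S2 k (B, z)).
    have -> : A2f S1 S2 k (B, z) = (fun x => (1 + k * v x) * B x).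
      by apply/funext => t; rewrite /A2f vfE.
    by apply: cont_mul => //; apply: cont_add; [exact: cont_cst|exact: cont_scale].
  have f2E : f2 = (fun x => (mu * a) * A2f S1 S2 k (B, z) x).
    by apply/funext => t; rewrite /f2 /A2f vfE Vv AB /=; ring.
  have hA2f : bd 0 ((1 + `|k| * M) * (f + 1)) (A2f S1 S2 k (B, z)).
    have -> : A2f S1 S2 k (B, z) = (fun x => (1 + k * v x) * B x).
      by apply/funext => t; rewrite /A2f vfE.
    apply: bd_mul0 hB; apply: bd_add; last exact: bd_scale.
    by apply/bd0P => _; rewrite normr1.
  by rewrite f2E (green_scale S2 (mu * a) x cA2 hA2f); field.
- by move=> x; rewrite vfE.
- by rewrite -btE /bt; field.
Qed.

(** Both solutions rescale to the same fixed point, and their amplitudes have the same square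
    [mu * beta X]; only the sign of the amplitude remains free. *)
Lemma sol_unique (M : R) : 0 <= M -> exists2 e : R, 0 < e & forall mu, mu != 0 -> `|mu| <= e ->
  forall V V1 A A1 W W1 B B1 K, is_sol S1 S2 k mu V V1 A A1 -> is_sol S1 S2 k mu W W1 B B1 ->
    bd 0 (M * `|mu|) V -> bd 0 K V1 -> bd 0 K A -> bd 0 K A1 -> (exists x, A x != 0) ->
    bd 0 (M * `|mu|) W -> bd 0 K W1 -> bd 0 K B -> bd 0 K B1 -> (exists x, B x != 0) ->
    V =1 W /\ (A =1 B \/ A =1 (fun x => - B x)).
Proof.
move=> M0; have r1 := rate_gt0 S1; have r2 := rate_gt0 S2.
have [d /andP[d0 d1] sm] := small_class k0 (lexx 0) r1 r2 gp D0.
have [e e0 fx] := fixpt_exists k0 (lexx 0) r1 r2 D0 d0 d1 sm.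
have [e' e'0 sf] := sol_fixpt M0 d0 d1 sm.
exists (Num.min e e'); first by rewrite lt_min e0.
move=> mu mun; rewrite le_min => /andP[me me'].
move=> V V1 A A1 W W1 B B1 K sV sW hV hV1 hA hA1 nA hW hW1 hB hB1 nB.
have [X [a [hX fX EV EA aE]]] := sf mu mun me' V V1 A A1 K sV hV hV1 hA hA1 nA.
have [Y [b [hY fY EW EB bE]]] := sf mu mun me' W W1 B B1 K sW hW hW1 hB hB1 nB.
have [_ /(_ X Y hX hY fX fY) [E1 E2]] := fx mu me.
have XY : X = Y by case: X Y E1 E2 {hX fX EV EA aE hY fY EW EB bE} => [p q] [p' q'] /= /funext -> /funext ->.
subst Y; split; first by move=> x; rewrite EV EW.
have /eqP : a * a = b * b by rewrite aE bE.
rewrite -!expr2 eqf_sqr => /orP[] /eqP ab; [left|right] => x; rewrite EA EB ab //.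
by rewrite mulNr.
Qed.
End Uniqueness.

(** * The operators of the theorem, and weak versus classical solutions *)

Section Concrete.
Variables (R : realType) (c k : R).
Hypotheses (hc : 0 < c) (hk : 6^-1 < k).
Notation mu := (@lebesgue_measure R).
Implicit Types (u v f : R -> R) (x m : R).

(** [wD] is a chosen representative, so its additivity holds only almost everywhere and comes from
    uniqueness of weak derivatives. *)
Lemma H2_sub u v : H2 u -> H2 v -> H2 (fun x => u x - v x) /\
  \forall x \ae mu, wD (wD (fun x => u x - v x)) x = wD (wD u) x - wD (wD v) x.
Proof.
move=> hu hv; have [A B LA LB] := H2_wD hu; have [A' B' LA' LB'] := H2_wD hv.
have L2B f g : inL2 f -> inL2 g -> inL2 (fun x => f x - g x).
  move=> /inL2P[mf If] /inL2P[mg Ig].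
  have md : measurable_fun [set: R] (fun x => f x - g x) by exact: measurable_realfun.measurable_funB.
  apply/inL2P; split => //.
  have Is := integrableZl measurableT 2 (integrableD measurableT If Ig).
  apply: le_integrable Is => //.
    by apply/measurable_realfun.measurable_EFinP; exact: measurable_realfun.measurable_funX.
  move=> x _ /=; rewrite lee_fin ger0_norm ?sqr_ge0 // ger0_norm; last first.
    by rewrite mulr_ge0 // addr_ge0 ?sqr_ge0.
  by have := sqr_ge0 (f x + g x); rewrite !expr2; lra.
have WA := weak_sub A A'; have WB := weak_sub B B'.
split; last by have [_ _ _ E] := wD_spec2 WA WB; apply: ae_imp E.
split; first exact: L2B (proj1 hu) (proj1 hv).
exists (fun x => wD u x - wD v x), (fun x => wD (wD u) x - wD (wD v) x).
by split => //; exact: L2B.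
Qed.

Let kp : R := Num.sqrt c / 2.

Lemma kp_gt0 : 0 < kp. Proof. by rewrite divr_gt0 // sqrtr_gt0. Qed.

Lemma kp_sqr : c = 4 * kp ^+ 2.
Proof. by rewrite /kp exprMn sqr_sqrtr ?ltW //; field. Qed.

Lemma k_gt0 : 0 < k. Proof. by apply: lt_trans hk; rewrite invr_gt0. Qed.

Lemma disc_sqr : Num.sqrt (1 + 48 * k) ^+ 2 = 1 + 48 * k.
Proof. by rewrite sqr_sqrtr // addr_ge0 // mulr_ge0 // ltW // k_gt0. Qed.

(** [k > 1/6] amounts to [1 + 48 k > 9]: the condition for [gtilde] to decay. *)
Lemma qexp_gt0 : 0 < qexp k.
Proof.
rewrite divr_gt0 // subr_gt0 -[3]ger0_norm // -sqrtr_sqr ltr_sqrt //.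
  by have := hk; rewrite expr2; lra.
by rewrite addr_gt0 // mulr_gt0 // k_gt0.
Qed.

(** Matches [k U0 = 12 k kp^2 sech^2] with the Poeschl-Teller coefficient [(q + 1) (q + 2) kp^2]. *)
Lemma qexpE : 12 * k = (qexp k + 1) * (qexp k + 2).
Proof.
have := disc_sqr; rewrite /qexp => E.
have -> : ((Num.sqrt (1 + 48 * k) - 3) / 2 + 1) * ((Num.sqrt (1 + 48 * k) - 3) / 2 + 2)
  = (Num.sqrt (1 + 48 * k) ^+ 2 - 1) / 4 by field.
by rewrite E; field.
Qed.

(** For [q = 2] the potential is [c - U0] and [phi] is proportional to [U0'], the odd kernel of
    [L1]. *)
Definition sysU : fundsys R := hsys kp_gt0 (ltr0Sn R 1).
Definition sysA : fundsys R := hsys kp_gt0 qexp_gt0.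

Lemma phi_sysA : phi sysA = gtilde c k.
Proof. by apply/funext => x; rewrite /gtilde spowE; reflexivity. Qed.

Lemma U0E x : U0 c x = 3 * c * (1 - tnh kp x ^+ 2).
Proof. by rewrite /U0 -/kp sech_sqr. Qed.

Lemma pot_sysU x : pot sysU x = c - U0 c x.
Proof.
rewrite U0E (_ : pot sysU x = hpot kp 2 x); last by reflexivity.
by rewrite /hpot kp_sqr; ring.
Qed.

Lemma pot_sysA x : pot sysA x = - Omega_c c k - k * U0 c x.
Proof.
rewrite U0E; transitivity (kp ^+ 2 * (qexp k ^+ 2 - (12 * k) * (1 - tnh kp x ^+ 2))).
  by rewrite qexpE.
by rewrite /Omega_c kp_sqr /qexp; field.
Qed.

Lemma bd_pot (q : R) : 0 < q -> exists P, bd 0 P (hpot kp q).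
Proof.
move=> q0; exists (`|kp ^+ 2| * (q ^+ 2 + (q + 1) * (q + 2) * 2)); apply/bd0P => x.
rewrite normrM ler_wpM2l //.
have q1 : 0 <= (q + 1) * (q + 2) by rewrite mulr_ge0 // addr_ge0 // ltW.
apply: le_trans (ler_normB _ _) _.
rewrite [X in _ + X]normrM (ger0_norm q1) (ger0_norm (sqr_ge0 q)).
rewrite lerD2l ler_wpM2l // ger0_norm; last by rewrite -sech_sqr sqr_ge0.
by have := sqr_ge0 (tnh kp x); lra.
Qed.

Lemma gtilde_gt0 x : 0 < x -> 0 < phi sysA x.
Proof.
move=> x0.
rewrite (_ : phi sysA x = spow kp (qexp k) x * tnh kp x); last by reflexivity.
rewrite mulr_gt0 ?expR_gt0 // tnhE divr_gt0 ?chs_gt0 //.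
have y0 : 0 < kp * x by rewrite mulr_gt0 // kp_gt0.
by rewrite subr_gt0 ltr_expR; lra.
Qed.

Definition U01 x : R := 3 * c * (- (2 * kp) * tnh kp x * spow kp 2 x).
Definition U02 x : R := c * U0 c x - 2^-1 * U0 c x ^+ 2.

Lemma U0_spow x : U0 c x = 3 * c * spow kp 2 x.
Proof. by rewrite /U0 -[sech _ ^+ 2]powR_mulrn ?spowE // ltW // sech_gt0. Qed.

Lemma dv_U0 : dv (U0 c) U01.
Proof. by apply: dv_ext (dv_scale (3 * c) (dv_spow kp 2)) _ => x; rewrite U0_spow. Qed.

Lemma dv_U01 : dv U01 U02.
Proof.
have H := dv_scale (3 * c * (- (2 * kp))) (dv_mul (dv_tnh kp) (dv_spow kp 2)).
apply: dv_eq (dv_ext H _) _ => x; first by rewrite /U01; ring.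
rewrite /U02 !U0_spow.
have -> : spow kp 2 x = 1 - tnh kp x ^+ 2.
  by rewrite -sech_sqr -powR_mulrn ?spowE // ltW // sech_gt0.
by rewrite kp_sqr; field.
Qed.

Lemma cont_U0 : continuous (U0 c). Proof. exact: dv_cont dv_U0. Qed.

Lemma cont_U02 : continuous U02.
Proof.
have -> : U02 = (fun x => c * U0 c x - 2^-1 * (U0 c x * U0 c x)).
  by apply/funext => x; rewrite /U02 expr2.
by apply: cont_sub; apply: cont_scale; [|apply: cont_mul]; exact: cont_U0.
Qed.

Lemma U0_even x : U0 c (- x) = U0 c x.
Proof. by rewrite !U0_spow spow_even. Qed.

Lemma bd_U0 : exists P, [/\ bd (2 * kp) P (U0 c), bd (2 * kp) P U01 & bd (2 * kp) P U02].
Proof.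
have k2 : 0 <= 2 * kp by rewrite mulr_ge0 // ltW // kp_gt0.
have hs := bd_spow kp_gt0 (ler0n R 2); set E := expR _ in hs.
have E0 : 0 <= E := bd_ge0 hs.
have h0 : bd (2 * kp) (`|3 * c| * E) (U0 c).
  have -> : U0 c = (fun x => 3 * c * spow kp 2 x) by apply/funext => x; exact: U0_spow.
  exact: bd_scale.
have h1 : bd (2 * kp) (`|3 * c * - (2 * kp)| * (E * 1)) U01.
  have -> : U01 = (fun x => 3 * c * - (2 * kp) * (spow kp 2 x * tnh kp x)).
    by apply/funext => x; rewrite /U01; ring.
  by apply: bd_scale; apply: bd_mul0 hs _; exact: bd_tnh.
set a0 := `|3 * c| * E in h0; set a1 := (X in bd _ X U01) in h1.
have a00 := bd_ge0 h0; have a10 := bd_ge0 h1.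
have h2 : bd (2 * kp) (`|c| * a0 + `|2^-1| * (a0 * a0)) U02.
  have -> : U02 = (fun x => c * U0 c x - 2^-1 * (U0 c x * U0 c x)).
    by apply/funext => x; rewrite /U02 expr2.
  apply: bd_add; first exact: bd_scale.
  by apply: bd_opp; apply: bd_scale; apply: bd_mul0 => //; exact: bd_weak h0.
have a20 := bd_ge0 h2; set a2 := (_ + _) in h2 a20.
exists (a0 + a1 + a2); clearbody a0 a1 a2.
by split; [apply: bd_le h0|apply: bd_le h1|apply: bd_le h2]; lra.
Qed.

Lemma H2_U0 : H2 (U0 c) /\ \forall x \ae mu, wD (wD (U0 c)) x = U02 x.
Proof.
have [P [h0 h1 h2]] := bd_U0.
have k2 : 0 < 2 * kp by rewrite mulr_gt0 // kp_gt0.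
by have [] := H2_classical k2 dv_U0 dv_U01 cont_U02 h0 h1 h2.
Qed.

Let f0 x : R := gtilde c k x ^+ 2.
Let W : R -> R := green sysU f0.

Lemma f0E x : f0 x = phi sysA x * phi sysA x.
Proof. by rewrite /f0 phi_sysA expr2. Qed.

Lemma cont_f0 : continuous f0.
Proof.
have -> : f0 = (fun x => phi sysA x * phi sysA x) by apply/funext; exact: f0E.
by apply: cont_mul; exact: dv_cont (dv_phi sysA).
Qed.

Lemma f0_even x : f0 (- x) = f0 x.
Proof. by rewrite !f0E phi_odd mulrNN. Qed.

Lemma bd_f0 b : 0 <= b -> b < rate sysA -> bd b (fsC sysA * fsC sysA) f0.
Proof.
move=> b0 b1; have -> : f0 = (fun x => phi sysA x * phi sysA x) by apply/funext; exact: f0E.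
have C0 := fsC_ge0 sysA.
apply: bd_mul0; first by apply: bd_weak (bd_phi sysA) => //; exact: ltW.
by apply: bd_weak (bd_phi sysA) => //; exact: ltW (rate_gt0 sysA).
Qed.

Let b : R := Num.min (rate sysU) (rate sysA) / 2.

Let b_spec : [/\ 0 < b, b < rate sysU & b < rate sysA].
Proof.
have m0 : 0 < Num.min (rate sysU) (rate sysA) by rewrite lt_min !rate_gt0.
have : b < Num.min (rate sysU) (rate sysA) by rewrite /b; lra.
by rewrite lt_min => /andP[? ?]; split => //; rewrite divr_gt0.
Qed.

Lemma L1inv_exists : H2even W /\ L1 c W = f0 %[ae mu].
Proof.
have [b0 b1 b2] := b_spec; have cf := cont_f0; have hf := bd_f0 (ltW b0) b2.
have [g0 g1] := bd_green (ltW b0) b1 cf hf (or_introl f0_even).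
have [P hP] := bd_pot (ltr0Sn R 1).
have d0 := dv_green sysU cf; have d1 := dv_green1 sysU cf.
have g2 := bd_add (bd_mul0 g0 hP) (bd_opp hf).
set M0 := greenC sysU b * _ in g0 g1 g2; set M2 := (_ + _) in g2.
have M00 := bd_ge0 g0; have M20 := bd_ge0 g2.
have c2 : continuous (fun x => pot sysU x * green sysU f0 x - f0 x).
  by apply: cont_sub => //; apply: cont_mul; [exact: cont_pot|exact: dv_cont d0].
have g2' : bd b (M0 + M2) (fun x => pot sysU x * green sysU f0 x - f0 x).
  have -> : (fun x => pot sysU x * green sysU f0 x - f0 x) = (fun x => green sysU f0 x * hpot kp 2 x - f0 x).
    by apply/funext => x; rewrite mulrC.
  by apply: bd_le g2; rewrite lerDr.
have M0le : M0 <= M0 + M2 by rewrite lerDl.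
have [hW _ e2 _] := H2_classical b0 d0 d1 c2 (bd_le M0le g0) (bd_le M0le g1) g2'.
split.
  split => //; apply/aeE; apply: ae_imp e2 => x _; exact: green_even cf f0_even.
apply/aeE; apply: ae_imp e2 => x e.
by rewrite /L1 e pot_sysU /W; ring.
Qed.

(** The even [C^1] representative has zero derivative at [0], which excludes the odd kernel, and is
    bounded by Sobolev; [green_repr] then determines it. *)
Lemma L1inv_unique u : H2even u -> L1 c u = f0 %[ae mu] -> \forall x \ae mu, u x = W x.
Proof.
move=> [hu eu] /aeE Lu; have [y [y1 rp]] := H2_rep hu; have [dy cy1 e0 e1 _] := rp.
have cy := dv_cont dy; have cf := cont_f0.
pose F x := pot sysU x * y x - f0 x.
have cF : continuous F by apply: cont_sub => //; apply: cont_mul => //; exact: cont_pot.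
have eF : \forall x \ae mu, wD (wD u) x = F x.
  apply: ae_imp (ae_and Lu e0) => x [l E]; rewrite /F -E pot_sysU -l /L1; ring.
have d1 := C1rep_dv hu rp cF eF; have [h0 h1] := C1rep_bound hu rp cF eF.
have ye := C1rep_even rp eu.
have y10 : y1 0 = 0.
  by apply: odd_0 => x; rewrite -(dv_inj (dv_neg dy) dy ye x) opprK.
apply: ae_imp e0 => x ->.
exact: (green_repr dy d1 cf h0 h1 y10 x).
Qed.

Definition DD : R := Jf sysA (fun x => Y1f sysU (base sysA) x * phi sysA x).

(** [L1inv] is a choice, so it is first identified almost everywhere with the Green operator; the
    integrand is then even, and the factor [2] passes to the half-line. *)
Lemma ip_L1inv : ip f0 (L1inv c f0) = 2 * DD.
Proof.
have [b0 b1 b2] := b_spec; have cf := cont_f0; have hf := bd_f0 (ltW b0) b2.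
have [WE WL] := L1inv_exists.
have [iE iL] : H2even (L1inv c f0) /\ L1 c (L1inv c f0) = f0 %[ae mu].
  by apply: (@xgetPex _ _ [set u | H2even u /\ L1 c u = f0 %[ae mu]]); exists W.
have e := L1inv_unique iE iL.
have [A _ _ _] := H2_wD (proj1 iE); have [mi _] := weak_meas A.
have cW : continuous W := @green_cont R sysU f0 cf.
have ef : \forall x \ae mu, f0 x = f0 x by apply: ae_imp e.
rewrite (ip_ae (cont_meas cf) (cont_meas cf) mi (cont_meas cW) ef e).
have [g0 _] := bd_green (ltW b0) b1 cf hf (or_introl f0_even).
rewrite /ip (even_integral b0 (cont_mul cf cW) (bd_mul0 hf (bd_weak (bd_ge0 g0) (ltW b0) g0))); last first.
  by move=> x; rewrite f0_even /W green_even //; exact: f0_even.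
congr (2 * _); rewrite /DD.
have -> : Y1f sysU (base sysA) = green sysU f0.
  by congr green; apply/funext => x; rewrite f0E.
rewrite /Jf.
congr pinf; apply/funext => x; rewrite /W.
by rewrite [f0 x]f0E; ring.
Qed.

(* The [C^1] representatives of a weak solution are classical solutions, by
   bootstrapping through the equations. *)
Lemma solution_classical Omega (U A : R -> R) : nontrivial_solution c k 1 Omega U A ->
  exists V V1 B B1, [/\ is_sol sysU sysA k (Omega - Omega_c c k) V V1 B B1,
    \forall x \ae mu, U x = U0 c x + V x, \forall x \ae mu, A x = B x, exists x, B x != 0 &
    (bd 0 (Num.sqrt 2 * H2norm (fun x => U x - U0 c x)) V /\
     bd 0 (Num.sqrt 2 * H2norm (fun x => U x - U0 c x)) V1) /\
    (bd 0 (Num.sqrt 2 * H2norm A) B /\ bd 0 (Num.sqrt 2 * H2norm A) B1)].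
Proof.
move=> [[hU eU] [hA oA] nA [/aeE s1 /aeE s2]].
have [hU0 eU0] := H2_U0; have [hu e2u] := H2_sub hU hU0.
set u := (fun x => U x - U0 c x) in hu e2u *.
have [V [V1 rV]] := H2_rep hu; have [B [B1 rB]] := H2_rep hA.
have [dV cV1 eV _ _] := rV; have [dB cB1 eB _ _] := rB.
have cV := dv_cont dV; have cB := dv_cont dB.
have EU : \forall x \ae mu, U x = U0 c x + V x.
  by apply: ae_imp eV => x; rewrite /u => <-; rewrite addrC subrK.
have csq (h : R -> R) : continuous h -> continuous (fun x => h x ^+ 2).
  move=> ch; have -> : (fun x => h x ^+ 2) = (fun x => h x * h x); last exact: cont_mul.
  by apply/funext => z; rewrite expr2.
have cVr : continuous (Vrhs sysU V B).
  apply: cont_sub; first by apply: cont_mul => //; exact: cont_pot.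
  by apply: cont_add; [apply: cont_scale|]; exact: csq.
have cAr : continuous (Arhs sysA k (Omega - Omega_c c k) V B).
  apply: cont_sub; first by apply: cont_mul => //; exact: cont_pot.
  by apply: cont_mul => //; apply: cont_add; [exact: cont_cst|exact: cont_scale].
have eVr : \forall x \ae mu, wD (wD u) x = Vrhs sysU V B x.
  apply: ae_imp (ae_and e2u (ae_and eU0 (ae_and s1 (ae_and EU eB)))) => x [-> [-> [h [EUx EBx]]]].
  by rewrite /Vrhs pot_sysU /U02; rewrite EUx EBx in h; move: h; set w := wD (wD U) x => h; lra.
have eAr : \forall x \ae mu, wD (wD A) x = Arhs sysA k (Omega - Omega_c c k) V B x.
  apply: ae_imp (ae_and s2 (ae_and EU eB)) => x [h [EUx EBx]].
  by rewrite /Arhs pot_sysA; rewrite EUx EBx in h; move: h; set w := wD (wD A) x => h; lra.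
have eu : (fun x => u (- x)) = u %[ae mu].
  by apply/aeE; move/aeE : eU; apply: ae_imp => x; rewrite /u U0_even => ->.
exists V, V1, B, B1; split => //.
- split; [split => //|exact: C1rep_dv hu rV cVr eVr|exact: C1rep_dv hA rB cAr eAr| |].
    exact: C1rep_even rV eu.
  exact: C1rep_odd rB oA.
- apply: contrapT => H; apply: nA; apply/aeE; apply: ae_imp eB => x ->.
  by apply: contrapT => /eqP Bx; apply: H; exists x.
- by split; [exact: C1rep_bound hu rV cVr eVr|exact: C1rep_bound hA rB cAr eAr].
Qed.

Lemma classical_solution (e : R) Omega V V1 A A1 : 0 < e ->
  is_sol sysU sysA k (Omega - Omega_c c k) V V1 A A1 -> (exists x, A x != 0) ->
  forall M N, [/\ bd e M V, bd e M V1 & bd e M (Vrhs sysU V A)] ->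
  [/\ bd e N A, bd e N A1 & bd e N (Arhs sysA k (Omega - Omega_c c k) V A)] ->
  [/\ nontrivial_solution c k 1 Omega (fun x => U0 c x + V x) A,
      H2norm (fun x => U0 c x + V x - U0 c x) <= M * Num.sqrt (3 / e) &
      H2norm A <= N * Num.sqrt (3 / e)].
Proof.
move=> e0 [[dV dA] dV1 dA1 Ve Ao] [x0 Ax0] M N [v0 v1 v2] [a0 a1 a2].
have cV := dv_cont dV; have cA := dv_cont dA.
have csq (h : R -> R) : continuous h -> continuous (fun x => h x ^+ 2).
  move=> ch; have -> : (fun x => h x ^+ 2) = (fun x => h x * h x); last exact: cont_mul.
  by apply/funext => z; rewrite expr2.
have cVr : continuous (Vrhs sysU V A).
  apply: cont_sub; first by apply: cont_mul => //; exact: cont_pot.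
  by apply: cont_add; [apply: cont_scale|]; exact: csq.
have cAr : continuous (Arhs sysA k (Omega - Omega_c c k) V A).
  apply: cont_sub; first by apply: cont_mul => //; exact: cont_pot.
  by apply: cont_mul => //; apply: cont_add; [exact: cont_cst|exact: cont_scale].
have [hV _ eV nV] := H2_classical e0 dV dV1 cVr v0 v1 v2.
have [hA _ eA nA] := H2_classical e0 dA dA1 cAr a0 a1 a2.
have [P [p0 p1 p2]] := bd_U0.
(* [U0] decays at rate [2 * kp] and [V] at rate [e]; their sum is controlled at the smaller one. *)
pose r := Num.min e (2 * kp).
have k2 : 0 < 2 * kp by rewrite mulr_gt0 // kp_gt0.
have r0 : 0 < r by rewrite /r lt_min e0.
have re : r <= e by rewrite /r ge_min lexx.
have rk : r <= 2 * kp by rewrite /r ge_min lexx orbT.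
have M0 := bd_ge0 v0; have P0 := bd_ge0 p0.
have q0 := bd_add (bd_weak P0 rk p0) (bd_weak M0 re v0).
have q1 := bd_add (bd_weak P0 rk p1) (bd_weak M0 re v1).
have q2 := bd_add (bd_weak P0 rk p2) (bd_weak M0 re v2).
have [hU _ eU _] := H2_classical r0 (dv_add dv_U0 dV) (dv_add dv_U01 dV1)
  (cont_add cont_U02 cVr) q0 q1 q2.
have EV : (fun x => U0 c x + V x - U0 c x) = V by apply/funext => x; rewrite addrC addKr.
rewrite EV; split => //; split.
- by split => //; apply/aeE; apply: ae_imp eU => x _; rewrite U0_even Ve.
- by split => //; apply/aeE; apply: ae_imp eA => x _; rewrite Ao.
- move=> /aeE /(cont_ae_eq cA (@cont_cst R 0)) /(_ x0) E.
  by move: Ax0; rewrite E eqxx.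
split; apply/aeE.
- by apply: ae_imp eU => x ->; rewrite /U02 /Vrhs pot_sysU; field.
- by apply: ae_imp eA => x ->; rewrite /Arhs pot_sysA; ring.
Qed.
End Concrete.

Theorem proposition5 (R : realType) (c k s : R)
  (hc : 0 < c) (hk : 6^-1 < k) (hs : s = Num.sg k)
  (hL : ip (fun x => gtilde c k x ^+ 2)
           (L1inv c (fun x => gtilde c k x ^+ 2)) != 0) :
  exists eps C : R, [/\ 0 < eps, 0 < C &
    forall Omega : R, Omega < 0 ->
      0 < `|Omega - Omega_c c k| < eps ->
      Num.sg (Omega - Omega_c c k)
        = - Num.sg (ip (fun x => gtilde c k x ^+ 2)
                       (L1inv c (fun x => gtilde c k x ^+ 2))) ->
      exists U A : R -> R,
        [/\ nontrivial_solution c k s Omega U A,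
            H2norm (fun x => U x - U0 c x) <= C * `|Omega - Omega_c c k|,
            H2norm A <= C * Num.sqrt `|Omega - Omega_c c k| &
            forall U' A' : R -> R,
              nontrivial_solution c k s Omega U' A' ->
              H2norm (fun x => U' x - U0 c x) <= C * `|Omega - Omega_c c k| ->
              H2norm A' <= C * Num.sqrt `|Omega - Omega_c c k| ->
              U' = U %[ae lmeas R] /\
              (A' = A %[ae lmeas R] \/ A' = (fun x => - A x) %[ae lmeas R])]].
Proof.
have k0 := k_gt0 hk.
have s1 : s = 1 by rewrite hs gtr0_sg.
rewrite s1 !(ip_L1inv hc hk) in hL *.
set S1 := sysU hc; set S2 := sysA hc hk.
have D0 : DD hc hk != 0 by move: hL; rewrite mulf_eq0 negb_or => /andP[].
have [P1 hP1] := bd_pot c (ltr0Sn R 1).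
have [P2 hP2] := bd_pot c (qexp_gt0 hk).
have gp : forall x, 0 < x -> 0 < phi S2 x by move=> x; exact: gtilde_gt0.
have [e1 [C1 [b [e10 C10 b0 ex]]]] := @branch_exists R S1 S2 k k0 gp D0 P1 P2 hP1 hP2.
(* The square root converts weighted bounds into [H2] norms, and the [+ 1] makes [C] positive. *)
pose C : R := C1 * Num.sqrt (3 / b) + 1.
have C0 : 0 < C by rewrite ltr_wpDl // mulr_ge0 ?sqrtr_ge0 // ltW.
have leC t : 0 <= t -> C1 * t * Num.sqrt (3 / b) <= C * t.
  by move=> t0; rewrite mulrAC ler_wpM2r // lerDl.
have M0 : 0 <= Num.sqrt 2 * C by rewrite mulr_ge0 ?sqrtr_ge0 // ltW.
(* [Num.sqrt 2] is the Sobolev factor of [C1rep_bound]. The radius [e2] depends on [C], which is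
   already fixed. *)
have [e2 e20 un] := @sol_unique R S1 S2 k k0 gp D0 (Num.sqrt 2 * C) M0.
exists (Num.min e1 e2), C; split => //; first by rewrite lt_min e10.
move=> Omega _; set m := Omega - Omega_c c k => /andP[m0].
rewrite lt_min => /andP[/ltW me1 /ltW me2] sgm.
have mn : m != 0 by rewrite -normr_gt0.
have mD : m * DD hc hk < 0.
  rewrite -sgr_lt0 sgrM sgm sgrM gtr0_sg // mul1r mulNr -expr2 sqr_sg D0.
  by rewrite oppr_lt0.
have [V [V1 [A [A1 [sol nz bV bA]]]]] := ex m me1 mD.
have [ns nU nA] := classical_solution b0 sol nz bV bA.
have {}nU := le_trans nU (leC _ (normr_ge0 m)).
have {}nA := le_trans nA (leC _ (sqrtr_ge0 _)).
exists (fun x => U0 c x + V x), A; split => // U' A' ns' nU' nA'.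
(* The constructed solution is treated like its competitor, through its [H2] norm, so that both
   satisfy the same sup bounds. *)
have [W [W1 [B [B1 [sW EU EA nB [[hW hW1] [hB hB1]]]]]]] := solution_classical hc hk ns.
have [W' [W1' [B' [B1' [sW' EU' EA' nB' [[hW' hW1'] [hB' hB1']]]]]]] := solution_classical hc hk ns'.
have r2 := sqrtr_ge0 (2 : R).
have bdW f : forall u, H2norm u <= C * `|m| -> bd 0 (Num.sqrt 2 * H2norm u) f ->
    bd 0 (Num.sqrt 2 * C * `|m|) f.
  by move=> u hu; apply: bd_le; rewrite -mulrA ler_wpM2l.
(* One finite bound for the derivatives and for the odd components of both solutions. *)
pose K := Num.sqrt 2 * C * `|m| + Num.sqrt 2 * (C * Num.sqrt `|m|).
have bdK f : bd 0 (Num.sqrt 2 * C * `|m|) f -> bd 0 K f.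
  by apply: bd_le; rewrite lerDl !mulr_ge0 ?sqrtr_ge0 // ltW.
have bdA f : forall u, H2norm u <= C * Num.sqrt `|m| -> bd 0 (Num.sqrt 2 * H2norm u) f -> bd 0 K f.
  move=> u hu; apply: bd_le; apply: le_trans (ler_wpM2l r2 hu) _.
  by rewrite lerDr !mulr_ge0 // ltW.
have [EV EAB] := un m mn me2 _ _ _ _ _ _ _ _ K sW' sW
  (bdW _ _ nU' hW') (bdK _ (bdW _ _ nU' hW1')) (bdA _ _ nA' hB') (bdA _ _ nA' hB1') nB'
  (bdW _ _ nU hW) (bdK _ (bdW _ _ nU hW1)) (bdA _ _ nA hB) (bdA _ _ nA hB1) nB.
split; first by apply/aeE; apply: ae_imp (ae_and EU EU') => x [-> ->]; rewrite EV.
case: EAB => E; [left|right]; apply/aeE; apply: ae_imp (ae_and EA EA') => x [-> ->]; exact: E.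
Qed.
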